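(* Let $k$ be an algebraically closed field of characteristic $p>2$, let $\mathfrak g$ be the Heisenberg Lie algebra of dimension $3$ over $k$, i.e. $\mathfrak g=\langle x,y,z\mid [x,y]=z,\ [z,x]=[z,y]=0,\ x^{[p]}=y^{[p]}=z^{[p]}=0\rangle$, and let $A=u(\mathfrak g)$. There exists $t\in\mathscr N(\mathfrak g)$ of order $1$ such that, for $\mathfrak p=\mathfrak p(t)\in\mathscr X(A)$, there exists an isotropy $\varphi\in\Omega(A,\mathfrak p)$ for which $$V\,\widetilde\otimes\,V\not\cong V\,\widetilde\otimes^{\varphi}\,V,$$ where $V=V_{1,\mathfrak g}(t)$. Further, $\mathfrak g$ is unipotent (i.e. $u(\mathfrak g)$ is a local ring) and therefore $\mathscr X(A,V)=\{\mathfrak p\}$. So $\mathfrak g$ does not satisfy Property PA.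
   Context: **Hopf structures.** $k$ is an algebraically closed field of characteristic $p>0$. For a finite-dimensional restricted Lie algebra $\mathfrak g$ over $k$, let $A=u(\mathfrak g)$ be its restricted enveloping algebra, with the augmentation $A\to k$ killing $\mathfrak g$. $\widetilde\Delta$ denotes the comultiplication on $A$ for which all elements of $\mathfrak g$ are primitive, and $\widetilde\otimes$ the resulting tensor product of $A$-modules. We consider all cocommutative Hopf algebra structures $\Delta$ on the algebra $A$ whose counit is this fixed augmentation. Each one makes $A$ the group algebra $kG=k[G]^*$ of a finite group scheme $G$; the resulting tensor product of $A$-modules is denoted $\otimes$. **Points and support.** $\mathscr X(A)=\operatorname{Proj}H^*(A,k)$, where $H^*(A,k)=\operatorname{Ext}^*_A(k,k)$, is the space of homogeneous primes of the reduction of this graded-commutative ring; it does not depend on $\Delta$. A $\pi$-point of $G$ over a field extension $K/k$ is a flat map of $K$-algebras $\alpha_K:K[t]/t^p\to KG_K$ factoring through the group algebra of a unipotent abelian subgroup scheme of $G_K$. The point $\mathfrak p(\alpha_K)\in\mathscr X(A)$ is the radical of the kernel of $H^*(A,k)\to H^*(A_K,K)\to H^*(K[t]/t^p,K)$. Every point of $\mathscr X(A)$ arises this way. For a finite-dimensional $A$-module $M$, its support $\mathscr X(A,M)\subseteq\mathscr X(A)$ is the closed set of those $\mathfrak p(\alpha_K)$ for which $\alpha_K^*(M_K)$ is not projective; it does not depend on $\Delta$. For a closed point $\mathfrak p$, $\mathcal C(\mathfrak p)$ is the full subcategory of finite-dimensional $A$-modules $M$ with $\mathscr X(A,M)\subseteq\{\mathfrak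 p\}$. A point $\mathfrak p$ is noble for $G$ if $\mathfrak p=\mathfrak p(\alpha_K)$ for some $\pi$-point $\alpha_K$ of $G$ whose image is a Hopf subalgebra of $KG_K$. **Property PA.** For every finite group scheme $G$ with group algebra $kG=A$ arising from a cocommutative Hopf algebra structure $\Delta$ on $A=u(\mathfrak g)$ whose counit is the fixed augmentation $A\to k$ (with resulting tensor product $\otimes$), and every closed $\mathfrak p\in\mathscr X(A)$ noble for $G$, $V\otimes W\cong V\widetilde\otimes W$ for all $V,W\in\mathcal C(\mathfrak p)$. **Twisting.** $\operatorname{Aut}(A)$ is the group of augmented $k$-algebra automorphisms of $A$. It acts on $\mathscr X(A)$ by $\varphi^*(\mathfrak p(\alpha_K))=\mathfrak p(\varphi_K\circ\alpha_K)$, and $\Omega(A,\mathfrak p)=\{\varphi\in\operatorname{Aut}(A):\varphi^*(\mathfrak p)=\mathfrak p\}$; its elements are called isotropies. $\widetilde\otimes^\varphi$ is the tensor product of $A$-modules given by $\widetilde\Delta^\varphi=(\varphi\otimes\varphi)\circ\widetilde\Delta\circ\varphi^{-1}$. **Nilpotent elements.** $\mathscr N_r(\mathfrak g)=\{x\in\mathfrak g: x^{[p]^r}=0\}$ and $\mathscr N(\mathfrak g)=\bigcup_r\mathscr N_r(\mathfrak g)$; $t$ has order $r$ if $t\in\mathscr N_r(\mathfrak g)\setminus\mathscr N_{r-1}(\mathfrak g)$. $\langle t\rangle\subset\mathfrak g$ is the restricted subalgebra generated by $t$, so $u(\langle t\rangle)=k[t]/t^{p^r}$. For $t$ of order $r\ge1$,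 $\mathfrak p(t)\in\mathscr X(A)$ is the point given by the $\pi$-point $u(\langle t^{[p]^{r-1}}\rangle)\hookrightarrow u(\mathfrak g)$. $V_{1,\mathfrak g}(t)=u(\mathfrak g)\otimes_{u(\langle t\rangle)}k$ is the module induced from the trivial $\langle t\rangle$-module. *)

(* Defs.v *)
From HB Require Import structures.
From mathcomp Require Import all_boot all_order all_algebra all_field.
From mathcomp Require Import boolp classical_sets.
From mathcomp Require Import mxtens.

Set Implicit Arguments.
Unset Strict Implicit.
Unset Printing Implicit Defensive.

Import GRing.Theory.
Local Open Scope ring_scope.

(* V (x) W is realised as the space of coordinate matrices with respect to
   the chosen bases [vbasis fullv] of V and W; [tlift] is its universal
   property. *)
Section Tensor.
Variables (K : fieldType) (V W : vectType K).

Definition evec (i : 'I_(\dim {:V})) : V := (vbasis {:V})`_i.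

Definition tens := 'M[K]_(\dim {:V}, \dim {:W}).

Definition tprod (v : V) (w : W) : tens :=
  \matrix_(i, j) (coord (vbasis {:V}) i v * coord (vbasis {:W}) j w).

End Tensor.

Definition tlift (K : fieldType) (V W : vectType K) (P : lmodType K)
    (b : V -> W -> P) (X : tens V W) : P :=
  \sum_i \sum_j X i j *: b (evec i) (evec j).

Definition tmap (K : fieldType) (V W V' W' : vectType K)
    (f : V -> V') (g : W -> W') : tens V W -> tens V' W' :=
  tlift (fun v w => tprod (f v) (g w)).

Definition tmul (K : fieldType) (A : falgType K) (X Y : tens A A) : tens A A :=
  tlift (fun a b => tlift (fun c d => tprod (a * c) (b * d)) Y) X.

Definition tassoc (K : fieldType) (U V W : vectType K) :
    tens (tens U V) W -> tens U (tens V W) :=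
  tlift (fun X w => tlift (fun u v => tprod u (tprod v w)) X).

Definition tensv (K : fieldType) (V W : vectType K)
    (U1 : {vspace V}) (U2 : {vspace W}) : {vspace tens V W} :=
  <<[seq tprod u w | u <- vbasis U1, w <- vbasis U2]>>%VS.

(* K (x)_k A, as the space of K-coordinates on the chosen k-basis of A. *)
Definition bc (k K : fieldType) (iota : {rmorphism k -> K}) (A : falgType k) :=
  'rV[K]_(\dim {:A}).

Section BaseChange.
Variables (k K : fieldType) (iota : {rmorphism k -> K}) (A : falgType k).
Local Notation AK := (bc iota A).

HB.instance Definition _ := Vector.copy AK 'rV[K]_(\dim {:A}).

(* a |-> 1 (x) a *)
Definition bc_in (a : A) : AK := \row_i iota (coord (vbasis {:A}) i a).

(* The K-linear extension of an iota-semilinear map A -> W. *)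
Definition bc_lift (W : lmodType K) (f : A -> W) (u : AK) : W :=
  \sum_i u 0 i *: f (evec i).

Definition bc_mul (u v : AK) : AK :=
  bc_lift (fun a => bc_lift (fun b => bc_in (a * b)) v) u.

Definition iota_linear (W : lmodType K) (f : A -> W) :=
  forall c a b, f (c *: a + b) = iota c *: f a + f b.

Lemma iota_linear_sum (W : lmodType K) (f : A -> W) : iota_linear f ->
  forall (I : finType) (c : I -> k) (a : I -> A),
  f (\sum_i c i *: a i) = \sum_i iota (c i) *: f (a i).
Proof.
move=> fl I c a; have f0 : f 0 = 0.
  by have := fl 1 0 0; rewrite scaler0 addr0 rmorph1 scale1r => /(congr1 (+%R^~ (- f 0)));
     rewrite addrK subrr.
by elim/big_rec2: _ => // i y1 y2 _ <-; rewrite fl.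
Qed.

Lemma evec_sum (a : A) : a = \sum_i coord (vbasis {:A}) i a *: evec i.
Proof. by rewrite {1}(coord_vbasis (memvf a)). Qed.

Lemma bc_liftK (W : lmodType K) (f : A -> W) :
  iota_linear f -> forall a, bc_lift f (bc_in a) = f a.
Proof.
move=> fl a; rewrite {2}(evec_sum a) iota_linear_sum //.
by apply: eq_bigr => i _; rewrite mxE.
Qed.

Lemma bc_in_linear : iota_linear bc_in.
Proof. by move=> c a b; apply/rowP=> i; rewrite !mxE !linearP rmorphD rmorphM. Qed.

Lemma bc_lift_linear (W : lmodType K) (f : A -> W) : linear (bc_lift f).
Proof.
move=> c u v; rewrite /bc_lift scaler_sumr -big_split /=.
by apply: eq_bigr => i _; rewrite !mxE scalerDl scalerA.
Qed.

HB.instance Definition _ (W : lmodType K) (f : A -> W) :=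
  GRing.isLinear.Build K AK W *:%R (bc_lift f) (bc_lift_linear f).

Lemma bc_in_evec i : bc_in (evec i) = delta_mx 0 i.
Proof.
apply/rowP => j; rewrite !mxE /evec (coord_free _ _ (basis_free (vbasisP _))).
by rewrite [j == i]eq_sym; case: eqP; rewrite ?rmorph1 ?rmorph0.
Qed.

Lemma bc_sum (u : AK) : u = \sum_i u 0 i *: bc_in (evec i).
Proof. by rewrite {1}(row_sum_delta u); apply: eq_bigr => i _; rewrite bc_in_evec. Qed.

Lemma bc_mul_linearl v : linear (bc_mul^~ v).
Proof. exact: bc_lift_linear. Qed.

Lemma bc_mul_linearr u : linear (bc_mul u).
Proof.
move=> c v w; rewrite /bc_mul [LHS]/bc_lift [X in _ = c *: X + _]/bc_lift.
rewrite [X in _ = _ + X]/bc_lift scaler_sumr -big_split /=.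
by apply: eq_bigr => i _; rewrite bc_lift_linear scalerDr !scalerA mulrC.
Qed.

Lemma bc_mulE a b : bc_mul (bc_in a) (bc_in b) = bc_in (a * b).
Proof.
have lr x : iota_linear (fun b => bc_in (x * b)).
  by move=> c ? ?; rewrite mulrDr -scalerAr bc_in_linear.
rewrite /bc_mul bc_liftK ?bc_liftK //.
by move=> c x y; rewrite !bc_liftK // mulrDl -scalerAl bc_in_linear.
Qed.

Lemma bc_eq (W : lmodType K) (f g : AK -> W) : linear f -> linear g ->
  (forall a, f (bc_in a) = g (bc_in a)) -> f =1 g.
Proof.
move=> fl gl fg u.
pose F := HB.pack_for {linear AK -> W} f (GRing.isLinear.Build K AK W *:%R f fl).
pose G := HB.pack_for {linear AK -> W} g (GRing.isLinear.Build K AK W *:%R g gl).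
rewrite -[f]/(F : _ -> _) -[g]/(G : _ -> _) (bc_sum u) !linear_sum.
by apply: eq_bigr => i _; rewrite !linearZ /= fg.
Qed.

Lemma bc_mulA : associative bc_mul.
Proof.
move=> u v w; move: u.
apply: bc_eq => [c x y|c x y|a]; rewrite ?bc_mul_linearl //.
move: v; apply: bc_eq => [c x y|c x y|b].
- by rewrite !(bc_mul_linearl, bc_mul_linearr).
- by rewrite !(bc_mul_linearl, bc_mul_linearr).
move: w; apply: bc_eq => [c x y|c x y|d]; rewrite ?bc_mul_linearr //.
by rewrite !bc_mulE mulrA.
Qed.

Lemma bc_mul1l : left_id (bc_in 1) bc_mul.
Proof.
apply: bc_eq => [c x y|c x y|a]; rewrite ?bc_mul_linearr //.
by rewrite bc_mulE mul1r.
Qed.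

Lemma bc_mul1r : right_id (bc_in 1) bc_mul.
Proof.
apply: bc_eq => [c x y|c x y|a]; rewrite ?bc_mul_linearl //.
by rewrite bc_mulE mulr1.
Qed.

Lemma bc_mulDl : left_distributive bc_mul +%R.
Proof. by move=> u v w; have := bc_mul_linearl w 1 u v; rewrite !scale1r. Qed.

Lemma bc_mulDr : right_distributive bc_mul +%R.
Proof. by move=> u v w; have := bc_mul_linearr u 1 v w; rewrite !scale1r. Qed.

Lemma bc_neq0 : bc_in 1 != 0.
Proof.
apply/eqP => /rowP E; have /eqP[] := oner_neq0 A.
rewrite (evec_sum 1) big1 // => i _; move: (E i); rewrite !mxE => /eqP.
by rewrite fmorph_eq0 => /eqP ->; rewrite scale0r.
Qed.

Lemma bc_scaleAl (c : K) (u v : AK) : c *: bc_mul u v = bc_mul (c *: u) v.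
Proof. by rewrite /bc_mul linearZ. Qed.

Lemma bc_scaleAr (c : K) (u v : AK) : c *: bc_mul u v = bc_mul u (c *: v).
Proof.
have z : bc_mul u 0 = 0.
  by have := bc_mulDr u 0 0; rewrite addr0 => /(congr1 (+%R^~ (- bc_mul u 0)));
     rewrite addrK subrr.
by have := bc_mul_linearr u c v 0; rewrite !addr0 z addr0.
Qed.

HB.instance Definition _ := GRing.Zmodule_isNzRing.Build AK
  bc_mulA bc_mul1l bc_mul1r bc_mulDl bc_mulDr bc_neq0.

HB.instance Definition _ := GRing.Lmodule_isLalgebra.Build K AK bc_scaleAl.

HB.instance Definition _ := GRing.Lalgebra_isAlgebra.Build K AK bc_scaleAr.
HB.instance Definition _ := Algebra_isFalgebra.Build K AK.

End BaseChange.

Section FlatProjective.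
Variable R : comNzRingType.

(* sum_u u.1 (x) u.2 = 0 in N (x)_R M, i.e. every balanced map kills it. *)
Definition tensor_zero (N M : lmodType R) (s : seq (N * M)) : Prop :=
  forall (P : zmodType) (b : N -> M -> P),
    (forall n, {morph b n : m m' / m + m'}) ->
    (forall m, {morph b^~ m : n n' / n + n'}) ->
    (forall r n m, b (r *: n) m = b n (r *: m)) ->
  \sum_(u <- s) b u.1 u.2 = 0.

Definition flat (M : lmodType R) : Prop :=
  forall (N' N : lmodType R) (f : {linear N' -> N}), injective f ->
  forall s : seq (N' * M),
    tensor_zero [seq (f u.1, u.2) | u <- s] -> tensor_zero s.

Definition projective (M : lmodType R) : Prop :=
  forall (N' N : lmodType R) (g : {linear N' -> N}) (f : {linear M -> N}),
    (forall y, exists x, g x = y) ->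
  exists h : {linear M -> N'}, forall m, g (h m) = f m.

End FlatProjective.

(* S as an R-module along f *)
Definition along (R S : nzRingType) (f : {rmorphism R -> S}) := (S : Type).

Section Along.
Variables (R S : nzRingType) (f : {rmorphism R -> S}).
HB.instance Definition _ := GRing.Zmodule.copy (along f) S.
Definition along_scale (r : R) (s : along f) : along f := f r * (s : S).
Fact along_scaleA a b s : along_scale a (along_scale b s) = along_scale (a * b) s.
Proof. by rewrite /along_scale rmorphM mulrA. Qed.
Fact along_scale1 : left_id 1 along_scale.
Proof. by move=> s; rewrite /along_scale rmorph1 mul1r. Qed.
Fact along_scaleDr : right_distributive along_scale +%R.
Proof. by move=> r s t; rewrite /along_scale mulrDr. Qed.
Fact along_scaleDl s : {morph along_scale^~ s : a b / a + b}.
Proof. by move=> a b; rewrite /along_scale rmorphD mulrDl. Qed.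
HB.instance Definition _ := GRing.Zmodule_isLmodule.Build R (along f)
  along_scaleA along_scale1 along_scaleDr along_scaleDl.
End Along.

(* The column space K^n as an R-module via a representation. *)
Definition repmod (R : nzRingType) (K : fieldType) (n : nat)
  (rho : {rmorphism R -> 'M[K]_n}) := 'cV[K]_n.

Section RepMod.
Variables (R : nzRingType) (K : fieldType) (n : nat).
Variable rho : {rmorphism R -> 'M[K]_n}.
HB.instance Definition _ := GRing.Zmodule.copy (repmod rho) 'cV[K]_n.
Definition rep_scale (r : R) (v : repmod rho) : repmod rho := rho r *m v.
Fact rep_scaleA a b v : rep_scale a (rep_scale b v) = rep_scale (a * b) v.
Proof. by rewrite /rep_scale rmorphM mulmxA. Qed.
Fact rep_scale1 : left_id 1 rep_scale.
Proof. by move=> v; rewrite /rep_scale rmorph1 mul1mx. Qed.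
Fact rep_scaleDr : right_distributive rep_scale +%R.
Proof. by move=> r s t; rewrite /rep_scale mulmxDr. Qed.
Fact rep_scaleDl v : {morph rep_scale^~ v : a b / a + b}.
Proof. by move=> a b; rewrite /rep_scale rmorphD mulmxDl. Qed.
HB.instance Definition _ := GRing.Zmodule_isLmodule.Build R (repmod rho)
  rep_scaleA rep_scale1 rep_scaleDr rep_scaleDl.
End RepMod.

Definition local_ring (R : unitRingType) : Prop :=
  forall a b : R, a \isn't a GRing.unit -> b \isn't a GRing.unit ->
  a + b \isn't a GRing.unit.

(* H^*(A, K) = Ext_A^*(K, K) is computed by the bar complex of the augmented
   algebra A: an n-cochain is an n-linear form on A.  All degrees live in the
   one type [seq A -> K], a cochain of degree n being supported on the lists of
   length n; this makes the cup product associative on the nose. *)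
Section Cohomology.
Variables (K : fieldType) (A : algType K) (eps : A -> K).

Definition multilinear (f : seq A -> K) : Prop :=
  forall s1 s2 c a b,
    f (s1 ++ (c *: a + b) :: s2) = c * f (s1 ++ a :: s2) + f (s1 ++ b :: s2).

Definition cochain (n : nat) (f : seq A -> K) : Prop :=
  multilinear f /\ forall s, size s != n -> f s = 0.

Definition contract (i : nat) (s : seq A) : seq A :=
  take i s ++ (s`_i * s`_i.+1) :: drop i.+2 s.

Definition cobound (f : seq A -> K) (s : seq A) : K :=
  if s is a :: s' then
    eps a * f s' + \sum_(i < size s') (-1) ^+ i.+1 * f (contract i s)
    + (-1) ^+ size s * (f (belast a s') * eps (last a s'))
  else 0.

Definition cup (f g : seq A -> K) (s : seq A) : K :=
  \sum_(i < (size s).+1) f (take i s) * g (drop i s).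

Definition cupn (f : seq A -> K) (m : nat) : seq A -> K :=
  iter m (cup f) (fun s => (nilp s)%:R).

Definition cocycle (n : nat) (f : seq A -> K) : Prop :=
  cochain n f /\ forall s, cobound f s = 0.

Definition coboundary (f : seq A -> K) : Prop :=
  exists n g, cochain n g /\ f = cobound g.

(* A homogeneous ideal of H^*(A, K) is given by the set of the cocycles that
   represent its homogeneous elements.  [homog_prime] describes the points of
   Proj H^*(A, K); passing to the reduction of this graded-commutative ring
   does not change its homogeneous primes. *)
Definition homog_prime (P : set (seq A -> K)) : Prop :=
  [/\ forall f, P f -> exists n, cocycle n f,
      forall n f, cocycle n f -> coboundary f -> P f,
      forall n f g, cocycle n f -> cocycle n g -> P f -> P g ->
        P (fun s => f s + g s),
      forall n f g, cocycle n f -> P g -> P (cup f g) /\ P (cup g f)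
    & (forall m n f g, cocycle m f -> cocycle n g -> P (cup f g) ->
        P f \/ P g) /\
      exists n f, [/\ (0 < n)%N, cocycle n f & ~ P f]].

Definition closed_point (P : set (seq A -> K)) : Prop :=
  homog_prime P /\
  forall Q, homog_prime Q -> (P `<=` Q)%classic -> Q = P.

End Cohomology.

(* The augmentation is t |-> 0. *)
Notation truncated K p := {poly %/ ('X^p : {poly K})}.
Definition trunc_eps (K : fieldType) (p : nat) (q : truncated K p) : K :=
  (q : {poly K})`_0.

Section Points.
Variables (k : fieldType) (A : falgType k) (eps : A -> k).

(* The K-multilinear extension of a cochain. *)
Fixpoint bc_cochain (K : fieldType) (iota : {rmorphism k -> K})
    (f : seq A -> k) (s : seq (bc iota A)) : K :=
  if s is u :: s' then
    bc_lift (W := K^o)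
      (fun a => bc_cochain (fun s0 => f (a :: s0)) s') u
  else iota (f [::]).

(* The radical of the kernel of H^*(A, k) -> H^*(A_K, K) -> H^*(K[t]/t^p, K). *)
Definition point_of (p : nat) (K : fieldType) (iota : {rmorphism k -> K})
    (alpha : truncated K p -> bc iota A) : set (seq A -> k) :=
  [set f | (exists n, cocycle eps n f) /\
           exists m, (0 < m)%N /\
             coboundary (@trunc_eps K p)
               (fun s => bc_cochain (cupn f m) (map alpha s))].

End Points.

Section Hopf.
Variables (k : fieldType) (A : falgType k) (eps : {lrmorphism A -> k^o}).

Record hopf := Hopf {
  comult : A -> tens A A;
  antipode : A -> A;
  comult_linear : linear comult;
  comult1 : comult 1 = tprod 1 1;
  comultM : forall a b, comult (a * b) = tmul (comult a) (comult b);
  comultA : forall a,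
    tassoc (tmap comult idfun (comult a)) = tmap idfun comult (comult a);
  counitl : forall a, tlift (fun b c => eps b *: c) (comult a) = a;
  counitr : forall a, tlift (fun b c => eps c *: b) (comult a) = a;
  antipode_linear : linear antipode;
  antipodel : forall a, tlift (fun b c => antipode b * c) (comult a) = eps a *: 1;
  antipoder : forall a, tlift (fun b c => b * antipode c) (comult a) = eps a *: 1 }.

Definition cocommutative (H : hopf) : Prop :=
  forall a, tlift (fun b c => tprod c b) (comult H a) = comult H a.

Section OverK.
Variables (H : hopf) (K : fieldType) (iota : {rmorphism k -> K}).
Local Notation AK := (bc iota A).

Definition bc_comult : AK -> tens AK AK :=
  bc_lift (fun a => \sum_i \sum_j
    iota (comult H a i j) *: tprod (bc_in iota (evec i)) (bc_in iota (evec j))).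

Definition bc_antipode : AK -> AK := bc_lift (fun a => bc_in iota (antipode H a)).

Definition hopf_sub (B : {vspace AK}) : Prop :=
  [/\ 1 \in B, (B * B <= B)%VS,
      forall b, b \in B -> bc_comult b \in tensv B B
    & forall b, b \in B -> bc_antipode b \in B].

(* Subgroup schemes of G_K correspond to Hopf subalgebras of KG_K; a subgroup
   scheme is abelian if its group algebra is commutative, and unipotent if
   its group algebra is local. *)
Definition pi_point (p : nat) (alpha : {lrmorphism truncated K p -> AK}) : Prop :=
  flat (along alpha) /\
  exists B : {aspace AK},
    [/\ hopf_sub B, {in B &, commutative *%R}, local_ring (subvs_of B)
      & forall r, alpha r \in B].

End OverK.

Definition noble (p : nat) (H : hopf) (P : set (seq A -> k)) : Prop :=
  exists (K : fieldType) (iota : {rmorphism k -> K})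
         (alpha : {lrmorphism truncated K p -> bc iota A}),
    [/\ pi_point H alpha, P = point_of eps alpha
      & exists2 B : {vspace bc iota A},
          (forall b, b \in B <-> exists r, b = alpha r) & hopf_sub H B].

End Hopf.

(* A finite-dimensional left A-module, on column vectors. *)
Record fdmod (k : fieldType) (A : falgType k) := FdMod {
  mdim : nat;
  mrep :> {lrmorphism A -> 'M[k]_mdim} }.

Definition rep_iso (k : fieldType) (A : Type) (m n : nat)
    (rho : A -> 'M[k]_m) (sigma : A -> 'M[k]_n) : Prop :=
  exists (P : 'M[k]_(n, m)) (Q : 'M[k]_(m, n)),
    [/\ Q *m P = 1%:M, P *m Q = 1%:M & forall a, P *m rho a = sigma a *m P].

(* The action of A on V (x) W through a comultiplication. *)
Definition tensor_rep (k : fieldType) (A : falgType k) (Delta : A -> tens A A)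
    (V W : fdmod A) (a : A) : 'M[k]_(mdim V * mdim W) :=
  tlift (fun b c => V b *t W c) (Delta a).

Section BaseChangeModule.
Variables (k K : fieldType) (iota : {rmorphism k -> K}) (A : falgType k).
Variable V : fdmod A.

Definition bc_rep : bc iota A -> 'M[K]_(mdim V) :=
  bc_lift (fun a => map_mx iota (V a)).

Lemma bc_rep_iota : iota_linear iota (fun a => map_mx iota (V a)).
Proof. by move=> c a b; rewrite linearP map_mxD map_mxZ. Qed.

Lemma bc_rep_linear : linear bc_rep.
Proof. exact: bc_lift_linear. Qed.

HB.instance Definition _ :=
  GRing.isLinear.Build K (bc iota A) 'M[K]_(mdim V) *:%R bc_rep bc_rep_linear.

Lemma bc_rep_monoid : monoid_morphism bc_rep.
Proof.
split; first by rewrite /bc_rep bc_liftK ?rmorph1 ?map_mx1 //; exact: bc_rep_iota.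
move=> u v; move: u; apply: (@bc_eq _ _ iota A) => [c x y|c x y|a].
- by rewrite mulrDl -scalerAl linearP.
- by rewrite linearP mulrDl -[_ * _ in RHS]/(_ *m _) scalemxAl.
move: v; apply: (@bc_eq _ _ iota A) => [c x y|c x y|b].
- by rewrite mulrDr -scalerAr linearP.
- by rewrite linearP mulrDr -[_ * _ in RHS]/(_ *m _) scalemxAr.
rewrite -[_ * _]/(bc_mul _ _) bc_mulE /bc_rep !bc_liftK; try exact: bc_rep_iota.
by rewrite rmorphM map_mxM.
Qed.

HB.instance Definition _ :=
  GRing.isMonoidMorphism.Build (bc iota A) 'M[K]_(mdim V) bc_rep bc_rep_monoid.

End BaseChangeModule.

Definition pi_support (k : fieldType) (A : falgType k) (eps : {lrmorphism A -> k^o})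
    (p : nat) (H : hopf eps) (V : fdmod A) : set (set (seq A -> k)) :=
  [set P | homog_prime eps P /\
     exists (K : fieldType) (iota : {rmorphism k -> K})
            (alpha : {lrmorphism truncated K p -> bc iota A}),
       [/\ pi_point H alpha, P = point_of eps alpha
         & ~ projective (repmod (bc_rep V \o alpha))]].

(* Property PA for the algebra A with reference Hopf structure H0.  Supports do
   not depend on the Hopf structure; they are computed with H0. *)
Definition property_PA (k : fieldType) (A : falgType k)
    (eps : {lrmorphism A -> k^o}) (p : nat) (H0 : hopf eps) : Prop :=
  forall H : hopf eps, cocommutative H ->
  forall P : set (seq A -> k), closed_point eps P -> noble p H P ->
  forall V W : fdmod A,
    (pi_support p H0 V `<=` [set P])%classic ->
    (pi_support p H0 W `<=` [set P])%classic ->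
  rep_iso (tensor_rep (comult H) V W) (tensor_rep (comult H0) V W).

Section Twist.
Variables (k : fieldType) (A : falgType k) (eps : {lrmorphism A -> k^o}).

Record aug_aut := AugAut {
  aut :> {lrmorphism A -> A};
  aut_inv : {lrmorphism A -> A};
  autK : cancel aut aut_inv;
  aut_invK : cancel aut_inv aut;
  aut_eps : forall a, eps (aut a) = eps a }.

Definition twist (phi : aug_aut) (Delta : A -> tens A A) (a : A) : tens A A :=
  tmap phi phi (Delta (aut_inv phi a)).

Definition bc_aut (K : fieldType) (iota : {rmorphism k -> K}) (phi : aug_aut) :
  bc iota A -> bc iota A := bc_lift (fun a => bc_in iota (phi a)).

(* The action of phi on points is inverse image under the map induced by phi
   on cohomology; see [aut_actE]. *)
Definition aut_act (phi : aug_aut) (P : set (seq A -> k)) : set (seq A -> k) :=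
  [set f | P (fun s => f (map phi s))].

Definition isotropy (phi : aug_aut) (P : set (seq A -> k)) : Prop :=
  aut_act phi P = P.

Section AutAct.
Variable phi : aug_aut.

Lemma contract_map i (s : seq A) : contract i (map phi s) = map phi (contract i s).
Proof.
have nthE j : (map phi s)`_j = phi s`_j.
  have [lt_j|le_j] := ltnP j (size s); first by rewrite (nth_map 0).
  by rewrite !nth_default ?size_map // rmorph0.
by rewrite /contract map_cat /= map_take map_drop rmorphM !nthE.
Qed.

Lemma cobound_map f : cobound eps (fun s => f (map phi s)) =
  (fun s => cobound eps f (map phi s)).
Proof.
apply/funext => -[|a s]; rewrite // [map _ _]/= /cobound -/(map phi).
rewrite /= !size_map aut_eps last_map aut_eps; congr (_ + _ + _ * (f _ * _)).
  by apply: eq_bigr => i _; rewrite -map_cons contract_map.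
by elim: s a => //= b s IH a; rewrite IH.
Qed.

Lemma multilinear_map f : multilinear f -> multilinear (fun s => f (map phi s)).
Proof. by move=> fl s1 s2 c a b; rewrite !map_cat /= linearP fl. Qed.

Lemma cochain_map n f : cochain n f -> cochain n (fun s => f (map phi s)).
Proof.
move=> [fl f0]; split; first exact: multilinear_map.
by move=> s sn; rewrite f0 // size_map.
Qed.

Lemma cocycle_map n f : cocycle eps n f -> cocycle eps n (fun s => f (map phi s)).
Proof.
by move=> [fc df]; split; [exact: cochain_map | move=> s; rewrite cobound_map df].
Qed.

Lemma cup_map f g (s : seq A) :
  cup (fun s => f (map phi s)) (fun s => g (map phi s)) s = cup f g (map phi s).
Proof.
by rewrite /cup size_map; apply: eq_bigr => i _; rewrite -map_take -map_drop.
Qed.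

Lemma cupn_map f m (s : seq A) :
  cupn (fun s => f (map phi s)) m s = cupn f m (map phi s).
Proof.
elim: m s => [|m IH] s; first by case: s.
by rewrite /cupn !iterS -/(cupn _ m) (funext IH) cup_map.
Qed.

End AutAct.

Lemma multilinear_cup (f g : seq A -> k) :
  multilinear f -> multilinear g -> multilinear (cup f g).
Proof.
move=> fl gl s1 s2 c a b; rewrite /cup !size_cat /= mulr_sumr -big_split /=.
apply: eq_bigr => i _; rewrite !take_cat !drop_cat; case: ltnP => [_|le_i].
  by rewrite gl mulrDr mulrCA.
case: (i - size s1)%N => [|j] /=; first by rewrite (gl [::]) /= mulrDr mulrCA.
by rewrite fl mulrDl mulrA.
Qed.

Lemma multilinear_cupn (f : seq A -> k) m :
  multilinear f -> multilinear (cupn f m.+1).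
Proof.
move=> fl; elim: m => [|m IH]; last exact: multilinear_cup.
suff -> : cupn f 1 = f by [].
apply/funext => s; rewrite /cupn /= /cup big_ord_recr /= take_size drop_size mulr1.
rewrite big1 ?add0r // => i _.
have: (0 < size (drop i s))%N by rewrite size_drop subn_gt0.
by case: (drop i s) => //= *; rewrite mulr0.
Qed.

Lemma bc_cochain_lin (K : fieldType) (iota : {rmorphism k -> K}) c f g
    (t : seq (bc iota A)) :
  bc_cochain (fun s => c * f s + g s) t =
  iota c * bc_cochain f t + bc_cochain g t.
Proof.
elim: t f g => [|u t IH] f g /=; first by rewrite rmorphD rmorphM.
rewrite /bc_lift mulr_sumr -big_split /=; apply: eq_bigr => i _.
by rewrite IH scalerDr /GRing.scale /= mulrCA.
Qed.

Lemma bc_cochain_cons (K : fieldType) (iota : {rmorphism k -> K}) f :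
  multilinear f -> forall t : seq (bc iota A),
  iota_linear (W := K^o) iota (fun a => bc_cochain (fun s => f (a :: s)) t).
Proof.
move=> fl t c a b; apply: etrans (bc_cochain_lin c _ _ t).
by congr bc_cochain; apply/funext => s; exact: (fl [::]).
Qed.

Lemma bc_cochain_map (K : fieldType) (iota : {rmorphism k -> K})
    (phi : aug_aut) f (t : seq (bc iota A)) : multilinear f ->
  bc_cochain (fun s => f (map phi s)) t = bc_cochain f (map (bc_aut phi) t).
Proof.
elim: t f => [//|u t IH] f fl /=.
have E (G : A -> K^o) : iota_linear iota G ->
    bc_lift G (bc_aut phi u) = bc_lift (fun a => G (phi a)) u.
  move=> Gl; rewrite [bc_aut _ _]/bc_lift linear_sum; apply: eq_bigr => i _.
  by rewrite linearZ /= bc_liftK.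
rewrite E; last exact: bc_cochain_cons.
apply: eq_bigr => i _; congr (_ * _).
apply: (IH (fun s => f (phi (evec i) :: s))).
by move=> s1 s2 c a b; exact: (fl (phi (evec i) :: s1)).
Qed.

Definition aut_sym (phi : aug_aut) : aug_aut :=
  @AugAut (aut_inv phi) phi (@aut_invK phi) (@autK phi)
    (fun a => esym (etrans (congr1 eps (esym (aut_invK phi a))) (aut_eps phi _))).

Lemma aut_actE (p : nat) (K : fieldType) (iota : {rmorphism k -> K})
    (phi : aug_aut) (alpha : truncated K p -> bc iota A) :
  aut_act phi (point_of eps alpha) = point_of eps (bc_aut phi \o alpha).
Proof.
have E f m : multilinear f ->
    (fun s => bc_cochain (cupn (fun s0 => f (map phi s0)) m.+1) (map alpha s)) =
    (fun s => bc_cochain (cupn f m.+1) (map (bc_aut phi \o alpha) s)).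
  move=> fl; apply/funext => s; rewrite map_comp -bc_cochain_map.
    by congr bc_cochain; apply/funext => s0; rewrite cupn_map.
  exact: multilinear_cupn.
apply/seteqP; split=> f [[n fc] [[|m] [] // _ mf]].
  have fc' : cocycle eps n f.
    have -> : f = (fun s => f (map phi (map (aut_sym phi) s))).
      by apply/funext => s; rewrite mapK //; exact: aut_invK.
    exact: (cocycle_map (aut_sym phi) fc).
  split; first by exists n.
  by exists m.+1; split=> //; rewrite -(E f m fc'.1.1).
split; first by exists n; exact: cocycle_map.
by exists m.+1; split=> //; rewrite (E f m fc.1.1).
Qed.

End Twist.

(* A / U for a left ideal U, in coordinates on the complement U^C. *)
Section QuotientModule.
Variables (k : fieldType) (A : falgType k) (U : {vspace A}).
Hypothesis idealU : ({:A} * U <= U)%VS.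

Let pr : 'End(A) := daddv_pi U^C U.

Definition quot_mx (a : A) : 'M[k]_(\dim U^C) :=
  \matrix_(i, j) coord (vbasis U^C) i (pr (a * (vbasis U^C)`_j)).

Let prC w : w \in (U^C)%VS -> pr w = w.
Proof. by move=> wU; rewrite /pr daddv_pi_id // capvC capv_compl. Qed.

Let pr_mem w : pr w \in (U^C)%VS.
Proof. exact: memv_pi. Qed.

Let pr0 w : w \in U -> pr w = 0.
Proof.
move=> wU; have dUC : (U^C :&: U = 0)%VS by rewrite capvC capv_compl.
have := @daddv_pi_add _ _ _ _ w dUC; rewrite addvC addv_complf memvf => /(_ isT).
by rewrite (daddv_pi_id (capv_compl U) wU) -[in RHS](add0r w) => /addIr.
Qed.

Let pr_mod w : w - pr w \in U.
Proof.
have dUC : (U^C :&: U = 0)%VS by rewrite capvC capv_compl.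
have := @daddv_pi_add _ _ _ _ w dUC; rewrite addvC addv_complf memvf => /(_ isT).
by move=> E; rewrite -{1}E /pr addrAC subrr add0r memv_pi.
Qed.

Let pr_mul a w : pr (a * pr w) = pr (a * w).
Proof.
apply/eqP; rewrite eq_sym -subr_eq0 -linearB -mulrBr; apply/eqP/pr0.
by rewrite (subvP idealU) // memv_mul ?memvf.
Qed.

Lemma quot_mx_linear : linear quot_mx.
Proof.
by move=> c a b; apply/matrixP=> i j; rewrite !mxE mulrDl -scalerAl !linearP.
Qed.

Lemma quot_mx_monoid : monoid_morphism quot_mx.
Proof.
split=> [|a b]; apply/matrixP => i j; rewrite !mxE.
  rewrite mul1r prC ?vbasis_mem ?mem_nth ?size_tuple //.
  by rewrite (coord_free _ _ (basis_free (vbasisP _))) eq_sym.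
rewrite -mulrA -[in LHS]pr_mul.
rewrite {1}(coord_vbasis (pr_mem (b * _))) mulr_sumr !linear_sum.
apply: eq_bigr => l _; rewrite !mxE -scalerAr !linearZ /=.
by rewrite mulrC.
Qed.

HB.instance Definition _ :=
  GRing.isLinear.Build k A 'M[k]_(\dim U^C) *:%R quot_mx quot_mx_linear.
HB.instance Definition _ :=
  GRing.isMonoidMorphism.Build A 'M[k]_(\dim U^C) quot_mx quot_mx_monoid.

Definition quot_module : fdmod A := FdMod quot_mx.

End QuotientModule.

Section Induced.
Variables (k : fieldType) (A : falgType k) (eps : {lrmorphism A -> k^o}).
Variable B : {vspace A}.

(* A (x)_B k = A / A B_+ for a subalgebra B with augmentation ideal B_+ *)
Definition ind_ideal : {vspace A} := ({:A} * (B :&: lker (linfun eps)))%VS.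

Lemma ind_idealP : ({:A} * ind_ideal <= ind_ideal)%VS.
Proof. by rewrite /ind_ideal prodvA prodvSl ?subvf. Qed.

Definition induced_trivial : fdmod A := quot_module ind_idealP.

End Induced.

(* In [ppowD], Jacobson's s_i(u, v) is defined by
   ad(l u + v)^(p-1) (u) = \sum_(1 <= i < p) i s_i(u, v) l^(i-1):
   a word w in {u, v} of length p-1 with i-1 letters u contributes to s_i. *)
Record restricted_lie (k : fieldType) (p : nat) := RestrictedLie {
  rl_space :> vectType k;
  lbr : rl_space -> rl_space -> rl_space;
  ppow : rl_space -> rl_space;
  lbr_linearl : forall v, linear (lbr^~ v);
  lbr_linearr : forall u, linear (lbr u);
  lbrxx : forall u, lbr u u = 0;
  lbr_jacobi : forall u v w,
    lbr u (lbr v w) + lbr v (lbr w u) + lbr w (lbr u v) = 0;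
  ppowZ : forall c u, ppow (c *: u) = c ^+ p *: ppow u;
  ppow_ad : forall u v, lbr (ppow u) v = iter p (lbr u) v;
  ppowD : forall u v, ppow (u + v) = ppow u + ppow v +
    \sum_(w : (p.-1).-tuple bool)
      ((count id w).+1%:R)^-1 *:
        foldr (fun b => lbr (if b then u else v)) u w }.

Section Restricted.
Variables (k : fieldType) (p : nat) (g : restricted_lie k p).

Definition nilset (r : nat) : set g := [set u | iter r (@ppow k p g) u = 0].

Definition has_order (r : nat) (t : g) : Prop :=
  (0 < r)%N /\ (nilset r `\` nilset r.-1)%classic t.

Definition restricted_morphism (B : algType k) (f : g -> B) : Prop :=
  [/\ linear f, forall u v, f (lbr u v) = f u * f v - f v * f u
    & forall u, f (ppow u) = f u ^+ p].

(* (A, inj) is the restricted enveloping algebra u(g). *)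
Definition is_envelope (A : falgType k) (inj : g -> A) : Prop :=
  restricted_morphism inj /\
  forall (B : algType k) (f : g -> B), restricted_morphism f ->
    (exists F : {lrmorphism A -> B}, forall u, F (inj u) = f u) /\
    (forall F F' : {lrmorphism A -> B},
      (forall u, F (inj u) = f u) -> (forall u, F' (inj u) = f u) -> F =1 F').

Variables (A : falgType k) (inj : g -> A) (eps : {lrmorphism A -> k^o}).

(* For t of order r, the map K[t]/t^p -> A_K (with K = k) sends the variable
   to the p^(r-1)-th restricted power of t. *)
Definition nil_point (r : nat) (t : g) : set (seq A -> k) :=
  point_of (p := p) (K := k) (iota := idfun) eps
    (fun q => horner_alg (bc_in idfun (inj (iter r.-1 (@ppow k p g) t)))
                         (q : {poly k})).

(* V_{1,g}(t): the subalgebra of A generated by t is u(<t>), as <t> is spanned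
   by the restricted powers of t, which are powers of t in A. *)
Definition V1 (t : g) : fdmod A := induced_trivial eps (agenv <[inj t]>%VS).

End Restricted.

(* Main.v *)
(** Take t = x and phi(x) = x + s, phi(y) = y, phi(z) = z, with
    s = y^(p-1) z^(p-1), which commutes with x and kills y and z.  Then
    phi preserves the Heisenberg relations, and phi(x)^(p-1) lies in A x, so that the
    pi-points x and phi(x) define the same point p of X(A): phi is an isotropy,
    and p is noble for the twisted structure as well.

    V = A / A x has basis y^j z^l.  A bilinear form on V invariant under y, z and
    the twisted action of x kills (s, 1): indeed f(s a, b) = f(a, s b) because s
    has even degree in y and z, whence 2 f(s, 1) = 0.  From this it kills s V in
    either variable, so it is also invariant under the untwisted action.  Some
    form invariant under the untwisted action does not kill (s, 1); hence the
    two tensor squares of V have spaces of invariant forms of different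
    dimension.

    For the support, let u be the image of a pi-point over K.  A commutative Hopf
    subalgebra containing u is stable under the partial derivatives
    (l (x) id) o Delta in PBW coordinates, which confines it to the algebra
    generated by z and some w = a x + b y + c z with (a, b) nonzero.  If b is
    nonzero, or if b = 0 and u has a nonzero linear coefficient on z, then V_K is
    projective over K[u]/u^p; otherwise u^(p-1) lies in A_K x and u defines p. *)
Require Import Defs.
From mathcomp Require Import all_boot all_order all_algebra all_field.
From mathcomp Require Import boolp classical_sets.
From mathcomp Require Import mxtens zify ring.
From HB Require Import structures.

Set Implicit Arguments.
Unset Strict Implicit.
Unset Printing Implicit Defensive.

Import GRing.Theory.
Local Open Scope ring_scope.

(** * The bar complex, its differential and the cup product *)

Section BarComplex.
Variables (K : fieldType) (A : algType K) (eps : A -> K).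
Hypothesis eps_lin : forall c a b, eps (c *: a + b) = c * eps a + eps b.
Hypothesis epsM : forall a b, eps (a * b) = eps a * eps b.
Hypothesis eps1 : eps 1 = 1.
Implicit Types (f g : seq A -> K) (s t : seq A).

(** Points are radicals of kernels in bar cohomology, so comparing them is a computation with
    cochains. Even classes of K[t]/t^p are detected by their value on the bar cycle (u, u^(p-1),
    ..., u, u^(p-1)), and odd ones square to zero since p > 2: a point is the vanishing of one
    scalar on even classes. That cycle ends in u^(p-1), which is why it matters that this power lies
    in A x: by an Eckmann-Shapiro argument, a class that dies on k[x] has a representative vanishing
    whenever its last argument lies in A x. This yields only the inclusion of p(x) in p(u); equality
    comes from p(x) being closed, as shown by a class of degree 2 pulled back along A -> k[t]/t^p, x
    -> t, y, z -> 0.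

    The twisted action of x is not that of x + s: a term coming from Delta(s) is subtracted. It
    starts with the action of y, because s is a left multiple of y, so forms invariant under y do
    not see it.

    The obstacle in the support is that a pi-point may live over any extension and in any
    commutative local Hopf subalgebra, so that u need not be linear in x, y, z. Projectivity is
    therefore tested by exactness at u and u^(p-1), which flatness provides in A_K and which has to
    be carried over to V_K. *)

Fixpoint barE f s : K :=
  match s with
  | [::] => 0
  | a :: s' => match s' with
    | [::] => f [::] * eps a
    | b :: s'' => f (a * b :: s'') - barE (fun t => f (a :: t)) s'
    end
  end.

Lemma barE1 f a : barE f [:: a] = f [::] * eps a.
Proof. by []. Qed.

Lemma barE2 f a b s :
  barE f [:: a, b & s] = f (a * b :: s) - barE (fun t => f (a :: t)) (b :: s).
Proof. by []. Qed.

(** The terms of the coboundary after the first, negated, obey the recursion [barE2] in the first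
    argument; inductions on lists then replace manipulations of signed sums. *)
Lemma coboundE f a s : cobound eps f (a :: s) = eps a * f s - barE f (a :: s).
Proof.
rewrite /cobound -addrA; congr (_ + _).
elim: s f a => [|b s IH] f a.
  by rewrite big_ord0 add0r /= expr1 mulN1r.
rewrite barE2 opprB [size (b :: s)]/= big_ord_recl [LHS]/=.
rewrite expr1 mulN1r /contract /= drop0 -addrA addrC; congr (_ - _).
rewrite -[RHS]opprK -(IH (fun t => f (a :: t)) b) opprD; congr (_ + _).
  rewrite -sumrN; apply: eq_bigr => i _.
  by rewrite /bump /= add1n [in LHS]exprS mulN1r mulNr.
by rewrite [size _]/= [in LHS]exprS mulN1r mulNr.
Qed.

Lemma eq_barE f g s :
  (forall t, (size t).+1 = size s -> f t = g t) -> barE f s = barE g s.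
Proof.
elim: s f g => [//|a [|b s] IH] f g fg; first by rewrite /= fg.
rewrite !barE2 fg //; congr (_ - _); apply: IH => t st.
by apply: fg => /=; rewrite st.
Qed.

Lemma barE_lin c f g s :
  barE (fun t => c * f t + g t) s = c * barE f s + barE g s.
Proof.
elim: s f g => [|a [|b s] IH] f g; first by rewrite /= mulr0 addr0.
  by rewrite /= mulrDl mulrA.
by rewrite !barE2 IH; ring.
Qed.

Lemma barE0 s : barE (fun=> 0) s = 0.
Proof. by elim: s => [|a [|b s] IH] //; [exact: mul0r | rewrite barE2 IH subrr]. Qed.

Lemma barE_vanish f s : (forall t, (size t).+1 = size s -> f t = 0) -> barE f s = 0.
Proof. by move=> f0; rewrite -(barE0 s); apply: eq_barE. Qed.

Lemma barEB f g s : barE (fun t => f t - g t) s = barE f s - barE g s.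
Proof.
rewrite (eq_barE (g := fun t => -1 * g t + f t)); last by move=> t _; ring.
by rewrite barE_lin; ring.
Qed.

Lemma barEZ c f s : barE (fun t => c * f t) s = c * barE f s.
Proof.
rewrite (eq_barE (g := fun t => c * f t + 0)); last by move=> t _; ring.
by rewrite (barE_lin c f (fun=> 0)) barE0 addr0.
Qed.

Lemma barE_sum (I : finType) (F : I -> seq A -> K) s :
  barE (fun t => \sum_i F i t) s = \sum_i barE (F i) s.
Proof.
elim: s F => [|a [|b s] IH] F; first by rewrite /= big1.
  by rewrite barE1 mulr_suml.
by rewrite barE2 IH -sumrB.
Qed.

Lemma barEE f s : barE (barE f) s = 0.
Proof.
have [n] := ubnP (size s); elim: n f s => [//|n IH] f [//|a [|b [|c s]]] sn.
- by rewrite /= mul0r.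
- by rewrite /= epsM; ring.
(* Unfolding the inner [barE] at its head leaves a double differential of [fun t => f (a :: t)] on a
   shorter list, which the induction hypothesis kills. *)
have EG : barE (fun t => barE f (a :: t)) [:: b, c & s] =
          barE (fun t => f (a * head 0 t :: behead t)) [:: b, c & s].
  rewrite (eq_barE (g := fun t => f (a * head 0 t :: behead t)
                           - barE (fun t => f (a :: t)) t)); last first.
    by case.
  by rewrite barEB IH ?subr0.
by rewrite barE2 EG !barE2 /= mulrA; ring.
Qed.

Lemma eq_cobound f g s :
  (forall t, (size t).+1 = size s -> f t = g t) ->
  cobound eps f s = cobound eps g s.
Proof.
case: s => [//|a s] fg; rewrite !coboundE fg //; congr (_ - _); exact: eq_barE.
Qed.

Lemma cobound_lin c f g s :
  cobound eps (fun t => c * f t + g t) s = c * cobound eps f s + cobound eps g s.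
Proof.
by case: s => [|a s]; [rewrite /= mulr0 addr0 | rewrite !coboundE barE_lin; ring].
Qed.

Lemma coboundZ c f s : cobound eps (fun t => c * f t) s = c * cobound eps f s.
Proof. by case: s => [|a s]; [rewrite mulr0 | rewrite !coboundE barEZ; ring]. Qed.

Lemma coboundB f g s :
  cobound eps (fun t => f t - g t) s = cobound eps f s - cobound eps g s.
Proof. by case: s => [|a s]; [rewrite /= subr0 | rewrite !coboundE barEB; ring]. Qed.

Lemma cobound_vanish f s :
  (forall t, (size t).+1 = size s -> f t = 0) -> cobound eps f s = 0.
Proof.
case: s => [//|a s] f0; rewrite coboundE f0 // barE_vanish // mulr0 subr0 //.
Qed.

Lemma cobound_cobound f s : cobound eps (cobound eps f) s = 0.
Proof.
case: s => [//|a s]; rewrite coboundE.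
case: s => [|b s]; first by rewrite /= mulr0 mul0r subr0.
rewrite barE2 !coboundE.
rewrite (eq_barE (f := fun t => cobound eps f (a :: t))
                 (g := fun t => eps a * f t - barE f (a :: t))); last first.
  by move=> t _; exact: coboundE.
have := barEE f [:: a, b & s]; rewrite barE2 => /eqP; rewrite subr_eq0 => /eqP EE.
by rewrite barEB barEZ epsM -EE; ring.
Qed.

(* The complex computing the cohomology with coefficients in the dual of the
   regular module; its first argument carries the coefficients. *)
Definition barD (F : A -> seq A -> K) (v : A) s : K :=
  if s is a :: s' then F (v * a) s' - barE (F v) s else 0.

Lemma barE_cons f v a s :
  barE f [:: v, a & s] = barD (fun v t => f (v :: t)) v (a :: s).
Proof. by []. Qed.

Lemma eq_barD F G v s : (forall v t, (size t).+1 = size s -> F v t = G v t) ->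
  barD F v s = barD G v s.
Proof.
case: s => [//|a s] FG; rewrite /barD FG //; congr (_ - _).
by apply: eq_barE => t; apply: FG.
Qed.

Lemma barD_sub F G v s :
  barD (fun v t => F v t - G v t) v s = barD F v s - barD G v s.
Proof. by case: s => [|a s]; rewrite /barD ?barEB ?subr0 //; ring. Qed.

Lemma barD2 F v a s : barD F v (a :: s) = F (v * a) s - barE (F v) (a :: s).
Proof. by []. Qed.

Lemma barDD F v s : barD (barD F) v s = 0.
Proof.
case: s => [//|a [|b s]]; first by rewrite /= mul0r subr0.
rewrite barD2 barE2 !barD2.
rewrite (eq_barE (f := fun t => barD F v (a :: t))
                 (g := fun t => F (v * a) t - barE (F v) (a :: t))) //.
have := barEE (F v) [:: a, b & s]; rewrite barE2 => /eqP; rewrite subr_eq0 => /eqP EE.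
by rewrite barEB -EE mulrA; ring.
Qed.

End BarComplex.

Arguments eq_barE {K A eps f g s}.
Arguments eq_cobound {K A eps f g s}.
Arguments eq_barD {K A eps F G v s}.
Arguments barE {K A} eps f s : simpl never.
Arguments barD {K A} eps F v s : simpl never.
Arguments cobound {K A} eps f s : simpl never.

Section Multilinear.
Variables (K : fieldType) (A : algType K).
Implicit Types (f g : seq A -> K) (s t : seq A).

Lemma multilinear0 f s1 s2 : multilinear f -> f (s1 ++ 0 :: s2) = 0.
Proof.
move=> fl; have := fl s1 s2 1 0 0; rewrite scaler0 addr0 mul1r => /eqP.
by rewrite -subr_eq0 opprD addNKr oppr_eq0 => /eqP.
Qed.

Lemma multilinear_sum f s1 s2 (I : finType) (c : I -> K) (a : I -> A) :
  multilinear f ->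
  f (s1 ++ (\sum_i c i *: a i) :: s2) = \sum_i c i * f (s1 ++ a i :: s2).
Proof.
move=> fl; elim/big_rec2 : _ => [|i x y _ <-]; first exact: multilinear0.
by rewrite fl.
Qed.

Lemma multilinear_cons f a : multilinear f -> multilinear (fun t => f (a :: t)).
Proof. by move=> fl s1 s2 c b d; exact: (fl (a :: s1)). Qed.

Lemma multilinear_comb c f g :
  multilinear f -> multilinear g -> multilinear (fun t => c * f t + g t).
Proof. by move=> fl gl s1 s2 d a b; rewrite fl gl; ring. Qed.

Lemma multilinear_sub f g :
  multilinear f -> multilinear g -> multilinear (fun t => f t - g t).
Proof. by move=> fl gl s1 s2 d a b; rewrite fl gl; ring. Qed.

Lemma multilinear_scale c f : multilinear f -> multilinear (fun t => c * f t).
Proof. by move=> fl s1 s2 d a b; rewrite fl; ring. Qed.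

Lemma cochain_comb n c f g :
  cochain n f -> cochain n g -> cochain n (fun t => c * f t + g t).
Proof.
move=> [fl f0] [gl g0]; split; first exact: multilinear_comb.
by move=> s sn; rewrite f0 // g0 // mulr0 addr0.
Qed.

Lemma cochain_sub n f g :
  cochain n f -> cochain n g -> cochain n (fun t => f t - g t).
Proof.
move=> [fl f0] [gl g0]; split; first exact: multilinear_sub.
by move=> s sn; rewrite f0 // g0 // subr0.
Qed.

Lemma cochain_scale n c f : cochain n f -> cochain n (fun t => c * f t).
Proof.
move=> [fl f0]; split; first exact: multilinear_scale.
by move=> s sn; rewrite f0 // mulr0.
Qed.

Lemma cochain_zero n : cochain n (fun _ : seq A => 0 : K).
Proof. by split=> // s1 s2 c a b; rewrite mulr0 addr0. Qed.

Variable eps : A -> K.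
Hypothesis eps_lin : forall c a b, eps (c *: a + b) = c * eps a + eps b.

Lemma multilinear_barE f : multilinear f -> multilinear (barE eps f).
Proof.
move=> fl s1; elim: s1 f fl => [|d s1 IH] f fl s2 c a b.
  case: s2 => [|e s2]; first by rewrite !barE1 eps_lin; ring.
  rewrite !barE2 mulrDl -scalerAl (fl [::]) /=.
  rewrite (eq_barE (g := fun t => c * f (a :: t) + f (b :: t))).
    by rewrite barE_lin; ring.
  by move=> t _; exact: (fl [::]).
have fd := multilinear_cons d fl.
case: s1 IH => [|e s1] IH.
  by rewrite !cat1s !barE2 (IH _ fd s2) mulrDr -scalerAr (fl [::]); rewrite /=; ring.
have E1 := IH _ fd s2 c a b; have E2 := fl (d * e :: s1) s2 c a b.
by rewrite !cat_cons in E1 E2 *; rewrite !barE2 E1 E2; ring.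
Qed.

Lemma multilinear_cobound f : multilinear f -> multilinear (cobound eps f).
Proof.
move=> fl [|d s1] s2 c a b.
  by rewrite !coboundE (multilinear_barE fl [::]) eps_lin; ring.
have E := multilinear_barE fl (d :: s1) s2 c a b.
by rewrite !cat_cons in E *; rewrite !coboundE E fl; ring.
Qed.

Lemma cochain_cobound n f : cochain n f -> cochain n.+1 (cobound eps f).
Proof.
move=> [fl f0]; split; first exact: multilinear_cobound.
move=> [//|a s]; rewrite eqSS => sn; apply: cobound_vanish => t /= [st].
by rewrite f0 ?st.
Qed.

Lemma cocycle_sub n f g :
  cocycle eps n f -> cocycle eps n g -> cocycle eps n (fun t => f t - g t).
Proof.
move=> [fc df] [gc dg]; split; first exact: cochain_sub.
by move=> s; rewrite coboundB df dg subrr.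
Qed.

Lemma cocycle_zero n : cocycle eps n (fun=> 0).
Proof. by split; [exact: cochain_zero | move=> s; rewrite cobound_vanish]. Qed.

Lemma cocycle_comb n c f g :
  cocycle eps n f -> cocycle eps n g -> cocycle eps n (fun t => c * f t + g t).
Proof.
move=> [fc df] [gc dg]; split; first exact: cochain_comb.
by move=> s; rewrite cobound_lin df dg mulr0 addr0.
Qed.

Lemma cocycle_scale n c f : cocycle eps n f -> cocycle eps n (fun t => c * f t).
Proof.
move=> [fc df]; split; first exact: cochain_scale.
by move=> s; rewrite coboundZ df mulr0.
Qed.

Definition cupN n f g s := f (take n s) * g (drop n s).

Lemma cup_cochain n f g s : cochain n f ->
  cup f g s = if (n <= size s)%N then cupN n f g s else 0.
Proof.
move=> [_ f0]; rewrite /cup; case: leqP => ns.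
  rewrite (bigD1 (Ordinal (ns : n < (size s).+1)%N)) //= big1 ?addr0 // => i ni.
  by rewrite f0 ?mul0r // size_takel // -ltnS.
rewrite big1 // => i _; rewrite f0 ?mul0r // size_take; have := ltn_ord i.
by case: ifP; move: ns; lia.
Qed.

(** The Leibniz rule at a single cut, the only one that contributes when [f] has degree [n]. The
    left factor meets only [barE], because the term with [eps] of the first argument is split off;
    the right factor meets the whole coboundary. *)
Lemma barE_cupN n f g s : (n < size s)%N ->
  barE eps (cupN n f g) s = barE eps f (take n.+1 s) * g (drop n.+1 s)
    - (-1) ^+ n * (f (take n s) * cobound eps g (drop n s)).
Proof.
elim: n f s => [|n IH] f [//|a s] ns.
  rewrite (eq_barE (g := fun t => f [::] * g t)) ?barEZ; last first.
    by move=> t _; rewrite /cupN take0 drop0.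
  by rewrite take0 drop0 /= take0 drop0 barE1 coboundE; ring.
case: s ns => [//|b s] ns; rewrite barE2.
rewrite (eq_barE (f := fun t => cupN n.+1 f g (a :: t))
  (g := cupN n (fun t => f (a :: t)) g)) //.
rewrite IH // exprS /cupN /= barE2.
ring.
Qed.

Lemma cobound_cupN n f g s : (n < size s)%N ->
  cobound eps (cupN n f g) s = cobound eps f (take n.+1 s) * g (drop n.+1 s)
    + (-1) ^+ n * (f (take n s) * cobound eps g (drop n s)).
Proof.
case: s => [//|a s] ns; rewrite [in LHS]coboundE barE_cupN //.
rewrite [take n.+1 _]/= [cobound eps f _]coboundE /cupN [drop n.+1 _]/=; ring.
Qed.

Lemma cochain_cup n m f g :
  cochain n f -> cochain m g -> cochain (n + m) (cup f g).
Proof.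
move=> fc gc; split; last first.
  move=> s sz; rewrite (cup_cochain _ _ fc); case: leqP => // ns.
  by rewrite /cupN gc.2 ?mulr0 // size_drop; apply: contra sz; lia.
move=> s1 s2 c a b; rewrite !(cup_cochain _ _ fc) !size_cat /=.
case: leqP => _; last by rewrite mulr0 addr0.
rewrite /cupN !take_cat !drop_cat; case: ltnP => [_|le_i]; first by rewrite gc.1; ring.
by case: (n - size s1)%N => [|j] /=; rewrite ?(gc.1 [::]) ?fc.1 /=; ring.
Qed.

Lemma cocycle_cup n m f g :
  cocycle eps n f -> cocycle eps m g -> cocycle eps (n + m) (cup f g).
Proof.
move=> [fc df] [gc dg]; split; first exact: cochain_cup.
move=> s; have [sn|ns] := leqP (size s) n.
  apply: cobound_vanish => t st; rewrite (cup_cochain _ _ fc).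
  by case: leqP => // nt; move: sn; rewrite -st ltnNge nt.
rewrite (eq_cobound (g := cupN n f g)); last first.
  by move=> t st; rewrite (cup_cochain _ _ fc) -ltnS st ns.
by rewrite cobound_cupN // df dg; ring.
Qed.

End Multilinear.

Section Coefficients.
Variables (K : fieldType) (A : algType K) (eps : A -> K).
Hypothesis eps_lin : forall c a b, eps (c *: a + b) = c * eps a + eps b.
Implicit Types (F : A -> seq A -> K).

Definition linear_head F :=
  forall c v w t, F (c *: v + w) t = c * F v t + F w t.

Lemma linear_head0 F t : linear_head F -> F 0 t = 0.
Proof.
move=> Fl; have := Fl 1 0 0 t; rewrite scaler0 addr0 mul1r => /eqP.
by rewrite -subr_eq0 opprD addNKr oppr_eq0 => /eqP.
Qed.

Lemma linear_headZ F c v t : linear_head F -> F (c *: v) t = c * F v t.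
Proof. by move=> Fl; rewrite -[c *: v]addr0 Fl linear_head0 // addr0. Qed.

Lemma linear_head_barD F : linear_head F -> linear_head (barD eps F).
Proof.
move=> Fl c v w [|a t]; first by rewrite /barD mulr0 addr0.
rewrite !barD2 mulrDl -scalerAl Fl.
rewrite (eq_barE (f := F (c *: v + w)) (g := fun t => c * F v t + F w t)) //.
by rewrite barE_lin; ring.
Qed.

Lemma multilinear_barD F v : linear_head F -> (forall w, multilinear (F w)) ->
  multilinear (barD eps F v).
Proof.
move=> Fl Fm [|d s1] s2 c a b.
  have E := multilinear_barE eps_lin (Fm v) [::] s2 c a b.
  by rewrite !cat0s in E *; rewrite !barD2 E mulrDr -scalerAr Fl; ring.
have E := multilinear_barE eps_lin (Fm v) (d :: s1) s2 c a b.
by rewrite !cat_cons in E *; rewrite !barD2 E Fm; ring.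
Qed.

End Coefficients.

(** For [u ^+ p = 0] this is the cycle [u | u^(p-1) | ... | u | u^(p-1)] of the bar complex, on
    which even cohomology classes are evaluated. *)
Fixpoint zeta (K : fieldType) (A : algType K) (p : nat) (u : A) (n : nat) : seq A :=
  if n is n'.+1 then [:: u, u ^+ p.-1 & zeta p u n'] else [::].

(** * Cohomology of K[t]/t^p *)

Section TruncatedPolynomials.
Variables (K : fieldType) (p : nat).
Hypothesis p_gt1 : (1 < p)%N.
Local Notation R := (truncated K p).
Local Notation eps := (@trunc_eps K p).

Local Notation truncp := (in_qpoly ('X^p : {poly K})).

Lemma coef_truncp P i : (truncp P : {poly K})`_i = if (i < p)%N then P`_i else 0.
Proof. by rewrite /= mk_monic_Xn prednK ?(ltnW p_gt1) // -Pdiv.RingMonic.take_poly_rmodp coef_take_poly. Qed.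

Lemma size_trunc (q : R) : (size (q : {poly K}) <= p)%N.
Proof.
apply: leq_trans (size_npoly q) _.
by rewrite mk_monic_Xn prednK ?(ltnW p_gt1) // size_polyXn.
Qed.

Lemma truncp_eq (q r : R) :
  (forall i, (i < p)%N -> (q : {poly K})`_i = (r : {poly K})`_i) -> q = r.
Proof.
move=> qr; apply: val_inj; apply/polyP => i; case: (ltnP i p) => [/qr //|ip].
by rewrite /= !nth_default // (leq_trans (size_trunc _)).
Qed.

Lemma valK_truncp (q : R) : truncp q = q.
Proof. by apply: truncp_eq => i ip; rewrite coef_truncp ip. Qed.

Lemma truncpM_coef (q r : R) i : (i < p)%N ->
  (q * r : R) `_i = ((q : {poly K}) * r)`_i.
Proof.
by move=> ip; rewrite -[q * r]/(truncp ((q : {poly K}) * r)) coef_truncp ip.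
Qed.

Definition truncX : R := truncp 'X.
Local Notation s := truncX.

Lemma truncXn n : s ^+ n = truncp 'X^n.
Proof. by rewrite -rmorphXn. Qed.

Lemma truncXp : s ^+ p = 0.
Proof.
apply: truncp_eq => i ip; rewrite truncXn coef_truncp ip coefXn coef0.
by rewrite ltn_eqF.
Qed.

Lemma trunc_epsE (q : R) : eps q = (q : {poly K})`_0. Proof. by []. Qed.

Lemma trunc_eps_lin c (a b : R) : eps (c *: a + b) = c * eps a + eps b.
Proof. by rewrite !trunc_epsE coefD coefZ. Qed.

Lemma trunc_epsM (a b : R) : eps (a * b) = eps a * eps b.
Proof.
rewrite /trunc_eps truncpM_coef ?(ltnW p_gt1) // coefM big_ord_recl big_ord0.
by rewrite addr0.
Qed.

Lemma coef_trunc1 i : ((1 : R) : {poly K})`_i = (i == 0%N)%:R.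
Proof. by rewrite -[1 : R]/(qpolyC _ 1) qpolyCE coefC; case: eqP. Qed.

Lemma trunc_eps1 : eps 1 = 1.
Proof. exact: coef_trunc1. Qed.

Lemma truncXM_coef (q : R) i : (i < p)%N ->
  (s * q : R)`_i = if i == 0 then 0 else (q : {poly K})`_i.-1.
Proof.
move=> ip; rewrite -{1}(valK_truncp q) -rmorphM coef_truncp ip.
by rewrite mulrC coefMX.
Qed.

Lemma trunc_epsXM (q : R) : eps (s * q) = 0.
Proof. by rewrite /trunc_eps truncXM_coef // (ltnW p_gt1). Qed.

Lemma trunc_epsX : eps s = 0.
Proof. by rewrite -[s]mulr1 trunc_epsXM. Qed.

Lemma trunc_epsXn n : (0 < n)%N -> eps (s ^+ n) = 0.
Proof. by case: n => // n _; rewrite exprS trunc_epsXM. Qed.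

Definition trunc_top (q : R) : K := (q : {poly K})`_p.-1.

(** Division by [s] after removal of the constant term. By [trunc_dropXM] it inverts multiplication
    by [s] up to the socle, which [s ^+ p.-1] spans. *)
Definition trunc_drop (q : R) : R := truncp (drop_poly 1 q).

Lemma trunc_top_lin c (a b : R) :
  trunc_top (c *: a + b) = c * trunc_top a + trunc_top b.
Proof. by rewrite /trunc_top coefD coefZ. Qed.

Lemma trunc_drop_lin c (a b : R) :
  trunc_drop (c *: a + b) = c *: trunc_drop a + trunc_drop b.
Proof. by rewrite /trunc_drop linearP /= linearP. Qed.

Lemma trunc_topX : trunc_top (s ^+ p.-1) = 1.
Proof.
by rewrite /trunc_top truncXn coef_truncp prednK ?(ltnW p_gt1) // leqnn coefXn eqxx.
Qed.

Lemma trunc_head (q : R) : q = eps q *: 1 + s * trunc_drop q.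
Proof.
apply: truncp_eq => i ip; rewrite coefD coefZ truncXM_coef //.
rewrite coef_trunc1 coef_truncp coef_drop_poly.
case: i ip => [|i] ip /=; first by rewrite mulr1 addr0.
by rewrite mulr0 add0r (ltnW ip) addn1.
Qed.

Lemma trunc_dropXM (q : R) : trunc_drop (s * q) = q - trunc_top q *: s ^+ p.-1.
Proof.
apply: truncp_eq => i ip; rewrite coefB coefZ coef_truncp ip coef_drop_poly addn1.
rewrite truncXn (coef_truncp 'X^(p.-1)) ip coefXn.
case: (ltnP i.+1 p) => [ip1|pi].
  rewrite truncXM_coef //= (_ : i == p.-1 = false) ?mulr0 ?subr0 //.
  by apply/eqP => Ei; rewrite Ei prednK ?ltnn // (ltnW p_gt1) in ip1.
have -> : i = p.-1 by move: ip pi; lia.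
rewrite eqxx mulr1 subrr nth_default //.
by rewrite prednK ?(ltnW p_gt1) // size_trunc.
Qed.

Lemma truncX_topM (a : R) : s ^+ p.-1 * a = eps a *: s ^+ p.-1.
Proof.
rewrite {1}(trunc_head a) mulrDr -scalerAr mulr1 mulrA -exprSr.
by rewrite prednK ?(ltnW p_gt1) // truncXp mul0r addr0.
Qed.

Lemma truncX_mul_top : s * s ^+ p.-1 = 0.
Proof. by rewrite -exprS prednK ?(ltnW p_gt1) // truncXp. Qed.

(** Adjacent entries multiply to [s ^+ p = 0] and the last entry has augmentation 0, so every term
    of the differential vanishes. *)
Lemma barE_zeta (f : seq R -> K) n : multilinear f ->
  barE eps f (s ^+ p.-1 :: zeta p s n) = 0.
Proof.
elim: n f => [|n IH] f fl.
  by rewrite barE1 trunc_epsXn ?mulr0 //; move: p_gt1; lia.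
rewrite [zeta _ _ _]/= !barE2 truncX_topM trunc_epsX scale0r truncX_mul_top.
rewrite (multilinear0 [::]) // (multilinear0 [:: _]) // IH ?subr0 //.
exact: (multilinear_cons _ (multilinear_cons _ fl)).
Qed.

Lemma cobound_zeta (f : seq R -> K) n : multilinear f ->
  cobound eps f (zeta p s n) = 0.
Proof.
case: n => [//|n] fl; rewrite [zeta _ _ _]/= coboundE trunc_epsX mul0r barE2.
rewrite truncX_mul_top (multilinear0 [::]) // barE_zeta ?subr0 //.
exact: multilinear_cons.
Qed.

(* The dimension shift through the injective hull of the trivial module: [h]
   and [G] are the cochains with coefficients that it produces. *)
Lemma trunc_cocycle_coboundary n (f : seq R -> K) :
  cocycle eps n.*2 f -> f (zeta p s n) = 0 ->
  exists g, [/\ multilinear g,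
    forall t, (size t).+1 != n.*2 -> g t = 0 & f = cobound eps g].
Proof.
have eM := trunc_epsM.
elim: n f => [|n IH] f [[fl f0] df] fz.
  exists (fun=> 0); split => //.
    by case: (cochain_zero R 0%N).
  apply/funext => -[|a t]; first by rewrite fz.
  by rewrite f0 // cobound_vanish.
set k := n.*2 in IH; rewrite doubleS -/k in f0.
pose h v t := f [:: s, v & t].
have hl : linear_head h by move=> c v w t; exact: (fl [:: s]).
have hm v : multilinear (h v) by exact: (multilinear_cons _ (multilinear_cons _ fl)).
(* The cocycle identity at [s, v, a, t], whose head term vanishes because [eps s = 0]. *)
have Dh v a t : barD eps h v (a :: t) = f [:: s * v, a & t].
  have := df [:: s, v, a & t]; rewrite coboundE trunc_epsX mul0r sub0r barE2 barE_cons.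
  by move/eqP; rewrite oppr_eq0 subr_eq0 => /eqP ->.
(* Since [s ^+ p.-1 * a = eps a *: s ^+ p.-1], the differential with coefficients becomes the
   trivial one at this argument, and [h (s ^+ p.-1)] is a cocycle of degree two less. *)
have [||g'' [gl g0 fg]] := IH (h (s ^+ p.-1)).
- split; first by split=> // t tk; apply: f0; rewrite /= !eqSS.
  move=> [//|a t]; rewrite coboundE -(linear_headZ _ _ _ hl) -truncX_topM.
  rewrite -[_ - _]/(barD eps h (s ^+ p.-1) (a :: t)) Dh truncX_mul_top.
  exact: (multilinear0 [::]).
- by [].
(* [g''] is spread over all coefficients by the functional that is 1 on the socle generator;
   subtracting the differential of [gt] makes [h'] vanish on the socle. *)
pose gt v t := trunc_top v * g'' t.
have gtl : linear_head gt by move=> c v w t; rewrite /gt trunc_top_lin; ring.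
have gtm v : multilinear (gt v) by exact: multilinear_scale.
pose h' v t := h v t - barD eps gt v t.
have h'l : linear_head h'.
  by move=> c v w t; rewrite /h' hl (linear_head_barD _ gtl); ring.
have h'm v : multilinear (h' v).
  by apply: multilinear_sub => //; apply: multilinear_barD => //; exact: trunc_eps_lin.
have h'top t : h' (s ^+ p.-1) t = 0.
  rewrite /h' (congr1 (@^~ t) fg) /=; case: t => [|a t]; first by rewrite subrr.
  rewrite barD2 /gt truncX_topM -[eps a *: _]addr0 trunc_top_lin trunc_topX.
  rewrite (_ : trunc_top 0 = 0) ?addr0; last by rewrite /trunc_top coef0.
  by rewrite barEZ coboundE; ring.
have h'drop w t : h' (trunc_drop (s * w)) t = h' w t.
  by rewrite trunc_dropXM addrC -scaleNr h'l h'top mulr0 add0r.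
(* As [h'] vanishes on the socle, it can be transported along multiplication by [s]; the
   differential of [e1] then agrees with [f] on the ideal generated by [s]. *)
pose e1 v t := h' (trunc_drop v) t.
have e1l : linear_head e1 by move=> c v w t; rewrite /e1 trunc_drop_lin h'l.
have e1m v : multilinear (e1 v) by exact: h'm.
have De1 w t : barD eps e1 (s * w) t = f (s * w :: t).
  case: t => [|a t]; first by rewrite f0.
  rewrite barD2 /e1 -mulrA h'drop.
  rewrite (eq_barE (f := h' (trunc_drop (s * w))) (g := h' w)) //.
  by rewrite -[LHS]/(barD eps h' w (a :: t)) barD_sub barDD // subr0 Dh.
(* [G] vanishes on multiples of [s], so it depends on [v] through [eps v] alone, and [G 1] is a
   cochain with trivial coefficients. *)
pose G v t := f (v :: t) - barD eps e1 v t.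
have Gl : linear_head G.
  by move=> c v w t; rewrite /G (fl [::]) (linear_head_barD _ e1l) /=; ring.
have GE v t : G v t = eps v * G 1 t.
  by rewrite {1}(trunc_head v) Gl {2}/G De1 subrr addr0.
exists (G 1); split.
- apply: multilinear_sub; first exact: multilinear_cons.
  by apply: multilinear_barD => //; exact: trunc_eps_lin.
- have e10 v t : size t != k -> e1 v t = 0.
    move=> tk; rewrite /e1 /h' {1}/h f0 ?sub0r; last by rewrite /= !eqSS.
    case: t tk => [|b t] tk; first exact: oppr0.
    rewrite barD2 /gt g0 // barEZ barE_vanish ?mulr0 ?subr0 ?oppr0 // => u [su].
    by rewrite g0 // su.
  move=> t; rewrite doubleS => tk; rewrite /G f0 ?sub0r; last by rewrite /= eqSS.
  case: t tk => [|b t] tk; first exact: oppr0.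
  rewrite barD2 e10 ?barE_vanish ?subr0 ?oppr0 //.
  by move=> u [su]; rewrite e10 // su; move: tk; rewrite /= !eqSS.
apply/funext => -[|a t]; first by rewrite f0.
rewrite coboundE -GE -{2}[a]mul1r -[RHS]/(barD eps G 1 (a :: t)) barD_sub barDD // subr0.
rewrite -barE_cons; have := df [:: 1, a & t].
by rewrite coboundE trunc_eps1 mul1r => /eqP; rewrite subr_eq0 => /eqP.
Qed.

Lemma trunc_cocycle_coboundary_even n (f : seq R -> K) :
  cocycle eps n.*2 f -> f (zeta p s n) = 0 -> coboundary eps f.
Proof.
move=> fc fz; have [g [gl g0 ->]] := trunc_cocycle_coboundary fc fz.
exists n.*2.-1, g; split=> //; split=> // t tn; apply: g0.
by apply: contra tn => /eqP <-.
Qed.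

(** The factorisation [s ^+ p.-1 = s ^+ p.-2 * s] moves the problem to a shorter cycle behind the
    prefix [s ^+ p.-2, s ^+ 2], whose product is 0. The condition on [f] concerns only lists that
    begin with [s ^+ p.-2], so that the cochain with this prefix inherits it. *)
Lemma zeta_odd_aux n (f : seq R -> K) : (2 < p)%N -> multilinear f ->
  (forall t, barE eps f (s ^+ p.-2 :: t) = 0) -> f (s ^+ p.-1 :: zeta p s n) = 0.
Proof.
move=> p2; have pE : p.-1 = p.-2.+1 by move: p2; lia.
have pE2 : p = p.-2.+2 by move: p2; lia.
have s0 : s ^+ p.-2 * s ^+ 2 = 0 by rewrite -exprD addn2 -pE2 truncXp.
have s0' : s ^+ 2 * s ^+ p.-2 = 0 by rewrite -exprD add2n -pE2 truncXp.
elim: n f => [|n IH] f fl fE.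
  by have := fE [:: s]; rewrite barE2 barE1 trunc_epsX mulr0 subr0 -exprSr -pE.
have := fE [:: s, s, s ^+ p.-1 & zeta p s n].
rewrite !barE2 truncX_mul_top (multilinear0 [:: _; _]) // barE_zeta; last first.
  exact: (multilinear_cons _ (multilinear_cons _ (multilinear_cons _ fl))).
rewrite !subr0 -exprSr -pE => /eqP; rewrite subr_eq0 => /eqP ->.
rewrite -expr2; apply: (IH (fun t => f [:: s ^+ p.-2, s ^+ 2 & t])).
  exact: (multilinear_cons _ (multilinear_cons _ fl)).
move=> t; have := fE [:: s ^+ 2, s ^+ p.-2 & t].
rewrite !barE2 s0 s0' (multilinear0 [::]) // (multilinear0 [:: _]) // !sub0r opprK.
by [].
Qed.

(** Here p > 2 enters: [s ^+ p.-2] must lie in the augmentation ideal. For p = 2 the cohomology ring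
    is polynomial on a class of degree 1, and odd classes are not nilpotent. *)
Lemma zeta_odd n m (f : seq R -> K) : (2 < p)%N -> cocycle eps m f ->
  f (s ^+ p.-1 :: zeta p s n) = 0.
Proof.
move=> p2 [[fl _] df]; apply: zeta_odd_aux => // t.
have := df (s ^+ p.-2 :: t); rewrite coboundE trunc_epsXn ?mul0r ?sub0r.
  by move/eqP; rewrite oppr_eq0 => /eqP.
by move: p2; lia.
Qed.

End TruncatedPolynomials.

(** * Eckmann-Shapiro: cocycles that vanish on a subalgebra over which A is free *)

Section Shapiro.
Variables (K : fieldType) (A : algType K) (eps : A -> K).
Hypothesis eps_lin : forall c a b, eps (c *: a + b) = c * eps a + eps b.
Hypothesis epsM : forall a b, eps (a * b) = eps a * eps b.
Implicit Types (f g : seq A -> K) (s t : seq A).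

(** A product formed inside [l ++ [:: a]] leaves the tail [s] behind a list of the length of [l],
    where [f] vanishes; only the terms that act on the tail survive. *)
Lemma barE_lead l f a s : (forall t, size t = size l -> f (t ++ s) = 0) ->
  barE eps f (l ++ a :: s) = (-1) ^+ size l * barE eps (fun t => f (l ++ t)) (a :: s).
Proof.
elim: l f => [|c l IH] f f0; first by rewrite mul1r.
have {}IH : barE eps (fun t => f (c :: t)) (l ++ a :: s) =
    (-1) ^+ size l * barE eps (fun t => f (c :: l ++ t)) (a :: s).
  by apply: IH => t tl; apply: (f0 (c :: t)); rewrite /= tl.
case: l f0 IH => [|d l] f0 IH; rewrite !cat_cons barE2.
  by rewrite (f0 [:: c * a]) // IH expr1; ring.
have := f0 (c * d :: l ++ [:: a]); rewrite /= size_cat addn1 => /(_ erefl).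
rewrite -catA /= => ->; rewrite IH [in RHS]/= exprS; ring.
Qed.

Lemma cobound_lead l f a s : (forall t, size t = size l -> f (t ++ s) = 0) ->
  cobound eps f (l ++ a :: s) =
  - ((-1) ^+ size l * barE eps (fun t => f (l ++ t)) (a :: s)).
Proof.
move=> f0; case: l f0 => [|c l] f0.
  by rewrite cat0s coboundE (f0 [::]) //; ring.
rewrite cat_cons coboundE -cat_cons barE_lead //.
have := f0 (l ++ [:: a]); rewrite size_cat addn1 => /(_ erefl).
by rewrite -catA /= => ->; ring.
Qed.

Variables (R : A -> Prop) (I : finType) (i0 : I) (b : I -> A) (r : I -> A -> A).
Hypothesis r_lin : forall i c x y, r i (c *: x + y) = c *: r i x + r i y.
Hypothesis brE : forall a, a = \sum_i b i * r i a.
Hypothesis rR : forall i a, R (r i a).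
Hypothesis r_mul : forall i a c, R c -> r i (a * c) = r i a * c.
Hypothesis b1 : b i0 = 1.
Hypothesis r_id : forall i c, R c -> r i c = if i == i0 then c else 0.
Hypothesis R1 : R 1.

Fixpoint inR s := if s is a :: s' then R a /\ inR s' else True.

Definition vanish_on j f := forall t s, size t = j -> inR s -> f (t ++ s) = 0.

(** A homotopy in position [j]: the entry there is split along the basis [b] of the free right
    [R]-module. *)
Definition induce j f t : K :=
  if (j < size t)%N then
    \sum_i f (take j t ++ [:: b i, r i (nth 0 t j) & drop j.+1 t])
  else 0.

Lemma induce_cat f l a s :
  induce (size l) f (l ++ a :: s) = \sum_i f (l ++ [:: b i, r i a & s]).
Proof.
rewrite /induce size_cat /= -addSnnS leq_addr; apply: eq_bigr => i _.
rewrite take_size_cat // nth_cat ltnn subnn /= drop_cat ltnNge leqnSn /=.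
by rewrite subSn // subnn /= drop0.
Qed.

Lemma cochain_induce j n f : cochain n.+1 f -> cochain n (induce j f).
Proof.
move=> [fl f0]; split; last first.
  move=> s sn; rewrite /induce; case: ltnP => // js; apply: big1 => i _.
  rewrite f0 // size_cat /= size_takel ?(ltnW js) // size_drop.
  by apply: contra sn; move: js; lia.
move=> s1 s2 c x y; rewrite /induce !size_cat /= !take_cat !drop_cat !nth_cat.
case: ltnP => _; last by rewrite mulr0 addr0.
rewrite mulr_sumr -big_split /=; apply: eq_bigr => i _.
case: (ltngtP j (size s1)) => [js|sj|->].
- case: (ltnP j.+1 (size s1)) => js'.
    by rewrite -!cat_cons !catA fl.
  have Ej : size s1 = j.+1 by apply/eqP; rewrite eqn_leq js js'.
  rewrite Ej subnn /=.
  by have := fl (take j s1 ++ [:: b i; r i (nth 0 s1 j)]) s2 c x y; rewrite -!catA.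
- rewrite ltnNge (leqW (ltnW sj)) /=.
  have [m Em] : exists m, (j - size s1)%N = m.+1 by exists (j - size s1).-1; lia.
  have Em' : (j.+1 - size s1)%N = m.+2 by move: Em; lia.
  by rewrite Em Em' /= -!catA; exact: fl.
rewrite subnn take0 subSn // subnn ltnNge leqnSn /= r_lin !cats0 !drop0.
by have := fl (s1 ++ [:: b i]) s2 c (r i x) (r i y); rewrite -!catA.
Qed.

(** Subtracting a coboundary allows one more arbitrary argument in front of those from [R]. The
    bound on [j] leaves at least one argument from [R] behind it. *)
Lemma vanish_onS j n f : cocycle eps n f -> (j.+2 <= n)%N -> vanish_on j f ->
  vanish_on j.+1 (fun t => f t - (- (-1) ^+ j) * cobound eps (induce j f) t).
Proof.
case: n => [//|n] [fc df] jn fv t s tj sR.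
have gc : cochain n (induce j f) by exact: cochain_induce.
have [fl f0] := fc.
have [ts|ts] := eqVneq (size (t ++ s)) n.+1; last first.
  by rewrite f0 // (cochain_cobound eps_lin gc).2 // mulr0 subrr.
case/lastP: t tj ts => [//|l a]; rewrite size_rcons => -[lj].
rewrite size_cat size_rcons lj => ts; rewrite cat_rcons.
case: s sR ts => [_ /= ts|c s]; first by exfalso; move: jn ts; lia.
move=> [cR sR] ts.
(* On an entry of [R] the splitting has the single term [1 * c], and [f] vanishes because the first
   [j] arguments are followed by [1, c, s], all in [R]. *)
have gv u : size u = size l -> induce j f (u ++ c :: s) = 0.
  move=> ul; rewrite -lj -ul induce_cat (bigD1 i0) //= big1 => [|i ii0].
    by rewrite b1 r_id // eqxx addr0 fv ?ul //; do !split.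
  by rewrite r_id // (negPf ii0); have := multilinear0 (u ++ [:: b i]) s fl; rewrite -catA.
rewrite cobound_lead // lj barE2.
(* The cocycle identities at [l, b i, r i a, c, s] are summed over [i], so that the products
   [b i * r i a] add up to [a]. *)
have E : \sum_i (f (l ++ b i * r i a :: c :: s) - f (l ++ [:: b i, r i a * c & s])
      + barE eps (fun t => f (l ++ [:: b i, r i a & t])) (c :: s)) = 0.
  apply: big1 => i _; have := df (l ++ [:: b i, r i a, c & s]).
  rewrite cobound_lead; last by move=> u ul; apply: fv; [rewrite ul | split].
  rewrite !barE2 => /eqP; rewrite oppr_eq0 mulf_eq0 signr_eq0 /= => /eqP E.
  by rewrite -E; ring.
have {}E : f (l ++ [:: a, c & s]) = induce j f (l ++ (a * c :: s))
    - barE eps (fun t => induce j f (l ++ a :: t)) (c :: s).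
  rewrite -lj induce_cat; under eq_bigr do rewrite r_mul //.
  have -> : barE eps (fun t => induce (size l) f (l ++ a :: t)) (c :: s) =
      \sum_i barE eps (fun t => f (l ++ [:: b i, r i a & t])) (c :: s).
    rewrite (eq_barE (g := fun t => \sum_i f (l ++ [:: b i, r i a & t]))).
      by rewrite barE_sum.
    by move=> u _; rewrite induce_cat.
  move: E; rewrite big_split sumrB /=.
  have -> : \sum_i f (l ++ b i * r i a :: c :: s) = f (l ++ [:: a, c & s]).
    rewrite {2}(brE a).
    have := multilinear_sum l (c :: s) (fun=> 1) (fun i => b i * r i a) fl.
    under eq_bigr do rewrite scale1r; move=> ->.
    by apply: eq_bigr => i _; rewrite mul1r.
  by move/eqP; rewrite addr_eq0 subr_eq => /eqP ->; rewrite addrC.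
by rewrite E mulrN mulNr opprK mulrA -expr2 sqrr_sign mul1r subrr.
Qed.

Lemma vanish_on_reduce j n f : cocycle eps n f -> vanish_on 0 f -> (j < n)%N ->
  exists2 g, cochain n.-1 g & vanish_on j (fun t => f t - cobound eps g t).
Proof.
move=> fc fv; elim: j => [|j IH] jn.
  exists (fun=> 0); first exact: cochain_zero.
  by move=> t s tj sR; rewrite cobound_vanish // subr0 fv.
have [g gc gv] := IH (ltnW jn).
have nE : n = n.-1.+1 by move: jn; lia.
have dgc : cocycle eps n (cobound eps g).
  by rewrite nE; split; [exact: cochain_cobound | exact: cobound_cobound].
pose f' t := f t - cobound eps g t.
have f'c : cocycle eps n f' by exact: cocycle_sub.
pose g' := induce j f'.
have g'c : cochain n.-1 g' by apply: cochain_induce; rewrite -nE; case: f'c.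
exists (fun t => (- (-1) ^+ j) * g' t + g t); first exact: cochain_comb.
move=> t s tj sR; have := vanish_onS f'c jn gv tj sR.
by rewrite cobound_lin => E; rewrite -E /f'; ring.
Qed.

(** In the cocycle identity at [t, a, c] only the product [a * c] and the term with [eps c]
    survive. *)
Lemma vanish_on_last n f t a c : cocycle eps n.+1 f -> vanish_on n f ->
  R c -> eps c = 0 -> f (rcons t (a * c)) = 0.
Proof.
move=> [[fl f0] df] fv cR c0; have [tn|tn] := eqVneq (size t) n; last first.
  by rewrite f0 // size_rcons.
have := df (t ++ [:: a; c]); rewrite cobound_lead; last first.
  by move=> u ul; apply: fv; rewrite ?ul.
rewrite barE2 barE1 c0 mulr0 subr0 => /eqP.
by rewrite oppr_eq0 mulf_eq0 signr_eq0 /= cats1 => /eqP.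
Qed.

Lemma shapiro n f : cocycle eps n.+1 f -> vanish_on 0 f ->
  exists2 g, cochain n g &
    forall t a c, R c -> eps c = 0 ->
      f (rcons t (a * c)) = cobound eps g (rcons t (a * c)).
Proof.
move=> fc fv; have [g gc gv] := vanish_on_reduce fc fv (leqnn n.+1).
exists g => // t a c cR c0; apply/eqP; rewrite -subr_eq0; apply/eqP.
apply: (@vanish_on_last n (fun t => f t - cobound eps g t)) cR c0 => //.
apply: cocycle_sub => //.
by split; [exact: (cochain_cobound eps_lin gc) | exact: cobound_cobound].
Qed.

End Shapiro.

Lemma zeta_cat (K : fieldType) (A : algType K) p (u : A) m n :
  zeta p u (m + n) = zeta p u m ++ zeta p u n.
Proof. by elim: m => //= m ->. Qed.

Lemma size_zeta (K : fieldType) (A : algType K) p (u : A) n :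
  size (zeta p u n) = n.*2.
Proof. by elim: n => //= n ->. Qed.

(** * Functoriality and scalar extension of cochains *)

Section AlgebraMaps.
Variables (K : fieldType) (B C : algType K) (h : {lrmorphism B -> C}).
Variables (epsB : B -> K) (epsC : C -> K).
Hypothesis eps_h : forall b, epsC (h b) = epsB b.

Lemma multilinear_comp f : multilinear f -> multilinear (fun s => f (map h s)).
Proof. by move=> fl s1 s2 c a b; rewrite !map_cat /= linearP fl. Qed.

Lemma cochain_comp n f : cochain n f -> cochain n (fun s => f (map h s)).
Proof.
move=> [fl f0]; split; first exact: multilinear_comp.
by move=> s sn; rewrite f0 // size_map.
Qed.

Lemma barE_comp f s : barE epsB (fun s => f (map h s)) s = barE epsC f (map h s).
Proof.
elim: s f => [//|a [|b s] IH] f; first by rewrite !barE1 eps_h.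
by rewrite barE2 (IH (fun t => f (h a :: t))) /= barE2 rmorphM.
Qed.

Lemma cobound_comp f s :
  cobound epsB (fun s => f (map h s)) s = cobound epsC f (map h s).
Proof. by case: s => [//|a s]; rewrite /= !coboundE barE_comp -eps_h. Qed.

Lemma cocycle_comp n f :
  cocycle epsC n f -> cocycle epsB n (fun s => f (map h s)).
Proof.
by move=> [fc df]; split; [exact: cochain_comp | move=> s; rewrite cobound_comp].
Qed.

Lemma map_zeta p u n : map h (zeta p u n) = zeta p (h u) n.
Proof. by elim: n => //= n ->; rewrite rmorphXn. Qed.

End AlgebraMaps.

Section ScalarExtension.
Variables (k K : fieldType) (iota : {rmorphism k -> K}) (A : falgType k).
Variable eps : {lrmorphism A -> k^o}.
Local Notation AK := (bc iota A).
Local Notation inK := (@bc_in k K iota A).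
Implicit Types (f g : seq A -> k).
Local Notation bcc f := (@bc_cochain k A K iota f).

Definition epsK (u : AK) : K := bc_lift (W := K^o) (fun a => iota (eps a)) u.

Lemma epsK_iota : iota_linear (W := K^o) iota (fun a => iota (eps a)).
Proof. by move=> c a b; rewrite linearP /= rmorphD rmorphM. Qed.

Lemma epsK_in a : epsK (bc_in iota a) = iota (eps a).
Proof. by rewrite /epsK bc_liftK //; exact: epsK_iota. Qed.

Lemma epsK_lin c a b : epsK (c *: a + b) = c * epsK a + epsK b.
Proof. by rewrite /epsK bc_lift_linear. Qed.

Lemma epsKM a b : epsK (a * b) = epsK a * epsK b.
Proof.
move: a; apply: (@bc_eq _ _ iota A K^o) => [c x y|c x y|a].
- by rewrite mulrDl -scalerAl epsK_lin.
- by rewrite epsK_lin mulrDl -mulrA.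
move: b; apply: (@bc_eq _ _ iota A K^o) => [c x y|c x y|b].
- by rewrite mulrDr -scalerAr epsK_lin.
- by rewrite epsK_lin mulrDr mulrCA.
by rewrite -[_ * _]/(bc_mul _ _) bc_mulE !epsK_in !rmorphM.
Qed.

Lemma epsK1 : epsK 1 = 1.
Proof. by rewrite -[1]/(bc_in iota 1) epsK_in !rmorph1. Qed.

Lemma bc_cochain_in f s : multilinear f ->
  bcc f (map inK s) = iota (f s).
Proof.
elim: s f => [//|a s IH] f fl /=.
rewrite bc_liftK; last exact: bc_cochain_cons.
by rewrite (IH (fun t => f (a :: t))) //; exact: multilinear_cons.
Qed.

Lemma multilinear_bc f : multilinear f -> multilinear (bcc f).
Proof.
move=> fl s1; elim: s1 f fl => [|u s1 IH] f fl s2 c a b /=.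
  by rewrite bc_lift_linear.
rewrite /bc_lift mulr_sumr -big_split /=; apply: eq_bigr => i _.
by rewrite (IH (fun t => f (evec i :: t))) ?scalerDr //;
  [rewrite /GRing.scale /= mulrCA | exact: multilinear_cons].
Qed.

Lemma cochain_bc n f : cochain n f -> cochain n (bcc f).
Proof.
move=> [fl f0]; split; first exact: multilinear_bc.
move=> s; elim: s n f {fl} f0 => [|u s IH] n f f0 sn /=.
  by rewrite f0 ?rmorph0.
rewrite /bc_lift big1 // => i _; case: n f0 sn => [|n] f0 sn.
  by rewrite (IH (size s).+1) ?scaler0 ?neq_ltn ?ltnSn // => t _; rewrite f0.
by rewrite (IH n) ?scaler0 // => t tn; rewrite f0.
Qed.

Lemma multilinear_ext (F G : seq AK -> K) : multilinear F -> multilinear G ->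
  (forall s, F (map inK s) = G (map inK s)) -> F =1 G.
Proof.
move=> Fl Gl FG s; rewrite -[s]cat0s -[[::]]/(map inK [::]).
elim: s [::] => [|u s IH] t; first by rewrite cats0.
rewrite (bc_sum u) !multilinear_sum //; apply: eq_bigr => i _; congr (_ * _).
by have := IH (rcons t (evec i)); rewrite map_rcons cat_rcons.
Qed.

Lemma barE_map_in f s : multilinear f ->
  barE epsK (bcc f) (map inK s) = iota (barE eps f s).
Proof.
move=> fl; rewrite -[X in X = _]/(barE epsK (fun t => bc_cochain f t) _).
suff E (g : seq AK -> K) : (forall s, g (map inK s) = iota (f s)) ->
    barE epsK g (map inK s) = iota (barE eps f s).
  by apply: E => t; exact: bc_cochain_in.
elim: s f g {fl} => [|a [|b s] IH] f g fg; first by rewrite rmorph0.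
  by rewrite /= !barE1 epsK_in rmorphM -fg.
rewrite [map _ _]/= !barE2 -[_ * _]/(bc_mul _ _) bc_mulE rmorphB /=.
rewrite -(fg (a * b :: s)) /=; congr (_ - _).
by rewrite -[bc_in _ b :: _]/(map _ (b :: s)); apply: IH => t; rewrite -fg.
Qed.

Lemma cobound_bc f : multilinear f ->
  bcc (cobound eps f) = cobound epsK (bc_cochain f).
Proof.
move=> fl; apply/funext; apply: multilinear_ext.
- by apply/multilinear_bc/multilinear_cobound => // c a b; rewrite linearP.
- by apply: multilinear_cobound; [exact: epsK_lin | exact: multilinear_bc].
move=> s; rewrite bc_cochain_in; last first.
  by apply: multilinear_cobound => // c a b; rewrite linearP.
case: s => [|a s]; first exact: rmorph0.
rewrite [map _ _]/= !coboundE rmorphB rmorphM epsK_in bc_cochain_in //.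
by rewrite -barE_map_in.
Qed.

Lemma bc_cochain0 s : bcc (fun=> 0) s = 0.
Proof.
elim: s => [|u s IH] /=; first exact: rmorph0.
by rewrite /bc_lift big1 // => i _; rewrite IH scaler0.
Qed.

Lemma bc_cochainZ c f s : bcc (fun t => c * f t) s = iota c * bcc f s.
Proof.
have := bc_cochain_lin c f (fun=> 0) s; rewrite bc_cochain0 addr0 => <-.
by congr bc_cochain; apply/funext => t; rewrite addr0.
Qed.

Lemma cocycle_bc n f : cocycle eps n f -> cocycle epsK n (bcc f).
Proof.
move=> [fc df]; split; first exact: cochain_bc.
move=> s; rewrite -cobound_bc; last by case: fc.
rewrite (_ : cobound eps f = fun=> 0); last exact/funext.
exact: bc_cochain0.
Qed.

Lemma cup_bc n m f g : cochain n f -> cochain m g ->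
  bcc (cup f g) = cup (bc_cochain f) (bc_cochain g).
Proof.
move=> fc gc; apply/funext; apply: multilinear_ext.
- by apply/multilinear_bc; case: (cochain_cup fc gc).
- by case: (cochain_cup (cochain_bc fc) (cochain_bc gc)).
move=> s; rewrite bc_cochain_in; last by case: (cochain_cup fc gc).
rewrite /cup size_map rmorph_sum; apply: eq_bigr => i _.
rewrite -map_take -map_drop !bc_cochain_in ?rmorphM //.
  by case: gc.
by case: fc.
Qed.

Lemma cochain_cupn n f m : cochain n f -> cochain (n * m) (cupn f m).
Proof.
move=> fc; elim: m => [|m IH]; last first.
  by rewrite mulnS; exact: (cochain_cup fc IH).
rewrite muln0; split; last by case.
by move=> [|x s1] s2 c a b /=; rewrite mulr0 addr0.
Qed.

Lemma cocycle_cupn n f m : cocycle eps n f -> cocycle eps (n * m) (cupn f m).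
Proof.
move=> fc; elim: m => [|m IH]; last first.
  by rewrite mulnS; exact: (cocycle_cup fc IH).
split; first by apply: cochain_cupn; case: fc.
case=> [//|a s]; rewrite coboundE.
case: s => [|b s]; first by rewrite barE1 /= mulrC subrr.
by rewrite mulr0 barE_vanish ?subrr // => -[].
Qed.

Lemma cupn1 f : multilinear f -> cupn f 1 = f.
Proof.
move=> fl; apply/funext => s; rewrite /cupn /= /cup big_ord_recr /=.
rewrite take_size drop_size mulr1 big1 ?add0r // => i _.
have: (0 < size (drop i s))%N by rewrite size_drop subn_gt0.
by case: (drop i s) => //= *; rewrite mulr0.
Qed.

End ScalarExtension.

(** * Homogeneous primes defined by pi-points, and closed points *)

Section PointClass.
Variables (k K : fieldType) (iota : {rmorphism k -> K}) (A : falgType k).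
Variables (eps : {lrmorphism A -> k^o}) (p : nat).
Hypothesis p_gt2 : (2 < p)%N.
Variable alpha : {lrmorphism truncated K p -> bc iota A}.
Local Notation AK := (bc iota A).
Local Notation s := (truncX K p).
Local Notation u := (alpha s).
Local Notation bcc f := (@bc_cochain k A K iota f).
Implicit Types (f g : seq A -> k).

Let p_gt1 : (1 < p)%N := ltnW p_gt2.

(** The image of t is nilpotent and so has augmentation 0: every algebra map out of K[t]/t^p
    respects the augmentations. *)
Lemma epsK_alpha q : epsK eps (alpha q) = trunc_eps q.
Proof.
have eX n : epsK eps (u ^+ n) = epsK eps u ^+ n.
  by elim: n => [|n IH]; [rewrite !expr0 epsK1 | rewrite !exprS epsKM IH].
have u0 : epsK eps u = 0.
  have := eX p; rewrite -rmorphXn /= truncXp // rmorph0.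
  have := epsK_lin eps 0 (0 : AK) 0; rewrite scaler0 addr0 mul0r add0r => _.
  have -> : epsK eps (0 : AK) = 0 by rewrite /epsK linear0.
  by move/esym/eqP; rewrite expf_eq0 => /andP[_ /eqP].
rewrite {1}(trunc_head p_gt1 q) linearD linearZ /= rmorph1 rmorphM /=.
by rewrite epsK_lin epsKM u0 epsK1 mul0r addr0 mulr1.
Qed.

Lemma cocycle_point n f :
  cocycle eps n f -> cocycle (@trunc_eps K p) n (fun t => bcc f (map alpha t)).
Proof. by move=> fc; apply: (cocycle_comp epsK_alpha); exact: cocycle_bc. Qed.

Definition point_class f n : K := bcc f (zeta p u n).

Lemma point_class_cup n m f g : cochain n.*2 f -> cochain m.*2 g ->
  point_class (cup f g) (n + m) = point_class f n * point_class g m.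
Proof.
move=> fc gc; rewrite /point_class (cup_bc _ fc gc) (cup_cochain _ _ (cochain_bc _ fc)).
rewrite zeta_cat size_cat !size_zeta leq_addr /cupN.
by rewrite take_size_cat ?size_zeta // drop_size_cat ?size_zeta.
Qed.

Lemma point_class_cupn n m f : cochain n.*2 f ->
  point_class (cupn f m) (n * m) = point_class f n ^+ m.
Proof.
move=> fc; elim: m => [|m IH]; first by rewrite muln0 /point_class /= rmorph1.
rewrite mulnS exprS -IH -point_class_cup //.
by have := cochain_cupn m fc; rewrite -doubleMl.
Qed.

Lemma point_class_odd_cup n m f g :
  cocycle eps n.*2.+1 f -> cocycle eps m.*2.+1 g ->
  point_class (cup f g) (n + m.+1) = 0.
Proof.
move=> fc gc; have [[fo _] [go _]] := (fc, gc).
rewrite /point_class (cup_bc _ fo go) (cup_cochain _ _ (cochain_bc _ fo)).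
rewrite -addSnnS addSn -addnS zeta_cat size_cat !size_zeta.
have -> : (n.*2.+1 <= n.*2 + m.+1.*2)%N by lia.
have g0 := zeta_odd p_gt1 m p_gt2 (cocycle_point gc).
move: g0; rewrite /= map_zeta rmorphXn /= => g0.
rewrite /cupN drop_cat size_zeta ltnNge leqnSn /= subSn // subnn /= ?drop0.
by rewrite g0 mulr0.
Qed.

(** One scalar decides membership in the radical of the kernel: exponent 1 suffices for even
    classes, which become coboundaries on K[t]/t^p once they vanish on the cycle, and exponent 2 for
    odd ones. *)
Lemma point_ofP n f : cocycle eps n f ->
  point_of eps alpha f <-> odd n \/ point_class f n./2 = 0.
Proof.
move=> fc; have [fo _] := fc; split=> [[_ [m [m0 [n' [g [[gl _] Eg]]]]]]|].
  case: (boolP (odd n)) => [|en]; [by left | right].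
  have nE : n = n./2.*2 by rewrite even_halfK.
  rewrite nE in fo.
  have := point_class_cupn m fo; rewrite /point_class -map_zeta.
  rewrite -[LHS]/((fun s => bcc (cupn f m) (map alpha s)) _) Eg cobound_zeta //.
  by move/esym/eqP; rewrite expf_eq0 => /andP[_ /eqP].
move=> fn; split; first by exists n.
case: (boolP (odd n)) fn => [on _|en [//|f0]].
  exists 2; split=> //.
  have nE : n = n./2.*2.+1 by rewrite -[LHS]odd_double_half on.
  have E : cupn f 2 = cup f f by rewrite -[RHS]/(cup f (id f)) -{3}(cupn1 fo.1).
  rewrite E; apply: (trunc_cocycle_coboundary_even (n := n) p_gt1).
    by rewrite -addnn; apply/cocycle_point/cocycle_cup.
  rewrite map_zeta; rewrite nE in fc; rewrite nE -addnn -addnS.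
  exact: point_class_odd_cup.
exists 1%N; split=> //; rewrite (cupn1 fo.1).
apply: (trunc_cocycle_coboundary_even (n := n./2) p_gt1).
  by rewrite even_halfK //; exact: cocycle_point.
by rewrite map_zeta.
Qed.

Lemma point_of_cocycle f : point_of eps alpha f -> exists n, cocycle eps n f.
Proof. by case. Qed.

(** [point_class] is multiplicative with values in a field, which gives primality; the class [f]
    keeps the ideal from containing all classes of positive degree. *)
Lemma homog_prime_point n f : cocycle eps n.+1.*2 f -> point_class f n.+1 <> 0 ->
  homog_prime eps (point_of eps alpha).
Proof.
move=> fc fn0; split; first exact: point_of_cocycle.
- move=> m g gc [n' [h [[hl _] gE]]]; apply/(point_ofP gc).
  case: (boolP (odd m)) => [|em]; [by left | right].
  rewrite /point_class gE cobound_bc // -map_zeta.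
  rewrite -(cobound_comp epsK_alpha).
  by rewrite cobound_zeta //; apply: multilinear_comp; exact: multilinear_bc.
- move=> m g h gc hc /(point_ofP gc) Pg /(point_ofP hc) Ph.
  have ghE : (fun t => g t + h t) = (fun t => 1 * g t + h t).
    by apply/funext => t; rewrite mul1r.
  have ghc : cocycle eps m (fun t => g t + h t).
    rewrite ghE; split; first by apply: cochain_comb; [case: gc | case: hc].
    by move=> t; rewrite cobound_lin gc.2 hc.2 mulr0 addr0.
  apply/(point_ofP ghc); case: Pg => [|g0]; [by left | case: Ph => [|h0]; [by left|]].
  right; rewrite ghE /point_class bc_cochain_lin rmorph1 mul1r.
  by rewrite -/(point_class g _) -/(point_class h _) g0 h0 addr0.
- move=> m g h gc Ph; have [m' hc] := point_of_cocycle Ph.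
  have {}Ph := (point_ofP hc).1 Ph.
  have ghc := cocycle_cup gc hc; have hgc := cocycle_cup hc gc.
  suff E : odd (m + m') \/ [/\ point_class (cup g h) (m + m')./2 = 0
                             & point_class (cup h g) (m' + m)./2 = 0].
    split; [apply/(point_ofP ghc) | apply/(point_ofP hgc)].
      by case: E => [|[]]; [left | right].
    by rewrite addnC in E *; case: E => [|[]]; [left | rewrite addnC; right].
  case: (boolP (odd m)) => om; case: (boolP (odd m')) => om'.
  + right; have mE : m = m./2.*2.+1 by rewrite -[LHS]odd_double_half om.
    have mE' : m' = m'./2.*2.+1 by rewrite -[LHS]odd_double_half om'.
    rewrite mE in gc *; rewrite mE' in hc *.
    rewrite !addSn !addnS -doubleD -doubleS doubleK.
    rewrite -addnS (point_class_odd_cup gc hc); split=> //.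
    rewrite -doubleD -doubleS doubleK -addnS.
    exact: point_class_odd_cup hc gc.
  + by left; rewrite oddD om (negPf om').
  + by left; rewrite oddD om' (negPf om).
  right; case: Ph => [|h0]; first by rewrite (negPf om').
  rewrite halfD (negPf om) /= add0n halfD (negPf om') /= add0n.
  have [go ho] : cochain m./2.*2 g /\ cochain m'./2.*2 h.
    by rewrite !even_halfK //; split; [case: gc | case: hc].
  by rewrite !point_class_cup // h0 mul0r mulr0.
split; last first.
  exists n.+1.*2, f; split=> // /(point_ofP fc).
  by rewrite odd_double doubleK => -[].
move=> m m' g h gc hc /(point_ofP (cocycle_cup gc hc)) Pgh.
have [om|em] := boolP (odd m); first by left; apply/(point_ofP gc); left.
have [om'|em'] := boolP (odd m'); first by right; apply/(point_ofP hc); left.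
case: Pgh; rewrite ?oddD ?(negPf em) ?(negPf em') // halfD (negPf em) /= add0n.
have [go ho] : cochain m./2.*2 g /\ cochain m'./2.*2 h.
  by rewrite !even_halfK //; split; [case: gc | case: hc].
rewrite point_class_cup // => /eqP; rewrite mulf_eq0 => /orP[/eqP g0|/eqP h0].
  by left; apply/(point_ofP gc); right.
by right; apply/(point_ofP hc); right.
Qed.

End PointClass.

Section PowerMap.
Variables (K : fieldType) (p : nat) (B : algType K).
Implicit Types (u : B) (q : truncated K p).

(** Evaluation at [u] of the representative of degree below [p]. [nil_point] is built on the same
    expression, which makes it convertible with the point of [base_point]. *)
Definition powmap u q : B := horner_alg u (q : {poly K}).

Lemma powmap_linear u : linear (powmap u).
Proof. by move=> c q r; rewrite /powmap linearP /= mulr_algl. Qed.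

HB.instance Definition _ u :=
  GRing.isLinear.Build K (truncated K p) B *:%R (powmap u) (powmap_linear u).

Hypothesis p_gt1 : (1 < p)%N.

Lemma powmap_in_qpoly u P : u ^+ p = 0 -> powmap u (in_qpoly 'X^p P) = horner_alg u P.
Proof.
move=> up; have E : in_qpoly 'X^p P = take_poly p P :> {poly K}.
  by apply/polyP => i; rewrite coef_truncp // coef_take_poly.
rewrite /powmap E -[in RHS](poly_take_drop p P) rmorphD rmorphM rmorphXn /=.
by rewrite horner_algX up mulr0 addr0.
Qed.

Lemma powmap_monoid u : u ^+ p = 0 -> monoid_morphism (powmap u).
Proof.
move=> up; split=> [|q r].
  by rewrite -(in_qpoly1 'X^p) powmap_in_qpoly // rmorph1.
by rewrite -(valK_truncp p_gt1 q) -(valK_truncp p_gt1 r) -rmorphM /=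
  !powmap_in_qpoly // rmorphM.
Qed.

Definition pow_morphism u (up : u ^+ p = 0) : {lrmorphism truncated K p -> B} :=
  HB.pack_for {lrmorphism truncated K p -> B} (powmap u)
    (GRing.isMonoidMorphism.Build (truncated K p) B (powmap u) (powmap_monoid up)).

Lemma pow_morphismE u (up : u ^+ p = 0) : pow_morphism up =1 powmap u.
Proof. by []. Qed.

Lemma powmapX u : u ^+ p = 0 -> powmap u (truncX K p) = u.
Proof. by move=> up; rewrite powmap_in_qpoly // horner_algX. Qed.

Lemma powmapE u q : powmap u q = \sum_(i < p) (q : {poly K})`_i *: u ^+ i.
Proof.
rewrite /powmap /horner_alg /horner_morph.
rewrite (horner_coef_wide _ (n := p)).
  by apply: eq_bigr => i _; rewrite coef_map mulr_algl.
by apply: leq_trans (size_poly _ _) (size_trunc _ _).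
Qed.

End PowerMap.

Section ClosedPoint.
Variables (k : fieldType) (A : falgType k) (eps : {lrmorphism A -> k^o}) (p : nat).
Hypothesis p_gt2 : (2 < p)%N.
Implicit Types (f g : seq A -> k).
Let p_gt1 : (1 < p)%N := ltnW p_gt2.

Section Closed.
Variable alpha : {lrmorphism truncated k p -> bc idfun A}.
Local Notation P := (point_of eps alpha).
Local Notation cls := (point_class alpha).

(** A homogeneous prime is only required to be closed under sums and cup products; scalars act on it
    as cochains of degree 0. *)
Lemma cup_const n c f : cochain n f -> cup (fun s => c * (nilp s)%:R) f = fun s => c * f s.
Proof.
move=> fc; apply/funext => s; rewrite /cup big_ord_recl take0 drop0 /= mulr1.
by rewrite big1 ?addr0 // => i _; case: s i => [[]|a s i] //=; rewrite mulr0 mul0r.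
Qed.

Lemma cocycle_const c : cocycle eps 0 (fun s => c * (nilp s)%:R).
Proof. by apply: cocycle_scale; exact: (cocycle_cupn 0 (cocycle_zero eps 0)). Qed.

Lemma homog_prime_scale Q n c f :
  homog_prime eps Q -> cocycle eps n f -> Q f -> Q (fun s => c * f s).
Proof.
move=> [_ _ _ Qi _] fc Qf; rewrite -(cup_const c fc.1).
by case: (Qi _ _ _ (cocycle_const c) Qf).
Qed.

Lemma homog_prime_cupn Q n m f :
  homog_prime eps Q -> cocycle eps n f -> Q (cupn f m) -> Q f.
Proof.
move=> Qp fc; have [_ _ _ Qi [Qm _]] := Qp; elim: m => [|m IH] Qf.
  have [Qf' _] := Qi _ _ _ fc Qf.
  by rewrite -(cupn1 fc.1.1).
by have [//|] := Qm _ _ _ _ fc (cocycle_cupn m fc) Qf.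
Qed.

(** Over [k] itself the quotient by the point embeds into k[T], where two nonzero homogeneous
    elements of positive degree have proportional powers; a strictly larger prime would thus contain
    every class of positive degree. *)
Lemma closed_point_rational n f :
  cocycle eps n.+1.*2 f -> cls f n.+1 <> 0 -> closed_point eps P.
Proof.
move=> fc fn0; split; first exact: homog_prime_point fc fn0.
move=> Q Qp PQ; apply/seteqP; split=> // g Qg.
have [Qc _ Qadd Qi [Qm [n' [h [n'0 hc Qh]]]]] := Qp.
have [m gc] := Qc _ Qg; apply/(point_ofP p_gt2 _ gc).
case: (boolP (odd m)) => [|em]; [by left | right].
apply: contrapT => /eqP g0; apply: (Qh).
have en' : ~~ odd n'.
  by apply/negP => on'; apply: (Qh); apply: PQ; apply/(point_ofP p_gt2 _ hc); left.
pose i := n'./2; pose j := m./2.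
have hc2 : cocycle eps i.*2 h by rewrite even_halfK.
have gc2 : cocycle eps j.*2 g by rewrite even_halfK.
have hjc := cocycle_cupn j hc2; have gic := cocycle_cupn i gc2.
rewrite -doubleMl in hjc; rewrite -doubleMl mulnC in gic.
have i0 : (0 < i)%N by rewrite /i half_gt0; move: n'0 en'; case: n' {hc i hc2 hjc gic} => [//|[|]].
(* The exponents bring both classes to degree [(i * j).*2], and the scalars make the combination
   vanish on the cycle. *)
pose w s := - (cls h i ^+ j) * cupn g i s + cls g j ^+ i * cupn h j s.
have wc : cocycle eps (i * j).*2 w by apply: cocycle_comb => //; exact: cocycle_scale.
have Qw : Q w.
  apply: PQ; apply/(point_ofP p_gt2 _ wc); right; rewrite doubleK /w.
  have E1 : cls (cupn g i) (i * j) = cls g j ^+ i.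
    by rewrite mulnC point_class_cupn //; case: gc2.
  have E2 : cls (cupn h j) (i * j) = cls h i ^+ j.
    by rewrite point_class_cupn //; case: hc2.
  rewrite /point_class in E1 E2 *.
  by rewrite bc_cochain_lin bc_cochainZ /= E1 E2; ring.
have Qgi : Q (cupn g i).
  by case: (i) i0 => // i' _; case: (Qi _ _ _ (cocycle_cupn i' gc2) Qg).
have Qhj : Q (fun s => cls g j ^+ i * cupn h j s).
  have := Qadd _ _ _ wc _ Qw (homog_prime_scale (cls h i ^+ j) Qp gic Qgi).
  move/(_ (cocycle_scale _ gic)); congr Q; apply/funext => s.
  by rewrite /w; ring.
apply: (homog_prime_cupn (m := j) Qp hc).
have := homog_prime_scale (cls g j ^- i) Qp (cocycle_scale _ hjc) Qhj.
by congr Q; apply/funext => s; rewrite mulrA mulVf ?mul1r // expf_neq0.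
Qed.

End Closed.
End ClosedPoint.

Section BaseChangeUnit.
Variables (k K : fieldType) (iota : {rmorphism k -> K}) (A : falgType k).
Local Notation inK := (@bc_in k K iota A).

Lemma bc_inM a b : inK (a * b) = inK a * inK b.
Proof. by rewrite -bc_mulE. Qed.

Lemma bc_inX a n : inK (a ^+ n) = inK a ^+ n.
Proof. by elim: n => [|n IH]; [rewrite !expr0 | rewrite !exprS bc_inM IH]. Qed.

Lemma bc_inD a b : inK (a + b) = inK a + inK b.
Proof. by have := bc_in_linear iota 1 a b; rewrite rmorph1 !scale1r. Qed.

Lemma bc_in0 : inK 0 = 0.
Proof. by apply/rowP => j; rewrite !mxE linear0 rmorph0. Qed.

Lemma bc_inZ c a : inK (c *: a) = iota c *: inK a.
Proof. by have := bc_in_linear iota c a 0; rewrite !addr0 bc_in0 addr0. Qed.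

End BaseChangeUnit.

Lemma powmap_bc_in (k : fieldType) (A : falgType k) p (x : A) (q : truncated k p) :
  (1 < p)%N ->
  powmap (bc_in idfun x) q = bc_in idfun (powmap x q : A) :> bc idfun A.
Proof.
move=> p1; rewrite !powmapE // (iota_linear_sum (@bc_in_linear _ _ idfun A)).
by apply: eq_bigr => i _; rewrite bc_inX.
Qed.

(** Freeness of A as a right module over K[x]/x^p with 1 in the basis: the input of the
    Eckmann-Shapiro argument. *)
Definition right_frame (K : fieldType) (p : nat) (A : algType K) (x : A)
    (I : finType) (i0 : I) (b : I -> A) (c : I -> A -> truncated K p) :=
  [/\ forall i, linear (c i), forall a, a = \sum_i b i * powmap x (c i a),
      forall i j q, c i (b j * powmap x q) = if i == j then q else 0
    & b i0 = 1].

Section PointInclusion.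
Variables (k : fieldType) (A : falgType k) (eps : {lrmorphism A -> k^o}) (p : nat).
Hypothesis p_gt2 : (2 < p)%N.
Let p_gt1 : (1 < p)%N := ltnW p_gt2.
Variables (x : A) (xp : x ^+ p = 0).
Variables (I : finType) (i0 : I) (b : I -> A) (c : I -> A -> truncated k p).
Hypothesis frame : right_frame x i0 b c.
Local Notation pw := (pow_morphism p_gt1 xp).

Lemma bc_in_pth : bc_in idfun x ^+ p = 0 :> bc idfun A.
Proof. by rewrite -bc_inX xp bc_in0. Qed.

Definition base_point : {lrmorphism truncated k p -> bc idfun A} :=
  pow_morphism p_gt1 bc_in_pth.

Lemma eps_pow q : eps (pw q) = trunc_eps q.
Proof.
have := epsK_alpha eps p_gt2 base_point q.
by rewrite [base_point q](powmap_bc_in x q p_gt1) epsK_in.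
Qed.

Lemma bc_cochain_rcons (K : fieldType) (iota : {rmorphism k -> K}) f
    (t : seq (bc iota A)) a :
  multilinear f -> (forall s d, f (rcons s (d * x)) = 0) ->
  bc_cochain f (rcons t (a * bc_in iota x)) = 0.
Proof.
elim: t f => [|u t IH] f fl f0 /=.
  rewrite (bc_sum a) mulr_suml linear_sum big1 // => i _.
  rewrite -scalerAl linearZ /= -bc_inM bc_liftK; last exact: (bc_cochain_cons fl [::]).
  by rewrite (f0 [::]) rmorph0 scaler0.
rewrite /bc_lift big1 // => i _; rewrite IH ?scaler0 //.
  exact: multilinear_cons.
by move=> s d; rewrite -rcons_cons f0.
Qed.

Lemma frame_mul i a q : c i (a * pw q) = c i a * q.
Proof.
have [cl bE cb _] := frame.
pose ci := HB.pack_for {linear A -> truncated k p} (c i)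
  (GRing.isLinear.Build k A (truncated k p) *:%R (c i) (cl i)).
rewrite -[c i]/(ci : _ -> _) {1}(bE a) mulr_suml linear_sum.
rewrite (bigD1 i) //= big1 => [|j ji].
  by rewrite -mulrA -[powmap x _]/(pw _) -rmorphM /= cb eqxx addr0.
by rewrite -mulrA -[powmap x _]/(pw _) -rmorphM /= cb eq_sym (negPf ji).
Qed.

Definition pow_range (a : A) := exists q, a = pw q.

Lemma cocycle_shapiro n f : cocycle eps n.+1 f ->
  (exists2 g, cochain n g &
    forall s, f (map pw s) = cobound (@trunc_eps k p) g s) ->
  exists2 g, cochain n g & forall t d, f (rcons t (d * x)) = cobound eps g (rcons t (d * x)).
Proof.
move=> fc [g [gl g0] fg]; have [cl bE cb b1] := frame.
(* The coordinate along 1 projects A onto k[x]. Through it a primitive of [f] on k[x] becomes a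
   cochain on A, and after subtracting its coboundary the cocycle vanishes on k[x]. *)
pose gt s := g (map (c i0) s).
have gtc : cochain n gt.
  split; last by move=> s sn; rewrite /gt g0 // size_map.
  by move=> s1 s2 e a d; rewrite /gt !map_cat /= cl gl.
have dgt : cocycle eps n.+1 (cobound eps gt).
  split; first by apply: cochain_cobound => // e a d; rewrite linearP.
  by apply: cobound_cobound => a d; exact: rmorphM.
have gtE s : cobound eps gt (map pw s) = cobound (@trunc_eps k p) g s.
  rewrite -(cobound_comp eps_pow); apply: eq_cobound => t _.
  rewrite /gt -map_comp; congr g; rewrite -[RHS]map_id; apply: eq_map => q /=.
  by rewrite -[powmap x q]mul1r -b1 cb eqxx.
have f1c : cocycle eps n.+1 (fun t => f t - cobound eps gt t) by exact: cocycle_sub.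
have [||||||||||h hc hE] := shapiro (R := pow_range) (i0 := i0) (b := b)
    (r := fun i a => pw (c i a)) _ _ _ _ _ _ _ _ _ f1c.
- by move=> e a d; rewrite linearP.
- by move=> a d; rewrite rmorphM.
- by move=> i e a d; rewrite cl linearP.
- exact: bE.
- by move=> i a; exists (c i a).
- by move=> i a _ [q ->]; rewrite frame_mul rmorphM.
- exact: b1.
- move=> i _ [q ->]; rewrite -{1}[pw q]mul1r -b1 cb.
  by case: eqP; rewrite ?rmorph0.
- by exists 1; rewrite rmorph1.
- move=> [|//] s _ sR; rewrite cat0s.
  have [l ->] : exists l, s = map pw l.
    elim: s sR => [|a s IH]; first by exists [::].
    by move=> [[q ->] /IH[l ->]]; exists (q :: l).
  by rewrite fg gtE subrr.
exists (fun t => 1 * gt t + h t); first exact: cochain_comb.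
move=> t d; have := hE t d x; rewrite cobound_lin mul1r => <-.
- by rewrite addrCA subrr addr0.
- by exists (truncX k p); rewrite pow_morphismE powmapX.
have := eps_pow (truncX k p); rewrite pow_morphismE powmapX // => ->.
exact: trunc_epsX.
Qed.

(** The cycle of [alpha] ends in the power that the hypothesis places in the left ideal generated by
    [x], where the adjusted cocycle vanishes. *)
Theorem point_inclusion (K : fieldType) (iota : {rmorphism k -> K})
    (alpha : {lrmorphism truncated K p -> bc iota A}) (a : bc iota A) :
  alpha (truncX K p) ^+ p.-1 = a * bc_in iota x ->
  (point_of eps base_point `<=` point_of eps alpha)%classic.
Proof.
move=> ua f Pf; have [n fc] := point_of_cocycle Pf.
have fx := (point_ofP p_gt2 base_point fc).1 Pf.
apply/(point_ofP p_gt2 _ fc).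
have [on|en] := boolP (odd n); [by left | right].
case: fx => [|fx]; first by rewrite (negPf en).
have nE : n = n./2.*2 by rewrite even_halfK.
have [fo _] := fc; have fl := fo.1.
have fz : f (zeta p x n./2) = 0.
  move: fx; rewrite /point_class [base_point _]powmapX ?bc_in_pth //.
  have -> : zeta p (bc_in idfun x : bc idfun A) n./2 = map (@bc_in _ _ idfun A) (zeta p x n./2).
    by elim: n./2 => //= m ->; rewrite bc_inX.
  by rewrite bc_cochain_in.
move: (n./2) nE fz => j nE fz; rewrite nE in fc fo; clear fx en nE.
(* In degree 0 the cycle is empty, and both evaluations come from the value of [f] on the empty
   list. *)
case: j fc fo fz => [|j] fc fo fz; first by rewrite /point_class /= fz rmorph0.
have Fc := cocycle_comp eps_pow fc.
have [|g0 [gl gs gE]] := trunc_cocycle_coboundary p_gt1 Fc.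
  by apply: etrans fz; rewrite map_zeta [pow_morphism _ _ _]powmapX.
have [|g gc fg] := cocycle_shapiro (n := j.*2.+1) fc.
  exists g0; last by move=> s; rewrite -gE.
  by split=> // t tj; apply: gs; rewrite doubleS eqSS.
have gcl : multilinear (cobound eps g).
  by apply: multilinear_cobound; [move=> e d h; rewrite linearP | case: gc].
rewrite /point_class.
have -> : f = fun t => 1 * (f t - cobound eps g t) + cobound eps g t.
  by apply/funext => t; rewrite mul1r subrK.
rewrite bc_cochain_lin rmorph1 mul1r cobound_bc; last by case: gc.
rewrite -[X in _ + cobound _ _ X]map_zeta -(cobound_comp (epsK_alpha eps p_gt2 alpha)).
rewrite cobound_zeta //; last first.
  by apply: multilinear_comp; apply: multilinear_bc; case: gc.
rewrite addr0 -addn1 zeta_cat /= -cat_rcons cats1 ua bc_cochain_rcons //.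
  exact: multilinear_sub.
by move=> s d; rewrite fg subrr.
Qed.

End PointInclusion.

(** * Heisenberg triples and their ordered monomials *)

Lemma spanning_frame (F : fieldType) (V : vectType F) (T : finType) (m : T -> V) :
  (forall v, exists c, v = \sum_t c t *: m t) -> #|T| = \dim {:V} ->
  exists2 co : T -> {scalar V},
    forall v, v = \sum_t co t v *: m t
  & forall t t', co t (m t') = (t == t')%:R.
Proof.
move=> span cardT; pose e := [tuple m (enum_val i) | i < #|T|].
have eE (i : 'I_#|T|) : e`_i = m (enum_val i) by rewrite -tnth_nth tnth_mktuple.
have e_full : <<e>>%VS = fullv.
  apply/eqP; rewrite eqEsubv subvf; apply/subvP => v _.
  have [c ->] := span v; apply: memv_suml => t _; apply: memvZ.
  rewrite memv_span //; apply/(nthP 0); exists (enum_rank t).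
    by rewrite size_tuple.
  by rewrite eE enum_rankK.
have e_basis : basis_of fullv e by rewrite basisEdim e_full subvv size_tuple cardT leqnn.
exists (fun t => coord e (enum_rank t) : {scalar V}) => [v|t t'].
   rewrite {1}(coord_basis e_basis (memvf v)).
  rewrite (reindex (fun i : 'I_#|T| => enum_val i)) /=; last first.
    by exists enum_rank => i _; rewrite ?enum_valK ?enum_rankK.
  by apply: eq_bigr => i _; rewrite enum_valK eE.
rewrite /= -{1}(enum_rankK t') -eE (coord_free _ _ (basis_free e_basis)).
by rewrite (inj_eq enum_rank_inj) eq_sym.
Qed.

(** The scalar [c] makes the notion stable under exchanging [X] and [Y] and under changes of basis
    that keep [Z]. *)
Definition heis_triple (F : fieldType) (A : algType F) (p : nat) (c : F) (X Y Z : A) :=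
  [/\ X * Y = Y * X + c *: Z, Z * X = X * Z, Z * Y = Y * Z
    & [/\ X ^+ p = 0, Y ^+ p = 0 & Z ^+ p = 0]].

Definition pbw (F : fieldType) (A : algType F) (X Y Z : A) (t : nat * nat * nat) :=
  X ^+ t.1.1 * Y ^+ t.1.2 * Z ^+ t.2.

Section HeisenbergTriple.
Variables (F : fieldType) (A : falgType F) (p : nat).
Implicit Types (X Y Z : A) (c : F).

(** Generation is phrased through left multiplication because the span of the ordered monomials is
    directly seen to be stable under it. *)
Definition left_generates X Y Z :=
  forall W : {vspace A}, 1 \in W ->
    (forall w, w \in W -> [/\ X * w \in W, Y * w \in W & Z * w \in W]) ->
  forall a, a \in W.

Definition ords (t : 'I_p * 'I_p * 'I_p) : nat * nat * nat := (t.1.1 : nat, t.1.2 : nat, t.2 : nat).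

Lemma heis_tripleC c X Y Z : heis_triple p c X Y Z -> heis_triple p (- c) Y X Z.
Proof.
by move=> [XY ZX ZY [Xp Yp Zp]]; split=> //; rewrite XY scaleNr addrK.
Qed.

Lemma left_generatesC X Y Z : left_generates X Y Z -> left_generates Y X Z.
Proof.
by move=> g W W1 WP; apply: g => // w /WP[].
Qed.

Section PBW.
Variables (c : F) (X Y Z : A).
Hypothesis heis : heis_triple p c X Y Z.

Lemma heis_commZXn n m : Z ^+ n * X ^+ m = X ^+ m * Z ^+ n.
Proof. by apply/commrX/commr_sym/commrX; case: heis => _ ZX _ _; exact: esym. Qed.

Lemma heis_commZYn n m : Z ^+ n * Y ^+ m = Y ^+ m * Z ^+ n.
Proof. by apply/commrX/commr_sym/commrX; case: heis => _ _ ZY _; exact: esym. Qed.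

Lemma heis_YXn n : Y * X ^+ n = X ^+ n * Y - (n%:R * c) *: (X ^+ n.-1 * Z).
Proof.
case: heis => XY ZX _ _; elim: n => [|n IH].
  by rewrite mulr1 mul1r mul0r scale0r subr0.
have YX : Y * X = X * Y - c *: Z by rewrite XY addrK.
rewrite exprS mulrA YX mulrBl -scalerAl -(mulrA X Y) IH mulrBr -scalerAr.
rewrite mulrA -addrA -opprD; congr (_ - _).
have -> : Z * X ^+ n = X ^+ n * Z by have := heis_commZXn 1 n; rewrite expr1.
case: n {IH} => [|n]; first by rewrite mul0r scale0r add0r /= !mul1r.
by rewrite /= mulrA -exprS -scalerDl -[n.+2%:R]natr1 mulrDl mul1r.
Qed.

Lemma pbw_big t : (p <= t.1.1)%N || (p <= t.1.2)%N || (p <= t.2)%N -> pbw X Y Z t = 0.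
Proof.
case: heis => _ _ _ [Xp Yp Zp]; case: t => [[i j] l] /=; rewrite /pbw /=.
have big (a : A) n : a ^+ p = 0 -> (p <= n)%N -> a ^+ n = 0.
  by move=> ap pn; rewrite -(subnKC pn) exprD ap mul0r.
by case/orP => [/orP[]|] pn; rewrite ?(big _ _ Xp pn) ?(big _ _ Yp pn) ?(big _ _ Zp pn)
  ?mul0r ?mulr0 ?mul0r.
Qed.

Lemma mulX_pbw i j l : X * pbw X Y Z (i, j, l) = pbw X Y Z (i.+1, j, l).
Proof. by rewrite /pbw !mulrA -exprS. Qed.

Lemma mulZ_pbw i j l : Z * pbw X Y Z (i, j, l) = pbw X Y Z (i, j, l.+1).
Proof.
rewrite /pbw /= !mulrA; have := heis_commZXn 1 i; rewrite expr1 => ->.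
rewrite -!mulrA; congr (_ * _); rewrite mulrA.
by have := heis_commZYn 1 j; rewrite expr1 => ->; rewrite -mulrA -exprS.
Qed.

Lemma mulY_pbw i j l : Y * pbw X Y Z (i, j, l) =
  pbw X Y Z (i, j.+1, l) - (i%:R * c) *: pbw X Y Z (i.-1, j, l.+1).
Proof.
rewrite /pbw /= !mulrA heis_YXn !mulrBl -!scalerAl exprS !mulrA; congr (_ - _ *: _).
rewrite exprS -!mulrA; congr (_ * _); rewrite !mulrA.
by have := heis_commZYn 1 j; rewrite expr1 => ->.
Qed.

Hypothesis gen : left_generates X Y Z.

Lemma pbw_span a : exists co, a = \sum_t co t *: pbw X Y Z (ords t).
Proof.
pose W := <<[seq pbw X Y Z (ords t) | t <- enum (predT : pred ('I_p * 'I_p * 'I_p))]>>%VS.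
have inW t : pbw X Y Z t \in W.
  case: t => [[i j] l].
  have [ip|ip] := ltnP i p; last by rewrite pbw_big ?mem0v //= ip.
  have [jp|jp] := ltnP j p; last by rewrite pbw_big ?mem0v //= jp orbT.
  have [lp|lp] := ltnP l p; last by rewrite pbw_big ?mem0v //= lp !orbT.
  apply: memv_span; apply/mapP.
  by exists (Ordinal ip, Ordinal jp, Ordinal lp); rewrite ?mem_enum.
have WE w : w \in W -> exists co, w = \sum_t co t *: pbw X Y Z (ords t).
  rewrite /W; elim: (enum _) w => [|t s IH] w.
    by rewrite span_nil memv0 => /eqP ->; exists (fun=> 0); rewrite big1 // => t _; rewrite scale0r.
  rewrite /= span_cons => /memv_addP[v /vlineP[d ->] [w' /IH[co ->] ->]].
  exists (fun t' => (if t' == t then d else 0) + co t').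
  under [RHS]eq_bigr do rewrite scalerDl.
  rewrite big_split /= [X in _ = X + _](bigD1 t) //= eqxx.
  rewrite [X in _ = _ + X + _]big1 ?addr0 // => t' /negPf ->.
  by rewrite scale0r.
apply: (WE); apply: gen.
  by have := inW (0, 0, 0)%N; rewrite /pbw !expr0 !mulr1.
move=> w /WE[co ->]; rewrite !mulr_sumr; split; apply: memv_suml => t _;
  rewrite -scalerAr memvZ //; case: t => [[i j] l]; rewrite /ords /=.
- by rewrite mulX_pbw.
- by rewrite mulY_pbw memvB ?memvZ.
by rewrite mulZ_pbw.
Qed.

Hypothesis dimA : \dim {:A} = (p ^ 3)%N.

Lemma pbw_frame : exists2 co : 'I_p * 'I_p * 'I_p -> {scalar A},
    forall v, v = \sum_t co t v *: pbw X Y Z (ords t)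
  & forall t t', co t (pbw X Y Z (ords t')) = (t == t')%:R.
Proof.
apply: spanning_frame; first exact: pbw_span.
by rewrite !card_prod !card_ord dimA !expnS muln1 mulnA.
Qed.

End PBW.
End HeisenbergTriple.

(** * Powers of linear combinations in a Heisenberg triple *)

Section HeisenbergPower.
Variables (F : fieldType) (B : algType F) (p : nat).
Hypothesis charp : p \in [pchar F].
Hypothesis p_gt2 : (2 < p)%N.
Implicit Types (X Y Z : B) (c : F).

Lemma algebra_mulrn_dvd (V : lmodType F) (v : V) n : (p %| n)%N -> v *+ n = 0.
Proof.
case/dvdnP => m ->.
by rewrite -scaler_nat natrM (pcharf0 charp) mulr0 scale0r.
Qed.

(* The derivative of (X + tY)^p in t vanishes, because [X + tY, [X + tY, Y]] = 0
   and p divides both p and 'C(p, 2). *)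
Section Pencil.
Variables (X Y Z : B).
Hypothesis XY : X * Y = Y * X + Z.
Hypothesis ZX : Z * X = X * Z.
Hypothesis ZY : Z * Y = Y * Z.

Let W : {poly B} := X%:P + Y%:P * 'X.
Let Z' : {poly B} := Z%:P.

Let WY : W * Y%:P = Y%:P * W + Z'.
Proof.
rewrite /W /Z' mulrDr mulrDl -polyCM XY polyCD -(mulrA _ 'X) commr_polyX.
by rewrite polyCM addrAC.
Qed.

Let Z'W n : W ^+ n * Z' = Z' * W ^+ n.
Proof.
apply/esym/commrX; rewrite /GRing.comm /W /Z' mulrDr mulrDl.
have -> : Z%:P * (Y%:P * 'X) = Y%:P * 'X * Z%:P.
  by rewrite -(mulrA _ 'X) -commr_polyX !mulrA -(polyCM Z) ZY polyCM.
by rewrite -(polyCM Z) ZX polyCM.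
Qed.

Let WYn n : W ^+ n.+1 * Y%:P = Y%:P * W ^+ n.+1 + (W ^+ n * Z') *+ n.+1.
Proof.
elim: n => [|n IH]; first by rewrite !expr1 expr0 mul1r.
rewrite exprS -mulrA IH mulrDr mulrA WY mulrDl -mulrA -exprS -addrA mulrnAr.
congr (_ + _).
by rewrite mulrA -exprS -Z'W [in RHS]mulrS.
Qed.

Let dW n : (W ^+ n.+1)^`() =
  (Y%:P * W ^+ n) *+ n.+1 + (W ^+ n.-1 * Z') *+ 'C(n.+1, 2).
Proof.
have dW1 : W^`() = Y%:P.
  by rewrite derivD derivM derivC derivX derivC mul0r mulr1 !add0r.
elim: n => [|n IH]; first by rewrite expr1 dW1 mulr1 addr0.
have binE : 'C(n.+2, 2) = ('C(n.+1, 2) + n.+1)%N by rewrite binS bin1.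
have E : (W ^+ n.-1 * Z' * W) *+ 'C(n.+1, 2) = (W ^+ n * Z') *+ 'C(n.+1, 2).
  case: n {IH binE} => [|n]; first by rewrite !mulr0n.
  by rewrite /= -mulrA -[Z' * W](Z'W 1) expr1 mulrA -exprSr.
rewrite binE exprSr derivM dW1 IH WYn mulrDl !mulrnAl -(mulrA Y%:P) -exprSr E.
by move: 'C(n.+1, 2) => b; rewrite mulrnDr addrACA -mulrSr.
Qed.

Let coefW n : (forall i, (n < i)%N -> (W ^+ n)`_i = 0) /\ (W ^+ n)`_n = Y ^+ n.
Proof.
elim: n => [|n [IH0 IH]].
  by split=> [[|i] // _|]; rewrite coef1.
have E i : (W ^+ n.+1)`_i = (W ^+ n)`_i * X +
    (if i == 0%N then 0 else (W ^+ n)`_i.-1 * Y).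
  by rewrite exprSr mulrDr coefD coefMC mulrA coefMX; case: eqP; rewrite // coefMC.
split=> [i ni|]; rewrite E.
  rewrite IH0 ?(ltnW ni) // mul0r add0r; case: i ni => //= i ni.
  by rewrite IH0 // mul0r.
by rewrite IH0 // mul0r add0r /= IH exprSr.
Qed.

Lemma pencil_pth : (X + Y) ^+ p = X ^+ p + Y ^+ p.
Proof.
have p0 : (0 < p)%N by exact: (ltn_trans _ p_gt2).
have pp : prime p := pcharf_prime charp.
have dWp : (W ^+ p)^`() = 0.
  have BP : forall (P : {poly B}) n, (p %| n)%N -> P *+ n = 0.
    move=> P n pn; apply/polyP => i; rewrite coefMn coef0.
    exact: (algebra_mulrn_dvd (V := B)).
  have := dW p.-1; rewrite prednK // !BP ?addr0 ?dvdnn //.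
  by rewrite prime_dvd_bin.
have W0 n : (W ^+ n)`_0 = X ^+ n.
  elim: n => [|n IH]; first by rewrite coef1.
  by rewrite !exprSr coef0M IH coefD coefC coefMX /= addr0.
have Wi i : (0 < i < p)%N -> (W ^+ p)`_i = 0.
  case: i => // i /andP[_ ip].
  have := congr1 (fun P : {poly B} => P`_i) dWp; rewrite coef_deriv coef0.
  rewrite -scaler_nat => /eqP; rewrite scaler_eq0 => /orP[|/eqP //].
  by rewrite -(dvdn_pcharf charp) gtnNdvd.
have WE : W ^+ p = (X ^+ p)%:P + (Y ^+ p)%:P * 'X^p.
  apply/polyP => i; rewrite coefD coefC coefCM coefXn.
  case: (ltngtP i p) => [ip|pi|->].
  - rewrite mulr0 addr0; case: i ip => [|i] ip; first by rewrite W0.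
    by rewrite Wi.
  - by rewrite (coefW p).1 //; case: i pi => //= i _; rewrite mulr0 addr0.
  by rewrite (coefW p).2 mulr1 gtn_eqF // add0r.
have c1 (P : {poly B}) : comm_poly P 1 by rewrite /comm_poly mulr1 mul1r.
have := congr1 (horner^~ 1) WE; rewrite horner_exp_comm; last exact: c1.
have e1 (P : B) n : (P%:P * 'X^n).[1] = P.
  by rewrite hornerM_comm ?hornerC ?hornerXn ?expr1n ?mulr1 //; exact: c1.
have W1 : W.[1] = X + Y by rewrite hornerD hornerMX !hornerC mulr1.
by rewrite W1 hornerD hornerC e1.
Qed.
End Pencil.

Lemma heis_pth (c : F) X Y Z a b d : heis_triple p c X Y Z ->
  (a *: X + b *: Y + d *: Z) ^+ p = 0.
Proof.
case=> XY ZX ZY [Xp Yp Zp].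
have eqZ (e : F) (T : B) : T ^+ p = 0 -> (e *: T) ^+ p = 0.
  by move=> Tp; rewrite exprZn Tp scaler0.
have WE : (a *: X + b *: Y) ^+ p = 0.
  rewrite (@pencil_pth _ _ ((a * b * c) *: Z)) ?eqZ ?addr0 //.
  - rewrite -!scalerAl -!scalerAr !scalerA XY scalerDr scalerA [b * a]mulrC.
    by [].
  - by rewrite -!scalerAl -!scalerAr ZX !scalerA [in RHS]mulrC.
  by rewrite -!scalerAl -!scalerAr ZY !scalerA [in RHS]mulrC.
rewrite (@pencil_pth _ _ 0) ?eqZ ?WE ?addr0 // ?mul0r ?mulr0 //.
by rewrite mulrDl mulrDr -!scalerAl -!scalerAr ZX ZY !scalerA ![_ * d]mulrC.
Qed.
End HeisenbergPower.

(** * The restricted enveloping algebra of the Heisenberg algebra *)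

Section HeisenbergAlgebra.
Variables (k : fieldType) (p : nat).
Hypothesis charp : p \in [pchar k].
Hypothesis p_gt2 : (2 < p)%N.
Variables (g : restricted_lie k p) (x y z : g).
Hypothesis xyz : basis_of fullv [:: x; y; z].
Hypotheses (brxy : lbr x y = z) (brzx : lbr z x = 0) (brzy : lbr z y = 0).
Hypotheses (px : ppow x = 0) (py : ppow y = 0) (pz : ppow z = 0).

Let e := in_tuple [:: x; y; z].
Let i0 : 'I_(size [:: x; y; z]) := @Ordinal 3 0 isT.
Let i1 : 'I_(size [:: x; y; z]) := @Ordinal 3 1 isT.
Let i2 : 'I_(size [:: x; y; z]) := @Ordinal 3 2 isT.
Definition heis_x (u : g) := coord e i0 u.
Definition heis_y (u : g) := coord e i1 u.
Definition heis_z (u : g) := coord e i2 u.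

Lemma heis_coordE u : u = heis_x u *: x + heis_y u *: y + heis_z u *: z.
Proof.
rewrite {1}(coord_basis (X := e) xyz (memvf u)).
rewrite (bigD1 i0) // (bigD1 i1) // (bigD1 i2) // big1 => [|i].
  by rewrite /= addr0 addrA.
by case: i => [[|[|[|m]]] lt_m].
Qed.

Let free_e : free e. Proof. exact: basis_free xyz. Qed.

Let coord_e (i j : 'I_(size [:: x; y; z])) : coord e i e`_j = (i == j)%:R.
Proof. by rewrite coord_free // eq_sym. Qed.

Lemma heis_coords a b c (u := a *: x + b *: y + c *: z) :
  [/\ heis_x u = a, heis_y u = b & heis_z u = c].
Proof.
have cu i : coord e i u = a * (i == i0)%:R + b * (i == i1)%:R + c * (i == i2)%:R.
  have c0 : coord e i x = (i == i0)%:R := coord_e i i0.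
  have c1 : coord e i y = (i == i1)%:R := coord_e i i1.
  have c2 : coord e i z = (i == i2)%:R := coord_e i i2.
  by rewrite /u !linearD !linearZ /= c0 c1 c2.
by split; rewrite /heis_x /heis_y /heis_z cu /= ?mulr1 ?mulr0 ?addr0 ?add0r.
Qed.

Lemma lbrC (u v : g) : lbr u v = - lbr v u.
Proof.
have := lbrxx (u + v).
have E (w1 w2 w3 : g) : lbr (w1 + w2) w3 = lbr w1 w3 + lbr w2 w3.
  by have := lbr_linearl w3 1 w1 w2; rewrite !scale1r.
have E' (w1 w2 w3 : g) : lbr w3 (w1 + w2) = lbr w3 w1 + lbr w3 w2.
  by have := lbr_linearr w3 1 w1 w2; rewrite !scale1r.
by rewrite E !E' !lbrxx add0r addr0 => /eqP; rewrite addr_eq0 => /eqP.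
Qed.

Lemma lbrDl (a b c : k) (u v w t : g) :
  lbr (a *: u + b *: v + c *: w) t = a *: lbr u t + b *: lbr v t + c *: lbr w t.
Proof.
have := lbr_linearl t a u (b *: v + c *: w); rewrite addrA => ->.
have := lbr_linearl t b v (c *: w) => ->.
have := lbr_linearl t c w 0; rewrite addr0 => ->.
have := lbr_linearl t (-1) 0 0; rewrite scaler0 addr0 scaleN1r addNr => ->.
by rewrite addr0 addrA.
Qed.

Lemma lbrDr (a b c : k) (u v w t : g) :
  lbr t (a *: u + b *: v + c *: w) = a *: lbr t u + b *: lbr t v + c *: lbr t w.
Proof. by rewrite lbrC lbrDl !opprD -!scalerN -!(lbrC t). Qed.

Lemma lbrE u v : lbr u v = (heis_x u * heis_y v - heis_y u * heis_x v) *: z.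
Proof.
rewrite {1}(heis_coordE u) {1}(heis_coordE v) lbrDl !lbrDr.
rewrite !lbrxx brxy brzx brzy (lbrC y x) brxy (lbrC x z) brzx (lbrC y z) brzy.
rewrite oppr0 !scaler0 !addr0 !add0r scalerN !scalerA scalerBl.
by rewrite scaler0 addr0 scalerN scalerA.
Qed.

Lemma lbr_lbr (u v w : g) : lbr u (lbr v w) = 0.
Proof.
rewrite (lbrE v w); have [z0 z1 _] := heis_coords 0 0 (heis_x v * heis_y w - heis_y v * heis_x w).
rewrite !scale0r !add0r in z0 z1.
by rewrite lbrE z0 z1 !mulr0 subr0 scale0r.
Qed.

(** Jacobson's correction terms are nested brackets of depth p - 1, which is at least 2, in a Lie
    algebra of nilpotency class 2. *)
Lemma ppow_add (u v : g) : ppow (u + v) = ppow u + ppow v.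
Proof.
rewrite ppowD big1 ?addr0 // => w _.
have : size w = p.-1 by exact: size_tuple.
case: (w : seq bool) => [|b1 [|b2 s]] /= sz; last by rewrite lbr_lbr scaler0.
  by move: p_gt2 sz; lia.
by move: p_gt2 sz; lia.
Qed.

Lemma ppow_eq0 (u : g) : ppow u = 0.
Proof. by rewrite (heis_coordE u) !ppow_add !ppowZ px py pz !scaler0 !addr0. Qed.

Lemma commutator_comb (B : algType k) (a b c : k) (u v w t : B)
    (C := fun s r : B => s * r - r * s) :
  C (a *: u + b *: v + c *: w) t = a *: C u t + b *: C v t + c *: C w t.
Proof.
rewrite /C !mulrDl !mulrDr -!scalerAl -!scalerAr !scalerBr !opprD.
by rewrite addrACA (addrACA (a *: _)).
Qed.

Lemma triple_commutator (B : algType k) (X Y Z : B) a b c a' b' c' :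
  heis_triple p 1 X Y Z ->
  (a *: X + b *: Y + c *: Z) * (a' *: X + b' *: Y + c' *: Z) -
  (a' *: X + b' *: Y + c' *: Z) * (a *: X + b *: Y + c *: Z) =
  (a * b' - b * a') *: Z.
Proof.
case=> XY ZX ZY _; rewrite commutator_comb.
have D (t : B) : t * (a' *: X + b' *: Y + c' *: Z) - (a' *: X + b' *: Y + c' *: Z) * t =
    - (a' *: (X * t - t * X) + b' *: (Y * t - t * Y) + c' *: (Z * t - t * Z)).
  by rewrite -commutator_comb opprB.
have cXY : X * Y - Y * X = Z by rewrite XY addrC addKr scale1r.
have cYX : Y * X - X * Y = - Z by rewrite -cXY opprB.
rewrite !D cXY cYX ZX ZY !subrr !scaler0 !addr0 !add0r oppr0 scaler0 addr0.
by rewrite !scalerN opprK !scalerA scalerBl.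
Qed.

Lemma triple_restricted (B : algType k) (X Y Z : B) : heis_triple p 1 X Y Z ->
  restricted_morphism (fun u : g => heis_x u *: X + heis_y u *: Y + heis_z u *: Z).
Proof.
move=> T; have [XY ZX ZY _] := T; split=> [d u v|u v|u].
- rewrite /heis_x /heis_y /heis_z !linearP /= !scalerDl !scalerDr !scalerA.
  by rewrite (addrACA (_ *: X)) (addrACA (_ + _ : B)).
- rewrite (triple_commutator _ _ _ _ _ _ T) lbrE.
  have [z0 z1 z2] := heis_coords 0 0 (heis_x u * heis_y v - heis_y u * heis_x v).
  by rewrite !scale0r !add0r in z0 z1 z2; rewrite z0 z1 z2 !scale0r !add0r.
rewrite ppow_eq0 (heis_pth charp p_gt2 _ _ _ T).
by rewrite /heis_x /heis_y /heis_z !linear0 !scale0r !addr0.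
Qed.

Variables (A : falgType k) (inj : g -> A).
Hypothesis envA : is_envelope inj.

Lemma inj_coordE u :
  inj u = heis_x u *: inj x + heis_y u *: inj y + heis_z u *: inj z.
Proof.
have [[il _ _] _] := envA; rewrite {1}(heis_coordE u).
have inj0 : inj 0 = 0.
  by have := il (-1) 0 0; rewrite scaler0 addr0 scaleN1r addNr.
by rewrite -addrA il il -[heis_z u *: z]addr0 il inj0 addr0 addrA.
Qed.

Lemma inj_triple : heis_triple p 1 (inj x) (inj y) (inj z).
Proof.
have [[il ibr ipp] _] := envA.
have inj0 : inj 0 = 0.
  by have := il (-1) 0 0; rewrite scaler0 addr0 scaleN1r addNr.
split.
- by have := ibr x y; rewrite brxy scale1r => ->; rewrite addrC subrK.
- by have := ibr z x; rewrite brzx inj0 => /esym/eqP; rewrite subr_eq0 => /eqP.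
- by have := ibr z y; rewrite brzy inj0 => /esym/eqP; rewrite subr_eq0 => /eqP.
by split; rewrite -ipp ?px ?py ?pz inj0.
Qed.

Lemma envelope_map (B : algType k) (X Y Z : B) : heis_triple p 1 X Y Z ->
  exists F : {lrmorphism A -> B}, [/\ F (inj x) = X, F (inj y) = Y & F (inj z) = Z].
Proof.
move=> T; have [_ /(_ B _ (triple_restricted T))[[F FE] _]] := envA.
exists F; rewrite !FE; have [ax bx cx] := heis_coords 1 0 0.
have [ay bY cy] := heis_coords 0 1 0; have [az bz cz] := heis_coords 0 0 1.
rewrite !scale0r !scale1r !addr0 ?add0r in ax bx cx ay bY cy az bz cz.
by rewrite ax bx cx ay bY cy az bz cz !scale0r !scale1r !addr0 !add0r.
Qed.

Lemma envelope_unique (B : algType k) (F G : {lrmorphism A -> B}) :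
  F (inj x) = G (inj x) -> F (inj y) = G (inj y) -> F (inj z) = G (inj z) -> F =1 G.
Proof.
move=> Fx Fy Fz; have [[il ibr ipp] env] := envA.
have Fr : restricted_morphism (fun u => F (inj u)).
  split=> [c u v|u v|u]; first by rewrite il linearP.
    by rewrite ibr rmorphB !rmorphM.
  by rewrite ipp rmorphXn.
apply: (env _ _ Fr).2 => // u.
by rewrite (inj_coordE u) !linearD !linearZ /= Fx Fy Fz.
Qed.

(** The universal property maps A into the subalgebra generated by the triple; by uniqueness the
    composite with the inclusion is the identity of A. *)
Lemma inj_generates : left_generates (inj x) (inj y) (inj z).
Proof.
move=> W W1 WP a.
pose V := (<[inj x]> + <[inj y]> + <[inj z]>)%VS.
have inV : [/\ inj x \in V, inj y \in V & inj z \in V].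
  split; [apply: subvP (memv_line _) | apply: subvP (memv_line _) | apply: subvP (memv_line _)].
  - by rewrite /V -addvA addvSl.
  - by rewrite /V (addvC <[inj x]>%VS) -addvA addvSl.
  by rewrite /V addvSr.
pose U := agenv_aspace V.
have inU (v : A) : v \in V -> v \in U by apply/subvP/sub_agenv.
have [Vx Vy Vz] := inV.
have [XY ZX ZY [Xp Yp Zp]] := inj_triple.
pose X : subvs_of U := Subvs (inU _ Vx).
pose Y : subvs_of U := Subvs (inU _ Vy).
pose Z : subvs_of U := Subvs (inU _ Vz).
have U1 : 1 \in U by rewrite memvE; exact: sub1_agenv.
have val1 : vsval (1 : subvs_of U) = 1 by apply/eqP; rewrite algid_eq1.
pose val_lr := HB.pack_for {lrmorphism subvs_of U -> A} (@vsval _ _ U)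
  (GRing.isMonoidMorphism.Build (subvs_of U) A (@vsval _ _ U)
     (conj val1 (fun v w => erefl))).
have T : heis_triple p 1 X Y Z.
  have vX n (v : subvs_of U) : vsval (v ^+ n) = vsval v ^+ n.
    exact: (rmorphXn val_lr).
  by split; [| | | split]; apply: val_inj; rewrite /= ?vX //=.
have [F [Fx Fy Fz]] := envelope_map T.
have aE : a = vsval (F a).
  by apply: (@envelope_unique A idfun (val_lr \o F)) => /=; rewrite ?Fx ?Fy ?Fz.
rewrite aE; apply: subvP (subvsP (F a)).
apply: agenv_sub_modl; first by rewrite -memvE.
apply/prodvP => u w /memv_addP[_ /memv_addP[_ /vlineP[c ->] [_ /vlineP[d ->] ->]]].
case=> _ /vlineP[e' ->] -> wW; have [xw yw zw] := WP _ wW.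
by rewrite !mulrDl -!scalerAl !memvD ?memvZ.
Qed.

End HeisenbergAlgebra.

(* The model of u(g) on k[y, z, x]/(y^p, z^p, x^p), with x acting as
   multiplication by x plus z d/dy. *)
Section HeisenbergModel.
Variables (k : fieldType) (P : nat).
Local Notation p := P.+1.
Hypothesis charp : p \in [pchar k].
Hypothesis p_gt2 : (2 < p)%N.

Definition shift_mx : 'M[k]_p := \matrix_(a, b) (a == b.+1 :> nat)%:R.
Definition deriv_mx : 'M[k]_p := \matrix_(a, b) ((a.+1 == b)%:R * b%:R).
Definition basis_col (n : nat) : 'cV[k]_p := \col_a (a == n :> nat)%:R.
Local Notation S := shift_mx.
Local Notation D := deriv_mx.
Local Notation E := basis_col.

Lemma basis_col_big n : (p <= n)%N -> E n = 0.
Proof.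
move=> pn; apply/colP => a; rewrite !mxE; case: eqP => // an.
by have := ltn_ord a; rewrite an ltnNge pn.
Qed.

Lemma mulmx_basis_col m (M : 'M[k]_(m, p)) (b : 'I_p) i : (M *m E b) i 0 = M i b.
Proof.
rewrite mxE (bigD1 b) //= !mxE eqxx mulr1 big1 ?addr0 // => c cb.
by rewrite mxE (_ : (c == b :> nat) = false) ?mulr0 //; apply: negbTE.
Qed.

Lemma mx_basis_ext (M N : 'M[k]_p) : (forall n, M *m E n = N *m E n) -> M = N.
Proof. by move=> MN; apply/matrixP => i j; rewrite -!mulmx_basis_col MN. Qed.

Lemma shift_mxE n : S *m E n = E n.+1.
Proof.
have [np|pn] := ltnP n p; last by rewrite !basis_col_big ?mulmx0 // leqW.
apply/colP => a; rewrite -[n]/(nat_of_ord (Ordinal np)) mulmx_basis_col.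
by rewrite !mxE.
Qed.

Lemma deriv_mxE n : D *m E n = n%:R *: E n.-1.
Proof.
have [np|pn] := ltnP n p.
  apply/colP => a; rewrite -[n]/(nat_of_ord (Ordinal np)) mulmx_basis_col.
  rewrite !mxE /=; case: n np => [|n] np /=; first by rewrite !mulr0n mulr0 mul0r.
  by rewrite eqSS mulrC.
rewrite basis_col_big // mulmx0; case: n pn => // n; rewrite leq_eqVlt.
(* At exponent p the right side is p times a nonzero column: characteristic p is what makes the
   derivation compatible with y^p = 0. *)
case/orP => [/eqP <-|pn]; first by rewrite (pcharf0 charp) scale0r.
by rewrite /= basis_col_big ?scaler0.
Qed.

Lemma weyl_mx : D *m S = S *m D + 1.
Proof.
apply: mx_basis_ext => n; rewrite mulmxDl mul1mx -!mulmxA shift_mxE !deriv_mxE.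
case: n => [|n] /=; first by rewrite scale1r scale0r mulmx0 add0r.
by rewrite -scalemxAr shift_mxE -{3}[E n.+1]scale1r -scalerDl natr1.
Qed.

Lemma shift_mx_pth : S ^+ p = 0.
Proof.
have SX m n : S ^+ m *m E n = E (n + m).
  elim: m n => [|m IH] n; first by rewrite expr0 mul1mx addn0.
  by rewrite exprSr -mulmxE -mulmxA shift_mxE IH addSnnS.
by apply: mx_basis_ext => n; rewrite SX mul0mx basis_col_big // leq_addl.
Qed.

Lemma deriv_mx_pth : D ^+ p = 0.
Proof.
have DX m n : D ^+ m *m E n = (n ^_ m)%:R *: E (n - m).
  elim: m => [|m IH]; first by rewrite expr0 mul1mx ffactn0 scale1r subn0.
  by rewrite exprS -mulmxE -mulmxA IH -scalemxAr deriv_mxE scalerA -natrM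
    ffactnSr subnS.
apply: mx_basis_ext => n; rewrite mul0mx; have [np|pn] := ltnP n p.
  by rewrite DX ffact_small // scale0r.
by rewrite basis_col_big // mulmx0.
Qed.

Local Notation tens3 A B C := ((A *t B) *t C).

Lemma tens3M m1 m2 m3 n1 n2 n3 r1 r2 r3
    (A : 'M[k]_(m1, n1)) (B : 'M[k]_(m2, n2)) (C : 'M[k]_(m3, n3))
    (A' : 'M[k]_(n1, r1)) (B' : 'M[k]_(n2, r2)) (C' : 'M[k]_(n3, r3)) :
  tens3 A B C *m tens3 A' B' C' = tens3 (A *m A') (B *m B') (C *m C').
Proof. by rewrite !tensmx_mul. Qed.

Lemma tens3X (A B C : 'M[k]_p) n :
  tens3 A B C ^+ n.+1 = tens3 (A ^+ n.+1) (B ^+ n.+1) (C ^+ n.+1).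
Proof.
elim: n => [//|n IH].
by rewrite [in LHS]exprS -mulmxE IH tens3M !mulmxE -!exprS.
Qed.

Definition model_x : 'M[k]_(p * p * p) := tens3 1 1 S + tens3 D S 1.
Definition model_y : 'M[k]_(p * p * p) := tens3 S 1 1.
Definition model_z : 'M[k]_(p * p * p) := tens3 1 S 1.

Lemma model_triple : heis_triple p 1 model_x model_y model_z.
Proof.
have t0l (B C : 'M[k]_p) : tens3 (0 : 'M[k]_p) B C = 0 by rewrite !tens0mx.
have mulE (M N : 'M[k]_(p * p * p)) : M * N = M *m N by [].
have Dm : tens3 (S *m D + 1) S (1 : 'M_p) = tens3 (S *m D) S 1 + tens3 1 S 1.
  by apply/matrixP => i j; rewrite !mxE; ring.
split; rewrite ?mulE /model_x /model_y /model_z ?mulmxDl ?mulmxDr.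
- by rewrite !tens3M !mulmx1 !mul1mx weyl_mx Dm scale1r addrA.
- by rewrite !tens3M !mulmx1 !mul1mx.
- by rewrite !tens3M !mulmx1 !mul1mx.
split; last 2 first.
- by rewrite tens3X shift_mx_pth t0l.
- by rewrite tens3X shift_mx_pth tensmx0 tens0mx.
rewrite (pencil_pth charp p_gt2 (Z := 0)) ?mul0r ?mulr0 //; last first.
  by rewrite addr0 !mulE !tens3M !mulmx1 !mul1mx.
by rewrite !tens3X shift_mx_pth deriv_mx_pth t0l tensmx0 addr0.
Qed.

Definition model_col a b c : 'M[k]_(p * p * p, 1 * 1 * 1) := tens3 (E a) (E b) (E c).

(** With [Y] to the left of [X], the powers of [model_x] act on columns free of y, where the
    derivation term vanishes; each monomial then produces a single basis column. *)
Lemma model_pbw (t : nat * nat * nat) :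
  pbw model_y model_x model_z t *m model_col 0 0 0 = model_col t.1.1 t.2 t.1.2.
Proof.
have zE n : model_z ^+ n *m model_col 0 0 0 = model_col 0 n 0.
  elim: n => [|n IH]; first by rewrite expr0 mul1mx.
  by rewrite exprS -mulmxE -mulmxA IH tens3M !mul1mx shift_mxE.
have xE b n : model_x ^+ n *m model_col 0 b 0 = model_col 0 b n.
  elim: n => [|n IH]; first by rewrite expr0 mul1mx.
  rewrite exprS -mulmxE -mulmxA IH mulmxDl !tens3M !mul1mx shift_mxE deriv_mxE.
  by rewrite scale0r !tens0mx addr0.
have yE b c n : model_y ^+ n *m model_col 0 b c = model_col n b c.
  elim: n => [|n IH]; first by rewrite expr0 mul1mx.
  by rewrite exprS -mulmxE -mulmxA IH tens3M !mul1mx shift_mxE.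
by rewrite /pbw -!mulmxE -!mulmxA zE xE yE.
Qed.

Lemma model_colE a b c (a' b' c' : 'I_p) :
  model_col a b c (mxtens_index (mxtens_index (a', b'), c')) 0 =
  [&& a' == a :> nat, b' == b :> nat & c' == c :> nat]%:R.
Proof.
rewrite !mxE !mxtens_indexK /= ?mxtens_indexK /=.
by do 3!case: eqP => _; rewrite ?mulr1 ?mulr0 ?mul0r.
Qed.

End HeisenbergModel.

Lemma heis_model (k : fieldType) (p : nat) : p \in [pchar k] -> (2 < p)%N ->
  exists (B : algType k) (X Y Z : B), heis_triple p 1 X Y Z /\
    forall c, \sum_t c t *: pbw Y X Z (@ords p t) = 0 -> forall t, c t = 0.
Proof.
case: p => // P charp p_gt2.
exists 'M[k]_(P.+1 * P.+1 * P.+1), (model_x k P), (model_y k P), (model_z k P).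
split=> [|c c0 t]; first exact: model_triple.
have := congr1 (fun M : 'M[k]_(P.+1 * P.+1 * P.+1) =>
  (M *m model_col k P 0 0 0) (mxtens_index (mxtens_index (t.1.1, t.2), t.1.2)) 0) c0.
rewrite mul0mx [RHS]mxE mulmx_suml summxE (bigD1 t) //= big1 ?addr0 => [|t' tt'].
  by rewrite -scalemxAl (model_pbw charp) mxE model_colE /ords /= !eqxx mulr1.
rewrite -scalemxAl (model_pbw charp) mxE model_colE /ords /=.
case: t t' tt' => [[t1 t2] t3] [[t1' t2'] t3'] /= /negPf tt'.
case: and3P => [[/eqP e1 /eqP e3 /eqP e2]|]; last by rewrite mulr0.
by move/eqP: tt'; case; congr (_, _, _); apply: val_inj.
Qed.

Section HeisenbergDimension.
Variables (k : fieldType) (p : nat).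
Hypothesis charp : p \in [pchar k].
Hypothesis p_gt2 : (2 < p)%N.
Variables (g : restricted_lie k p) (x y z : g).
Hypothesis xyz : basis_of fullv [:: x; y; z].
Hypotheses (brxy : lbr x y = z) (brzx : lbr z x = 0) (brzy : lbr z y = 0).
Hypotheses (px : ppow x = 0) (py : ppow y = 0) (pz : ppow z = 0).
Variables (A : falgType k) (inj : g -> A).
Hypothesis envA : is_envelope inj.

(** The commutation rules make the monomials span; they are independent because their images in the
    model are. *)
Lemma heis_dim : \dim {:A} = (p ^ 3)%N.
Proof.
have [B [X [Y [Z [T ind]]]]] := heis_model charp p_gt2.
have [F [Fx Fy Fz]] := envelope_map charp p_gt2 xyz brxy brzx brzy px py pz envA T.
have TA := inj_triple brxy brzx brzy px py pz envA.
have gA := inj_generates charp p_gt2 xyz brxy brzx brzy px py pz envA.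
pose m t := pbw (inj y) (inj x) (inj z) (@ords p t).
pose T3 : finType := ('I_p * 'I_p * 'I_p)%type.
pose e := [tuple m (enum_val i) | i < #|T3|].
have cardT : #|T3| = (p ^ 3)%N.
  by rewrite !card_prod !card_ord !expnS muln1 mulnA.
have eE (i : 'I_#|T3|) : e`_i = m (enum_val i).
  by rewrite -tnth_nth tnth_mktuple.
rewrite -cardT; apply/eqP; rewrite eqn_leq; apply/andP; split.
  suff <- : <<e>>%VS = fullv by rewrite (leq_trans (dim_span _)) ?size_tuple.
  apply/eqP; rewrite eqEsubv subvf; apply/subvP => v _.
  have [c ->] := pbw_span (heis_tripleC TA) (left_generatesC gA) v.
  apply: memv_suml => t _; apply: memvZ; rewrite memv_span //.
  by apply/(nthP 0); exists (enum_rank t); rewrite ?size_tuple // eE enum_rankK.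
suff fe : free e by rewrite -(size_tuple e) -(eqP fe) dimvS // subvf.
apply/freeP => c c0 i; rewrite -(enum_valK i).
apply: (ind (fun t => c (enum_rank t))).
have FE t : F (m t) = pbw Y X Z (@ords p t) by rewrite /m /pbw !rmorphM !rmorphXn /= Fx Fy Fz.
have := congr1 F c0; rewrite linear_sum linear0 => {2}<-.
rewrite (reindex (fun i : 'I_#|T3| => enum_val i)) /=; last first.
  by exists enum_rank => j _; rewrite ?enum_valK ?enum_rankK.
by apply: eq_bigr => j _; rewrite enum_valK eE linearZ /= FE.
Qed.

End HeisenbergDimension.

(** * Nilpotent augmentation ideals, and freeness over k[X] *)

Lemma nil_augmentation_unit (F : fieldType) (A : falgType F) (eps : A -> F) :
  (forall c a b, eps (c *: a + b) = c * eps a + eps b) ->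
  (forall a b, eps (a * b) = eps a * eps b) -> eps 1 = 1 ->
  (forall a, eps a = 0 -> exists n, a ^+ n = 0) ->
  forall a, (a \is a GRing.unit) = (eps a != 0).
Proof.
move=> el em e1 en a; apply/idP/idP => [ua|a0].
  apply: contraTneq (oner_neq0 F) => ea.
  by rewrite -e1 -(mulrV ua) em ea mul0r eqxx.
pose n := 1 - (eps a)^-1 *: a.
have n0 : eps n = 0.
  have -> : n = (- (eps a)^-1) *: a + 1 by rewrite /n addrC scaleNr.
  by rewrite el e1 mulNr mulVf // addNr.
have [N nN] := en _ n0.
have aE : a = eps a *: (1 - n).
  by rewrite /n opprB addrC subrK scalerA mulfV // scale1r.
have un : (1 - n) \is a GRing.unit.
  apply/unitrP; exists (\sum_(i < N) n ^+ i).
  have cn : GRing.comm (n - 1) (\sum_(i < N) n ^+ i).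
    apply: commr_sum => i _; apply: commrX.
    by apply: commr_sym; apply: commrB; [exact: commr_refl | exact: commr1].
  have E := subrX1 n N; rewrite nN sub0r in E.
  have E1 : (1 - n) * \sum_(i < N) n ^+ i = 1.
    by rewrite -[1 - n]opprB mulNr -E opprK.
  by split=> //; rewrite -[1 - n]opprB mulrN -cn -E opprK.
by rewrite aE -mulr_algl unitrMl ?scaler_unit ?unitfE ?unitr1.
Qed.

Lemma nil_augmentation_local (F : fieldType) (A : falgType F) (eps : A -> F) :
  (forall c a b, eps (c *: a + b) = c * eps a + eps b) ->
  (forall a b, eps (a * b) = eps a * eps b) -> eps 1 = 1 ->
  (forall a, eps a = 0 -> exists n, a ^+ n = 0) -> local_ring A.
Proof.
move=> el em e1 en a b; rewrite !(nil_augmentation_unit el em e1 en) !negbK.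
by rewrite -{2}[a]scale1r el => /eqP -> /eqP ->; rewrite mulr0 addr0.
Qed.

Section Frames.
Variables (F : fieldType) (A : falgType F) (p : nat) (c : F) (X Y Z : A).
Hypothesis p_gt1 : (1 < p)%N.
Hypothesis heis : heis_triple p c X Y Z.
Hypothesis gen : left_generates X Y Z.
Hypothesis dimA : \dim {:A} = (p ^ 3)%N.

Let p0 : (0 < p)%N := ltnW p_gt1.
Let Xp : X ^+ p = 0. Proof. by case: heis => _ _ _ []. Qed.

(** Freeness of A as a left module over F[X]/X^p, from which the flatness of pi-points is
    deduced. *)
Lemma left_frame_exists : exists (co : 'I_p * 'I_p -> A -> truncated F p),
  [/\ forall i, linear (co i),
      forall a, a = \sum_i powmap X (co i a) * (Y ^+ i.1 * Z ^+ i.2)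
    & forall (i j : 'I_p * 'I_p) q, co i (powmap X q * (Y ^+ j.1 * Z ^+ j.2)) =
        if i == j then q else 0].
Proof.
have [co coE coD] := pbw_frame heis gen dimA.
pose d (i : 'I_p * 'I_p) a : truncated F p :=
  in_qpoly 'X^p (\poly_(l < p) (if insub l is Some l' then co (l', i.1, i.2) a else 0)).
have dC i a (l : 'I_p) : (d i a : {poly F})`_l = co (l, i.1, i.2) a.
  by rewrite coef_truncp // ltn_ord coef_poly ltn_ord valK.
have dl i : linear (d i).
  move=> e a b; apply: truncp_eq => // l lp.
  by rewrite -[l]/(nat_of_ord (Ordinal lp)) coefD coefZ !dC linearP.
have dE a : a = \sum_i powmap X (d i a) * (Y ^+ i.1 * Z ^+ i.2).
  rewrite {1}(coE a).
  under [RHS]eq_bigr do rewrite powmapE // mulr_suml.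
  rewrite exchange_big pair_big /=.
  rewrite (reindex (fun t : 'I_p * ('I_p * 'I_p) => (t.1, t.2.1, t.2.2))) /=; last first.
    by exists (fun t => (t.1.1, (t.1.2, t.2))) => [[? []]|[[]]].
  by apply: eq_bigr => [[l [i j]]] _; rewrite dC -scalerAl /pbw /= mulrA.
exists d; split=> // i j q; rewrite powmapE // mulr_suml.
apply: truncp_eq => // l lp; rewrite -[l]/(nat_of_ord (Ordinal lp)) dC.
have E (l' : 'I_p) : co (Ordinal lp, i.1, i.2) (q`_l' *: X ^+ l' * (Y ^+ j.1 * Z ^+ j.2)) =
    q`_l' * ((Ordinal lp == l') && (i == j))%:R.
  rewrite -scalerAl mulrA -[_ * _ ^+ j.2]/(pbw X Y Z (ords (l', j.1, j.2))).
  rewrite linearZ /= coD; congr (_ * _%:R); case: i j => [i1 i2] [j1 j2] /=.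
  by rewrite -!pair_eqE /pair_eq /= andbA.
rewrite linear_sum (bigD1 (Ordinal lp)) // E eqxx big1 => [|l' ll'].
  by rewrite /= addr0; case: ifP; rewrite ?mulr1 ?mulr0 ?coef0.
by rewrite E eq_sym (negPf ll') mulr0.
Qed.

End Frames.

Lemma right_frame_exists (F : fieldType) (A : falgType F) (p : nat) (c : F) (X Y Z : A) :
  forall p_gt0 : (0 < p)%N, (1 < p)%N ->
  heis_triple p c X Y Z -> left_generates X Y Z -> \dim {:A} = (p ^ 3)%N ->
  let i0 := (Ordinal p_gt0, Ordinal p_gt0) in
  exists co, @right_frame F p A X _ i0 (fun i : 'I_p * 'I_p => Y ^+ i.1 * Z ^+ i.2) co.
Proof.
move=> p_gt0 p_gt1 T gen dimA i0.
(* Monomials are taken in the order Y, X, Z; since [Z] commutes with [X], the power of [X] can then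
   be moved to the right end. *)
have T' := heis_tripleC T; have gen' := left_generatesC gen.
have [co coE coD] := pbw_frame T' gen' dimA.
have pbwE (i j l : nat) : pbw Y X Z (i, l, j) = Y ^+ i * Z ^+ j * X ^+ l.
  by rewrite /pbw /= -!mulrA (heis_commZXn T).
pose d (i : 'I_p * 'I_p) a : truncated F p :=
  in_qpoly 'X^p (\poly_(l < p) (if insub l is Some l' then co (i.1, l', i.2) a else 0)).
have dC i a (l : 'I_p) : (d i a : {poly F})`_l = co (i.1, l, i.2) a.
  by rewrite coef_truncp // ltn_ord coef_poly ltn_ord valK.
exists d; split.
- move=> i e a b; apply: truncp_eq => // l lp.
  by rewrite -[l]/(nat_of_ord (Ordinal lp)) coefD coefZ !dC linearP.
- move=> a; rewrite {1}(coE a).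
  under [RHS]eq_bigr do rewrite powmapE // mulr_sumr.
  rewrite pair_big /=.
  rewrite (reindex (fun t : ('I_p * 'I_p) * 'I_p => (t.1.1, t.2, t.1.2))) /=; last first.
    by exists (fun t => (t.1.1, t.2, t.1.2)) => [[[]]|[[]]].
  by apply: eq_bigr => [[[i j] l]] _; rewrite dC -scalerAr pbwE.
- move=> i j q; rewrite powmapE // mulr_sumr.
  apply: truncp_eq => // l lp; rewrite -[l]/(nat_of_ord (Ordinal lp)) dC.
  have E (l' : 'I_p) : co (i.1, Ordinal lp, i.2) (Y ^+ j.1 * Z ^+ j.2 * (q`_l' *: X ^+ l')) =
      q`_l' * ((Ordinal lp == l') && (i == j))%:R.
    rewrite -scalerAr -pbwE -[pbw _ _ _ _]/(pbw Y X Z (ords (j.1, l', j.2))).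
    rewrite linearZ /= coD; congr (_ * _%:R); case: i j => [i1 i2] [j1 j2] /=.
    by rewrite -!pair_eqE /pair_eq /= andbAC andbC.
  rewrite linear_sum (bigD1 (Ordinal lp)) // E eqxx big1 => [|l' ll'].
    by rewrite /= addr0; case: ifP; rewrite ?mulr1 ?mulr0 ?coef0.
  by rewrite E eq_sym (negPf ll') mulr0.
by rewrite !expr0 mulr1.
Qed.

Section LocalAlgebra.
Variables (F : fieldType) (A : falgType F) (p : nat) (c : F) (X Y Z : A).
Hypothesis p_gt0 : (0 < p)%N.
Hypothesis heis : heis_triple p c X Y Z.
Hypothesis gen : left_generates X Y Z.
Hypothesis dimA : \dim {:A} = (p ^ 3)%N.
Variable eps : {lrmorphism A -> F^o}.
Hypotheses (eX : eps X = 0) (eY : eps Y = 0) (eZ : eps Z = 0).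

(* X and Y have weight 1, Z has weight 2. *)
Lemma augmentation_nilpotent a : eps a = 0 -> a ^+ (4 * p) = 0.
Proof.
move=> ea; have [co coE coD] := pbw_frame heis gen dimA.
pose wt (t : nat * nat * nat) := (t.1.1 + t.1.2 + t.2.*2)%N.
pose fil n b := forall t, (wt (ords t) < n)%N -> co t b = 0.
have co_pbw t s : wt (ords t) != wt s -> co t (pbw X Y Z s) = 0.
  case: s => [[i j] l] ts.
  have [ip|ip] := ltnP i p; last by rewrite (pbw_big heis) ?linear0 //= ip.
  have [jp|jp] := ltnP j p; last by rewrite (pbw_big heis) ?linear0 //= jp orbT.
  have [lp|lp] := ltnP l p; last by rewrite (pbw_big heis) ?linear0 //= lp !orbT.
  rewrite -[(i, j, l)]/(ords (Ordinal ip, Ordinal jp, Ordinal lp)) coD.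
  by case: (t =P _) ts => [->|//]; rewrite eqxx.
have filD n b d e : fil n b -> fil n d -> fil n (e *: b + d).
  by move=> fb fd t tn; rewrite linearP /= fb // fd // mulr0 addr0.
have fil0 n : fil n 0 by move=> t _; rewrite linear0.
have fil_sum n (T : finType) (f : T -> A) : (forall t, fil n (f t)) -> fil n (\sum_t f t).
  move=> ff; elim/big_ind: _ => // b d fb fd.
  by rewrite -[b]scale1r; apply: filD.
have fil_pbw n s : (n <= wt s)%N -> fil n (pbw X Y Z s).
  by move=> ns t tn; apply: co_pbw; rewrite neq_ltn (leq_trans tn ns).
have filS n b : fil n.+1 b -> fil n b by move=> fb t tn; apply: fb; exact: ltnW.
have mulG G : (forall t, fil (wt (ords t)).+1 (G * pbw X Y Z (@ords p t))) ->
    forall n b, fil n b -> fil n.+1 (G * b).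
  move=> GP n b fb; rewrite (coE b) mulr_sumr; apply: fil_sum => t.
  rewrite -scalerAr; have [tn|tn] := ltnP (wt (ords t)) n.
    by rewrite fb // scale0r.
  rewrite -[_ *: _]addr0; apply: filD => // s sn; apply: (GP t).
  by rewrite ltnS (leq_trans _ tn) // -ltnS.
have mulX := mulG X _; have mulY := mulG Y _; have mulZ := mulG Z _.
have {}mulX n b : fil n b -> fil n.+1 (X * b).
  by apply: mulX => -[[i j] l]; rewrite mulX_pbw; apply: fil_pbw; rewrite /wt /=; lia.
(* The correction term trades one [X] for one [Z]; it gains weight because [Z] counts twice. *)
have {}mulY n b : fil n b -> fil n.+1 (Y * b).
  apply: mulY => -[[[i ip] j] l]; rewrite (mulY_pbw heis) /=.
  case: i ip => [|i] ip; first by rewrite mul0r scale0r subr0; apply: fil_pbw; rewrite /wt /=; lia.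
  by rewrite addrC -scaleNr; apply: filD; apply: fil_pbw; rewrite /wt /=; lia.
have {}mulZ n b : fil n b -> fil n.+1 (Z * b).
  by apply: mulZ => -[[i j] l]; rewrite (mulZ_pbw heis); apply: fil_pbw; rewrite /wt /=; lia.

have filG t n b : (0 < wt t)%N -> fil n b -> fil n.+1 (pbw X Y Z t * b).
  case: t => [[i j] l]; elim: i j l b => [|i IHi] j l b; last first.
    case: (posnP (wt (i, j, l))) => [|w0 _ fb].
      rewrite /wt /=; case: i {IHi} => [|i]; case: j => [|j]; case: l => [|l] // _ _ fb.
      by rewrite /pbw /= !expr0 expr1 !mulr1; apply: mulX.
    by rewrite -mulX_pbw -mulrA; apply/filS/mulX/IHi.
  elim: j l b => [|j IHj] l b; last first.
    have -> : pbw X Y Z (0, j.+1, l)%N = Y * pbw X Y Z (0, j, l)%N.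
      by rewrite (mulY_pbw heis) mul0r scale0r subr0.
    case: (posnP (wt (0, j, l)%N)) => [|w0 _ fb].
      rewrite /wt /=; case: j {IHj} => [|j]; case: l => [|l] // _ _ fb.
      by rewrite /pbw /= !expr0 !mulr1; apply: mulY.
    by rewrite -mulrA; apply/filS/mulY/IHj.
  elim: l b => [//|l IHl] b _ fb.
  rewrite -(mulZ_pbw heis) -mulrA; apply: mulZ.
  case: l IHl => [|l] IHl; first by rewrite /pbw /= !expr0 !mul1r.
  exact/filS/IHl.
have pbw_eps t : eps (pbw X Y Z (ords t)) = (wt (@ords p t) == 0)%:R.
  rewrite /pbw !rmorphM !rmorphXn /= eX eY eZ !expr0n /wt -!natrM !mulnb.
  by congr (_%:R); rewrite /=; case: t => [[[i ?] [j ?]] [l ?]] /=; lia.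
pose t0 := (Ordinal p_gt0, Ordinal p_gt0, Ordinal p_gt0).
have co0 : co t0 a = 0.
  rewrite -ea {2}(coE a) linear_sum /= (bigD1 t0) //= big1 ?addr0.
    by rewrite linearZ /= pbw_eps /= [X in _ = X]mulr1.
  move=> t tt0; rewrite linearZ /= pbw_eps.
  suff -> : (wt (ords t) == 0)%N = false by rewrite scaler0.
  apply: contraNF tt0; case: t => [[[i ?] [j ?]] [l ?]]; rewrite /wt /= => w0.
  by apply/eqP; congr (_, _, _); apply: val_inj; move: w0 => /=; lia.
have mula n b : fil n b -> fil n.+1 (a * b).
  move=> fb; rewrite (coE a) mulr_suml; apply: fil_sum => t.
  rewrite -scalerAl -[_ *: _]addr0; have [->|tt0] := eqVneq t t0.
    by rewrite co0 scale0r addr0.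
  apply: filD => //; apply: filG => //; rewrite lt0n.
  apply: contra tt0; case: t => [[[i ?] [j ?]] [l ?]]; rewrite /wt /= => w0.
  by apply/eqP; congr (_, _, _); apply: val_inj; move: w0 => /=; lia.
have fa n : fil n (a ^+ n) by elim: n => [|n IH]; [|rewrite exprS; apply: mula].
(* A nonzero ordered monomial has weight at most 4 (p - 1), so level [4 * p] of the filtration is
   0. *)
rewrite (coE (a ^+ _)) big1 // => t _; rewrite fa ?scale0r //.
by case: t => [[[i ?] [j ?]] [l ?]]; rewrite /wt /=; lia.
Qed.

End LocalAlgebra.

(** * Flat and projective modules over K[t]/t^p *)

Section TruncatedModules.
Variables (K : fieldType) (p : nat).
Hypothesis p_gt1 : (1 < p)%N.
Local Notation R := (truncated K p).
Local Notation s := (truncX K p).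

Lemma trunc_sum (r : R) : r = \sum_(i < p) (r : {poly K})`_i *: s ^+ i.
Proof.
rewrite -[LHS](valK_truncp p_gt1 r) -[in LHS](coefK (r : {poly K})) poly_def !linear_sum /=.
rewrite (big_ord_widen _ (fun i => in_qpoly ('X^p : {poly K}) (r`_i *: 'X^i)) (size_trunc p_gt1 r)).
rewrite big_mkcond /=; apply: eq_bigr => i _.
case: ltnP => iq; last by rewrite nth_default // scale0r.
by rewrite linearZ /= -truncXn.
Qed.

Definition trunc_eps_rm : {rmorphism R -> K} :=
  HB.pack_for {rmorphism R -> K} (@trunc_eps K p)
    (GRing.isZmodMorphism.Build R K (@trunc_eps K p)
       (fun a b : R => coefB (a : {poly K}) b 0))
    (GRing.isMonoidMorphism.Build R K (@trunc_eps K p)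
       (conj (@trunc_eps1 K p) (@trunc_epsM K p p_gt1))).

Lemma flat_left_frame (B : algType K) (alpha : {lrmorphism R -> B}) (I : finType)
    (b : I -> B) (c : I -> B -> R) :
  (forall i, linear (c i)) -> (forall a, a = \sum_i alpha (c i a) * b i) ->
  (forall i r a, c i (alpha r * a) = r * c i a) -> flat (along alpha).
Proof.
move=> cl cE cM N' N f f_inj t t0 P g gDr gDl gM.
have c0 i : \sum_(u <- t) c i u.2 *: u.1 = 0.
  apply: f_inj; rewrite linear0 linear_sum /=.
  have := t0 N (fun n m => c i m *: n); rewrite big_map /=.
  under [X in _ -> X = _]eq_bigr do rewrite linearZ /=.
  apply=> [n m m'|m n n'|r n m].
  - by rewrite -scalerDl; congr (_ *: _); have := cl i 1 m m'; rewrite !scale1r.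
  - by rewrite scalerDr.
  by rewrite scalerA -[r *: (m : along alpha)]/(alpha r * (m : B)) cM mulrC.
have g0 m : g 0 m = 0 by apply: (addrI (g 0 m)); rewrite -gDl !addr0.
have g0r n : g n 0 = 0 by apply: (addrI (g n 0)); rewrite -gDr !addr0.
have gsum n (J : Type) (l : seq J) (F : J -> along alpha) :
    g n (\sum_(j <- l) F j) = \sum_(j <- l) g n (F j).
  by elim/big_rec2: _ => [|j x y _ <-]; [exact: g0r | exact: gDr].
have gsuml m (J : Type) (l : seq J) (F : J -> N') :
    g (\sum_(j <- l) F j) m = \sum_(j <- l) g (F j) m.
  by elim/big_rec2: _ => [|j x y _ <-]; [exact: g0 | exact: gDl].
have E u : g u.1 u.2 = \sum_i g (c i u.2 *: u.1) (b i).
  rewrite {1}(cE u.2) -[\sum_i _]/(\sum_i (c i u.2 *: (b i : along alpha))) gsum.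
  by apply: eq_bigr => i _; rewrite gM.
under eq_bigr do rewrite E.
rewrite exchange_big big1 // => i _.
by rewrite -gsuml c0 g0.
Qed.

(** Flatness is tested on the embedding of K as the socle of K[t]/t^p. It sends 1 (x) a to s^(p-1)
    (x) a = 1 (x) u^(p-1) a = 0, so a vanishes in K (x) B = B / u B. *)
Lemma flat_exact (B : falgType K) (alpha : {lrmorphism R -> B}) (a : B) :
  flat (along alpha) -> alpha s ^+ p.-1 * a = 0 -> exists a', a = alpha s * a'.
Proof.
move=> fl ua; set u := alpha s in ua *.
pose U := limg (linfun (u \*o @idfun B)).
pose q : 'End(B) := daddv_pi U^C U.
have q_ker w : (q w == 0) = (w \in U).
  have dUC : (U^C :&: U = 0)%VS by rewrite capvC capv_compl.
  have := @daddv_pi_add _ _ _ _ w dUC; rewrite addvC addv_complf memvf => /(_ isT) E.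
  apply/idP/idP => [/eqP q0|wU]; first by rewrite -E -/q q0 add0r memv_pi.
  by apply/eqP; move: E; rewrite (daddv_pi_id (capv_compl U) wU) -[in RHS](add0r w) => /addIr.
have qu w : q (u * w) = 0.
  by apply/eqP; rewrite q_ker; have := memv_img (linfun (u \*o @idfun B)) (memvf w); rewrite lfunE.
have qM r w : q (alpha r * w) = trunc_eps r *: q w.
  rewrite {1}(trunc_head p_gt1 r) rmorphD rmorphM /= linearZ /= rmorph1.
  by rewrite mulrDl -scalerAl mul1r -mulrA linearD /= qu addr0 linearZ.
(* The trivial module K, on which t acts by 0; [f] embeds it as the socle. *)
pose N' := along trunc_eps_rm.
pose f (e : N') : R^o := (e : K) *: s ^+ p.-1.
have f_lin : linear f.
  move=> r e e'; rewrite /f scalerDl; congr (_ + _).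
  rewrite -[r *: e]/(trunc_eps r * (e : K)) -[r *: _]/(r * _).
  by rewrite [X in X *: _]mulrC -scalerA -truncX_topM // -scalerAr (mulrC r).
pose fL := HB.pack_for {linear N' -> R^o} f (GRing.isLinear.Build R N' R^o *:%R f f_lin).
have f_inj : injective fL.
  move=> e e' /(congr1 (@trunc_top K p)); rewrite -![fL _]/(f _) /f.
  have E (x : K) : trunc_top (x *: s ^+ p.-1) = x.
    by rewrite -[_ *: _]addr0 trunc_top_lin // trunc_topX // mulr1 /trunc_top coef0 addr0.
  by rewrite !E.
have /(_ _ _ fL f_inj [:: ((1 : K) : N', a : along alpha)]) := fl.
have pre : tensor_zero [seq (fL u.1, u.2) | u <- [:: ((1 : K) : N', a : along alpha)]].
  move=> P g gDr gDl gM; rewrite /= big_seq1 /= /f scale1r.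
  have -> : s ^+ p.-1 = s ^+ p.-1 *: (1 : R^o) by rewrite -[_ *: _]/(_ * _) mulr1.
  rewrite gM -[_ *: (a : along _)]/(alpha _ * a) rmorphXn /= -/u ua.
  by apply: (addrI (g 1 0)); rewrite -gDr !addr0.
move=> /(_ pre B (fun (e : N') m => (e : K) *: q m)); rewrite big_seq1 /= scale1r => qa.
have /eqP : q a = 0.
  apply: qa => [n m m'|m n n'|r n m].
  - by rewrite -scalerDr -linearD.
  - by rewrite -scalerDl.
  by rewrite -[_ *: (m : along _)]/(alpha _ * m) qM scalerA mulrC.
rewrite q_ker => /memv_imgP[a' _ ->]; exists a'; by rewrite lfunE.
Qed.

End TruncatedModules.

(** The sum formed with [t] commutes with [u] and lies in 1 + u E, so it differs from 1 by a
    nilpotent element and is invertible; [t'] is [t] times its inverse. *)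
Lemma nilp_split (E : pzRingType) (p : nat) (u t c : E) : (0 < p)%N ->
  u ^+ p = 0 -> t * u ^+ p.-1 = 1 + u * c ->
  exists t', \sum_(i < p) u ^+ i * t' * u ^+ (p.-1 - i) = 1.
Proof.
move=> p0 up tu; pose T := \sum_(i < p) u ^+ i * t * u ^+ (p.-1 - i).
have uT : u * T = T * u.
  case: p p0 up tu @T => // p _ up _ T; rewrite /T /= mulr_sumr mulr_suml.
  rewrite big_ord_recr big_ord_recl /= !mulrA -exprS up !mul0r addr0.
  rewrite subn0 mul1r -mulrA -exprSr up mulr0 add0r; apply: eq_bigr => i _.
  by rewrite !mulrA -exprS /bump /= add1n -[RHS]mulrA -exprSr subnSK.
have [d Td] : exists d, T = 1 + u * d.
  case: p p0 up tu @T uT => // p _ up tu T _.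
  exists (c + \sum_(i < p) u ^+ i * t * u ^+ (p - bump 0 i)).
  rewrite /T /= big_ord_recl /= subn0 mul1r tu -addrA mulrDr; congr (_ + (_ + _)).
  by rewrite mulr_sumr; apply: eq_bigr => i _; rewrite !mulrA -exprS.
pose n := 1 - T.
have un : u * n = n * u by rewrite /n mulrBr mulrBl mulr1 mul1r uT.
have nE : n = u * - d by rewrite /n Td opprD addrA subrr add0r mulrN.
have nX m : exists e, n ^+ m = u ^+ m * e.
  elim: m => [|m [e IH]]; first by exists 1; rewrite mulr1.
  exists (- d * e); rewrite exprS IH mulrA.
  have -> : n * u ^+ m = u ^+ m * n by apply: commrX; exact: esym.
  by rewrite {1}nE !mulrA -exprSr.
have np : n ^+ p = 0 by have [e ->] := nX p; rewrite up mul0r.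
pose S := \sum_(i < p) n ^+ i.
have TS : T * S = 1.
  have -> : T = 1 - n by rewrite /n opprB addrC subrK.
  have SE : S = \sum_(i < p.+1) n ^+ i by rewrite big_ord_recr /= np addr0.
  rewrite mulrBl mul1r mulr_sumr SE big_ord_recl expr0.
  under [X in _ + X - _]eq_bigr do rewrite exprS.
  by rewrite addrK.
have uS i : S * u ^+ i = u ^+ i * S.
  apply/esym/commr_sum => j _; apply/commrX/commr_sym/commrX; exact: esym.
exists (t * S); rewrite -TS /T mulr_suml; apply: eq_bigr => i _.
by rewrite -!mulrA uS.
Qed.

Lemma shift_sum (E : nmodType) (a : nat -> E) (p : nat) : a 0%N = 0 -> a p = 0 ->
  \sum_(i < p) a i = \sum_(i < p) a i.+1.
Proof.
case: p => [|p] a0 ap; first by rewrite !big_ord0.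
by rewrite big_ord_recl a0 add0r [RHS]big_ord_recr /= ap addr0.
Qed.

Section ProjectiveCriterion.
Variables (K : fieldType) (p : nat).
Hypothesis p_gt1 : (1 < p)%N.
Local Notation R := (truncated K p).
Local Notation s := (truncX K p).
Variables (n : nat) (rho : {rmorphism R -> 'M[K]_n}).
Hypothesis rhoZ : forall c r, rho (c *: r) = c *: rho r.

Let rhoC c : rho c%:A = c%:M.
Proof. by rewrite rhoZ rmorph1 -scalemx1. Qed.

(** Higman's criterion for the symmetric algebra K[t]/t^p: a K-linear lift is averaged over the dual
    bases t^i and t^(p-1-i) into one that commutes with t. *)
Lemma projective_split (t : 'M[K]_n) :
  \sum_(i < p) (rho s ^+ i *m t *m rho s ^+ (p.-1 - i)) = 1%:M ->
  projective (repmod rho).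
Proof.
move=> tE N' N g f g_surj.
have /choice[y yE] : forall j : 'I_n, exists w, g w = f (delta_mx j 0) by move=> j.
pose l (v : 'cV[K]_n) : N' := \sum_j (v j 0)%:A *: y j.
have lD v w : l (v + w) = l v + l w.
  by rewrite -big_split; apply: eq_bigr => j _; rewrite mxE scalerDl scalerDl.
have lZ c v : l (c *: v) = c%:A *: l v.
  rewrite scaler_sumr; apply: eq_bigr => j _.
  by rewrite mxE scalerA -scalerAl mul1r scalerA.
have gl v : g (l v) = f v.
  rewrite linear_sum /=.
  have {2}-> : v = \sum_j ((v j 0)%:A : R) *: (delta_mx j 0 : repmod rho).
    rewrite {1}(matrix_sum_delta v); apply: eq_bigr => j _.
    rewrite big_ord1; apply/esym; rewrite -[LHS]/(rho _ *m _) rhoC.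
    by rewrite mul_scalar_mx.
  by rewrite linear_sum; apply: eq_bigr => j _; rewrite !linearZ /= yE.
pose h (v : repmod rho) : N' :=
  \sum_(i < p) s ^+ i *: l (t *m (rho s ^+ (p.-1 - i) *m (v : 'cV[K]_n))).
have hD v w : h (v + w) = h v + h w.
  rewrite -big_split; apply: eq_bigr => i _ /=.
  by rewrite -scalerDr -lD -!mulmxDr.
have hZ c (v : repmod rho) : h (c%:A *: v) = c%:A *: h v.
  rewrite /h scaler_sumr; apply: eq_bigr => i _.
  rewrite -[_ *: v]/(rho _ *m (v : 'cV[K]_n)) rhoC mul_scalar_mx.
  by rewrite -!scalemxAr lZ !scalerA mulrC.
have rho0 : rho s ^+ p = 0 by rewrite -rmorphXn truncXp // rmorph0.
have hX (v : repmod rho) : h (s *: v) = s *: h v.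
  pose a i := s ^+ i *: l (t *m (rho s ^+ (p - i) *m (v : 'cV[K]_n))).
  have -> : h (s *: v) = \sum_(i < p) a i.
    apply: eq_bigr => i _; congr (_ *: l (_ *m _)).
    rewrite -[_ *: v]/(rho s *m (v : 'cV[K]_n)) mulmxA -[_ *m rho s]/(_ * _) -exprSr.
    by congr (_ ^+ _ *m _); have := ltn_ord i; lia.
  have -> : s *: h v = \sum_(i < p) a i.+1.
    rewrite scaler_sumr; apply: eq_bigr => i _; rewrite scalerA -exprS /a.
    by congr (_ *: l (_ *m (_ ^+ _ *m _))); have := ltn_ord i; lia.
  apply: shift_sum; rewrite /a ?truncXp ?scale0r // subn0 rho0 mul0mx mulmx0.
  have -> : (0 : 'cV[K]_n) = 0 *: 0 by rewrite scaler0.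
  by rewrite lZ scale0r scale0r scaler0.
have hXn i (v : repmod rho) : h (s ^+ i *: v) = s ^+ i *: h v.
  elim: i => [|i IH]; first by rewrite !expr0 !scale1r.
  by rewrite exprS -!scalerA hX IH.
have h0 : h 0 = 0 by apply: (addrI (h 0)); rewrite -hD !addr0.
have hR r (v : repmod rho) : h (r *: v) = r *: h v.
  rewrite (trunc_sum p_gt1 r) !scaler_suml (big_morph h hD h0).
  by apply: eq_bigr => i _; rewrite -(mulr_algl _ (s ^+ i)) -!scalerA hZ hXn.
have h_lin : linear (h : repmod rho -> N') by move=> r v w; rewrite hD hR.
exists (HB.pack_for {linear repmod rho -> N'} h
          (GRing.isLinear.Build R (repmod rho) N' *:%R h h_lin)) => v.
rewrite -[X in g X]/(h v) linear_sum /=.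
under eq_bigr do rewrite linearZ /= gl -linearZ /=.
rewrite -linear_sum; congr (f _); rewrite -[RHS](mul1mx (v : 'cV[K]_n)) -tE mulmx_suml.
by apply: eq_bigr => i _; rewrite -[LHS]/(rho (s ^+ i) *m _) rmorphXn /= !mulmxA.
Qed.

(** For a generalised inverse [t] of [u ^+ p.-1], the image of [t *m u ^+ p.-1 - 1%:M] lies in the
    kernel of [u ^+ p.-1], thus in the image of [u]; [nilp_split] turns this into the operator of
    Higman's criterion. *)
Lemma projective_exact :
  (forall v : 'cV[K]_n, rho s ^+ p.-1 *m v = 0 -> exists w, v = rho s *m w) ->
  projective (repmod rho).
Proof.
move=> ex; set u := rho s in ex *; have p0 : (0 < p)%N := ltnW p_gt1.
have up : u ^+ p = 0 by rewrite -rmorphXn truncXp // rmorph0.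
pose t := pinvmx (u ^+ p.-1).
have tK : u ^+ p.-1 *m t *m u ^+ p.-1 = u ^+ p.-1 by rewrite mulmxKpV.
have /choice[c cE] : forall j, exists w, col j (t *m u ^+ p.-1 - 1%:M) = u *m w.
  move=> j; apply: ex; rewrite colE mulmxA mulmxBr mulmx1 mulmxA tK subrr mul0mx.
  by [].
have tu : t * u ^+ p.-1 = 1 + u * (\matrix_(i, j) c j i 0).
  apply/eqP; rewrite addrC -subr_eq; apply/eqP/matrixP => i j.
  have := cE j => /colP/(_ i); rewrite [LHS]mxE => ->.
  by rewrite !mxE; apply: eq_bigr => l _; rewrite mxE.
have [t' t'E] := nilp_split p0 up tu; exact: (@projective_split t').
Qed.

(** The hypotheses describe a trivial direct summand. A lift of the functional [e] through K[t]/t^p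
    -> K would send [v] into the annihilator of t, where the augmentation is 0. *)
Lemma fixed_not_projective (e : 'rV[K]_n) (v : 'cV[K]_n) :
  e *m rho s = 0 -> rho s *m v = 0 -> e *m v != 0 -> ~ projective (repmod rho).
Proof.
move=> es sv ev prj.
pose N := along (trunc_eps_rm K p_gt1).
pose g (r : R^o) : N := trunc_eps r.
have g_lin : linear g.
  move=> r a b; rewrite /g; have := trunc_eps_lin 1 (r * a : R) b.
  by rewrite scale1r mul1r => ->; rewrite trunc_epsM.
pose gL := HB.pack_for {linear R^o -> N} g (GRing.isLinear.Build R R^o N *:%R g g_lin).
pose f (w : repmod rho) : N := (e *m (w : 'cV[K]_n)) 0 0.
have rhoE r : e *m rho r = trunc_eps r *: e.
  rewrite {1}(trunc_head p_gt1 r) rmorphD rmorphM rhoC mulmxDr /=.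
  by rewrite -[rho s * _]/(_ *m _) mulmxA es mul0mx addr0 mul_mx_scalar.
have f_lin : linear f.
  move=> r a b; rewrite /f mulmxDr mxE; congr (_ + _).
  by rewrite -[r *: a]/(rho r *m (a : 'cV[K]_n)) mulmxA rhoE -scalemxAl mxE.
pose fL := HB.pack_for {linear repmod rho -> N} f
  (GRing.isLinear.Build R (repmod rho) N *:%R f f_lin).
have g_surj (y : N) : exists r, gL r = y.
  exists ((y : K) *: (1 : R)); rewrite -[gL _]/(trunc_eps _) -[_ *: _]addr0 trunc_eps_lin.
  by rewrite trunc_eps1 mulr1 /trunc_eps coef0 addr0.
have [h hE] := prj R^o N gL fL g_surj.
have hv : s * (h v : R) = 0.
  rewrite -[_ * _]/(s *: (h v : R^o)) -linearZ /= -[s *: _]/(rho s *m (v : 'cV[K]_n)) sv.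
  exact: linear0.
have := hE v; rewrite -[gL _]/(trunc_eps (h v : R)) -[fL v]/((e *m v) 0 0) /trunc_eps.
have -> : ((h v : R) : {poly K})`_0 = 0.
  by have := truncXM_coef p_gt1 (h v : R) p_gt1; rewrite hv coef0.
move=> ev0; move/negP: ev; apply; apply/eqP/matrixP => i j.
by rewrite !ord1 -ev0 mxE.
Qed.
End ProjectiveCriterion.

(** * Tensors over a field extension and convolution operators *)

Section SemilinearTensors.
Variables (k K : fieldType) (iota : {rmorphism k -> K}) (A : vectType k).
Variable W : lmodType K.
Implicit Types (X Y : tens A A) (f : A -> A -> W).

Definition slinear (V : lmodType k) (f : V -> W) :=
  forall c a b, f (c *: a + b) = iota c *: f a + f b.

Lemma slinear_sum (V : lmodType k) (f : V -> W) (I : finType) (c : I -> k) (a : I -> V) :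
  slinear f -> f (\sum_i c i *: a i) = \sum_i iota (c i) *: f (a i).
Proof.
move=> fl; have f0 : f 0 = 0.
  by apply: (addrI (f 0)); rewrite addr0 -{1}[f 0]scale1r -(rmorph1 iota) -fl scaler0 addr0.
by elim/big_rec2: _ => // i y1 y2 _ <-; rewrite fl.
Qed.

Definition slift f X : W := \sum_i \sum_j iota (X i j) *: f (evec i) (evec j).

Definition sbilinear f := (forall b, slinear (f^~ b)) /\ (forall a, slinear (f a)).

Lemma evecE (a : A) : a = \sum_i coord (vbasis {:A}) i a *: evec i.
Proof. by rewrite {1}(coord_vbasis (memvf a)). Qed.

Lemma slift_linear f : slinear (slift f).
Proof.
move=> c X Y; rewrite /slift scaler_sumr -big_split; apply: eq_bigr => i _ /=.
rewrite scaler_sumr -big_split; apply: eq_bigr => j _ /=.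
by rewrite !mxE rmorphD rmorphM scalerDl scalerA.
Qed.

Lemma slift_tprod f a b : sbilinear f -> slift f (tprod a b) = f a b.
Proof.
move=> [fl fr]; rewrite [in RHS](evecE a) (slinear_sum _ _ (fl b)); apply: eq_bigr => i _.
rewrite [in RHS](evecE b) (slinear_sum _ _ (fr (evec i))) scaler_sumr.
by apply: eq_bigr => j _; rewrite mxE rmorphM scalerA.
Qed.

Lemma slinear_tlift (V : lmodType k) (h : V -> W) (g : A -> A -> V) X : slinear h ->
  h (tlift g X) = slift (fun a b => h (g a b)) X.
Proof.
move=> hl; have h0 : h 0 = 0.
  by apply: (addrI (h 0)); rewrite addr0 -{1}[h 0]scale1r -(rmorph1 iota) -hl scaler0 addr0.
have D v w : h (v + w) = h v + h w by have := hl 1 v w; rewrite scale1r rmorph1 scale1r.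
rewrite /tlift (big_morph _ D h0); apply: eq_bigr => i _.
rewrite (big_morph _ D h0); apply: eq_bigr => j _.
by rewrite -[_ *: _]addr0 hl h0 addr0.
Qed.

Lemma eq_slift f g X : (forall a b, f a b = g a b) -> slift f X = slift g X.
Proof. by move=> fg; apply: eq_bigr => i _; apply: eq_bigr => j _; rewrite fg. Qed.

End SemilinearTensors.

Lemma slift_morph (k K : fieldType) (iota : {rmorphism k -> K}) (A : vectType k)
    (W W' : lmodType K) (h : W -> W') (f : A -> A -> W) X :
  linear h -> h (slift iota f X) = slift iota (fun a b => h (f a b)) X.
Proof.
move=> hl; pose H := HB.pack_for {linear W -> W'} h (GRing.isLinear.Build K W W' *:%R h hl).
rewrite -[h _]/(H _) linear_sum; apply: eq_bigr => i _.
by rewrite linear_sum; apply: eq_bigr => j _; rewrite linearZ.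
Qed.

Section BilinearTensors.
Variables (k : fieldType) (V W : vectType k).

Lemma tlift_linear (P : lmodType k) (f : V -> W -> P) : linear (tlift f).
Proof.
move=> c X Y; rewrite /tlift scaler_sumr -big_split; apply: eq_bigr => i _ /=.
rewrite scaler_sumr -big_split; apply: eq_bigr => j _ /=.
by rewrite !mxE scalerDl scalerA.
Qed.

HB.instance Definition _ (P : lmodType k) (f : V -> W -> P) :=
  GRing.isLinear.Build k (tens V W) P *:%R (tlift f) (tlift_linear f).

Lemma tlift_tprod (P : lmodType k) (f : V -> W -> P) a b :
  (forall b, linear (f^~ b)) -> (forall a, linear (f a)) -> tlift f (tprod a b) = f a b.
Proof.
move=> fl fr.
have suml (h : V -> P) (I : finType) (c : I -> k) (e : I -> V) : linear h ->
    h (\sum_i c i *: e i) = \sum_i c i *: h (e i).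
  by move=> hl; apply: (@slinear_sum k k idfun P V h I c e).
have sumr (h : W -> P) (I : finType) (c : I -> k) (e : I -> W) : linear h ->
    h (\sum_i c i *: e i) = \sum_i c i *: h (e i).
  by move=> hl; apply: (@slinear_sum k k idfun P W h I c e).
rewrite [in RHS](evecE a) (suml (f^~ b)) //; apply: eq_bigr => i _.
rewrite [in RHS](evecE b) sumr // scaler_sumr.
by apply: eq_bigr => j _; rewrite mxE scalerA.
Qed.

Lemma tprod_linearl (w : W) : linear (@tprod k V W ^~ w).
Proof. by move=> c a b; apply/matrixP => i j; rewrite !mxE linearP mulrDl mulrA. Qed.

Lemma tprod_linearr (v : V) : linear (@tprod k V W v).
Proof. by move=> c a b; apply/matrixP => i j; rewrite !mxE linearP mulrDr mulrCA. Qed.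

End BilinearTensors.

Lemma tmul_tprod (k : fieldType) (A : falgType k) (a b c d : A) :
  tmul (tprod a b) (tprod c d) = tprod (a * c) (b * d).
Proof.
have El a0 b0 : tlift (fun c d => tprod (a0 * c) (b0 * d)) (tprod c d) = tprod (a0 * c) (b0 * d).
  rewrite tlift_tprod // => [y|x] e u v; rewrite mulrDr -scalerAr.
    exact: tprod_linearl.
  exact: tprod_linearr.
rewrite /tmul tlift_tprod ?El // => [y|x] e u v; rewrite !El mulrDl -scalerAl.
  exact: tprod_linearl.
exact: tprod_linearr.
Qed.

Lemma tmulDl (k : fieldType) (A : falgType k) (X Y Z : tens A A) :
  tmul (X + Y) Z = tmul X Z + tmul Y Z.
Proof. by rewrite /tmul linearD. Qed.

Section Convolution.
Variables (k : fieldType) (A : falgType k) (eps : {lrmorphism A -> k^o}) (H : hopf eps).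
Variables (K : fieldType) (iota : {rmorphism k -> K}).
Local Notation AK := (bc iota A).
Implicit Types (l : AK -> K).
Local Notation "a %:K" := (bc_in iota a) (at level 2, format "a %:K").

(** The operator (l (x) id) o Delta on A_K, written with [comult] over [k] so that the Hopf axioms
    of A apply directly; [conv_comult] compares it with the extended comultiplication. *)
Definition conv l (u : AK) : AK :=
  bc_lift (fun a => slift iota (fun c d => l c%:K *: d%:K) (comult H a)) u.

Lemma conv_linear l : linear (conv l).
Proof. exact: bc_lift_linear. Qed.

HB.instance Definition _ l :=
  GRing.isLinear.Build K AK AK *:%R (conv l) (conv_linear l).

Lemma conv_in l a : conv l a%:K = slift iota (fun c d => l c%:K *: d%:K) (comult H a).
Proof. by rewrite /conv bc_liftK // => c x y; rewrite comult_linear slift_linear. Qed.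

Lemma conv_sbilinear l : linear (l : AK -> K^o) ->
  sbilinear iota (fun c d : A => l c%:K *: d%:K).
Proof.
move=> ll; split=> [b|a] c x y; rewrite bc_in_linear.
  by rewrite (ll (iota c)) scalerDl scalerA.
by rewrite scalerDr !scalerA mulrC.
Qed.

Lemma conv_comult l u : linear (l : AK -> K^o) ->
  conv l u = tlift (fun v w => l v *: w) (bc_comult H u).
Proof.
move=> ll; have E v w : tlift (fun v w => l v *: w) (tprod v w) = l v *: w :> AK.
  rewrite tlift_tprod // => [b|a] c x y; first by rewrite (ll c) scalerDl scalerA.
  by rewrite scalerDr !scalerA mulrC.
have cE a : bc_comult H a%:K = slift iota (fun c d => tprod c%:K d%:K) (comult H a).
  by rewrite /bc_comult bc_liftK // => c x y; rewrite comult_linear;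
      exact: (slift_linear iota (fun c d => tprod c%:K d%:K)).
move: u; apply: bc_eq => [|c x y|a]; first exact: conv_linear.
  by rewrite /bc_comult linearP linearP.
rewrite conv_in cE slift_morph; last exact: tlift_linear.
by apply: eq_slift => c d; rewrite E.
Qed.

Lemma conv_sub l (B : {vspace AK}) b : linear (l : AK -> K^o) ->
  hopf_sub H B -> b \in B -> conv l b \in B.
Proof.
move=> ll [_ _ BB _] /BB; rewrite conv_comult //; move: (bc_comult _ b) => X.
pose h := linfun (tlift (fun v w => l v *: w : AK)).
suff /subvP sub : (tensv B B <= h @^-1: B)%VS by move/sub; rewrite -memv_preim lfunE.
apply/span_subvP => _ /allpairsP[[u w] /= [uB wB ->]].
rewrite -memv_preim lfunE /= tlift_tprod => [|b0 c x y|a c x y].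
- by rewrite memvZ // vbasis_mem.
- by rewrite (ll c) scalerDl scalerA.
by rewrite scalerDr !scalerA mulrC.
Qed.

Lemma conv1 l : linear (l : AK -> K^o) -> conv l 1 = l 1 *: 1.
Proof.
move=> ll; rewrite -[1 in LHS]/(1%:K) conv_in comult1 slift_tprod //.
exact: conv_sbilinear.
Qed.

(** In Delta(g u) = (g (x) 1 + 1 (x) g) Delta(u) the first summand changes the functional and the
    second one multiplies outside. *)
Lemma conv_mul l (g : A) u : linear (l : AK -> K^o) ->
  comult H g = tprod g 1 + tprod 1 g ->
  conv l (g%:K * u) = conv (fun v => l (g%:K * v)) u + g%:K * conv l u.
Proof.
move=> ll gp; move: u; apply: bc_eq => [c x y|c x y|a].
- by rewrite mulrDr -scalerAr linearP.
- by rewrite !linearP mulrDr -scalerAr scalerDr addrACA.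
rewrite -[_ * _]/(bc_mul _ _) bc_mulE !conv_in comultM gp tmulDl /tmul.
have sl := slift_linear iota (fun c d => l c%:K *: d%:K).
have := sl 1 (tlift (fun a0 b => tlift (fun c d => tprod (a0 * c) (b * d)) (comult H a)) (tprod g 1))
 (tlift (fun a0 b => tlift (fun c d => tprod (a0 * c) (b * d)) (comult H a)) (tprod 1 g)).
have E a0 b0 : tlift (fun a1 b1 => tlift (fun c d => tprod (a1 * c) (b1 * d)) (comult H a)) (tprod a0 b0)
   = tlift (fun c d => tprod (a0 * c) (b0 * d)) (comult H a).
  rewrite tlift_tprod // => [y|x] e u v.
    rewrite /tlift scaler_sumr -big_split; apply: eq_bigr => i _.
    rewrite scaler_sumr -big_split; apply: eq_bigr => j _ /=.
    by rewrite mulrDl -scalerAl tprod_linearl scalerDr !scalerA mulrC.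
  rewrite /tlift scaler_sumr -big_split; apply: eq_bigr => i _.
  rewrite scaler_sumr -big_split; apply: eq_bigr => j _ /=.
  by rewrite mulrDl -scalerAl tprod_linearr scalerDr !scalerA mulrC.
rewrite rmorph1 !scale1r !E !(slinear_tlift _ _ sl) => ->; congr (_ + _).
  apply: eq_slift => c d; rewrite mul1r slift_tprod //; last exact: conv_sbilinear.
  by rewrite -[_ * _ in RHS]/(bc_mul _ _) bc_mulE.
rewrite (@slift_morph _ _ _ _ _ _ ( *%R g%:K)); last by move=> c x y; rewrite mulrDr -scalerAr.
apply: eq_slift => c d; rewrite mul1r slift_tprod //; last exact: conv_sbilinear.
by rewrite -scalerAr -[_ * _ in RHS]/(bc_mul _ _) bc_mulE.
Qed.

Lemma conv_counit l u : (forall a, l a%:K = iota (eps a)) -> conv l u = u.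
Proof.
move=> le; move: u; apply: bc_eq => [|//|a]; first exact: conv_linear.
rewrite conv_in -[in RHS](counitl H a) (slinear_tlift _ _ (@bc_in_linear _ _ iota A)).
apply: eq_slift => c d; rewrite le -[eps c *: d]addr0 bc_in_linear.
by rewrite (_ : bc_in _ 0 = 0) ?addr0 //; apply/rowP => i; rewrite !mxE linear0 rmorph0.
Qed.

Lemma conv_lin c l l' u : conv (fun v => c * l v + l' v) u = c *: conv l u + conv l' u.
Proof.
rewrite /conv /bc_lift scaler_sumr -big_split; apply: eq_bigr => i _ /=.
rewrite scalerA mulrC -scalerA -scalerDr; congr (_ *: _).
rewrite /slift scaler_sumr -big_split; apply: eq_bigr => a _ /=.
rewrite scaler_sumr -big_split; apply: eq_bigr => b _ /=.
by rewrite scalerDl scalerDr !scalerA mulrCA mulrA.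
Qed.

Lemma eq_conv l l' : l =1 l' -> conv l =1 conv l'.
Proof. by move=> /funext ->. Qed.

End Convolution.

(** * Coordinates on ordered monomials and partial derivatives *)

Section Coordinates.
Variables (F : fieldType) (A : falgType F) (p : nat) (c : F) (W E Z : A).
Hypothesis p_gt1 : (1 < p)%N.
Hypothesis heis : heis_triple p c W E Z.
Hypothesis gen : left_generates W E Z.
Hypothesis dimA : \dim {:A} = (p ^ 3)%N.

Definition in_box (t : nat * nat * nat) := [&& t.1.1 < p, t.1.2 < p & t.2 < p]%N.

(** Coordinates are indexed by all triples of naturals and vanish outside the box, so that exponents
    can be shifted without carrying bounds. *)
Lemma pbw_coordinates : exists cf : nat * nat * nat -> {scalar A},
  [/\ forall a, a = \sum_(s : 'I_p * 'I_p * 'I_p) cf (ords s) a *: pbw W E Z (ords s),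
      forall t s, cf t (pbw W E Z s) = (in_box s && (s == t))%:R
    & forall t, ~~ in_box t -> forall a, cf t a = 0].
Proof.
have [co coE coD] := pbw_frame heis gen dimA.
pose f (t : nat * nat * nat) a : F := \sum_s co s a * (ords s == t)%:R.
have f_lin t : linear (f t : A -> F^o).
  move=> e a b; rewrite /f scaler_sumr -big_split; apply: eq_bigr => s _ /=.
  by rewrite linearP mulrDl -mulrA.
pose cf t : {scalar A} := HB.pack_for {scalar A} (f t)
  (GRing.isLinear.Build F A F^o *:%R (f t) (f_lin t)).
have ords_inj : injective (@ords p).
  move=> [[i j] l] [[i' j'] l'] [] /= /val_inj -> /val_inj -> /val_inj -> //.
have cf_ords s a : cf (ords s) a = co s a.
  rewrite -[LHS]/(f _ _) /f (bigD1 s) //= eqxx mulr1 big1 ?addr0 // => s' ss'.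
  by rewrite (inj_eq ords_inj) (negPf ss') mulr0.
have box_ords s : in_box (@ords p s) by case: s => [[i j] l]; rewrite /in_box /= !ltn_ord.
have ordsE t : in_box t -> exists s : 'I_p * 'I_p * 'I_p, t = ords s.
  case: t => [[i j] l] /and3P[/= ip jp lp].
  by exists (Ordinal ip, Ordinal jp, Ordinal lp).
have cf_out t a : ~~ in_box t -> cf t a = 0.
  move=> tp; rewrite -[LHS]/(f _ _) /f big1 // => s _.
  by case: eqP tp => [<-|]; rewrite ?box_ords ?mulr0.
exists cf; split=> [a|t s|t tp a].
- by rewrite {1}(coE a); apply: eq_bigr => s _; rewrite cf_ords.
- have [sb|sb] := boolP (in_box s); last first.
    by rewrite (pbw_big heis) ?linear0 //; move: sb; rewrite /in_box; lia.
  have [s' ->] := ordsE s sb; rewrite -[LHS]/(f _ _) /f (bigD1 s') //= coD eqxx mul1r.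
  by rewrite big1 ?addr0 // => r rs; rewrite coD (negPf rs) mul0r.
exact: cf_out.
Qed.

Variable cf : nat * nat * nat -> {scalar A}.
Hypothesis cfE : forall a, a = \sum_(s : 'I_p * 'I_p * 'I_p) cf (ords s) a *: pbw W E Z (ords s).
Hypothesis cf_pbw : forall t s, cf t (pbw W E Z s) = (in_box s && (s == t))%:R.
Hypothesis cf_out : forall t, ~~ in_box t -> forall a, cf t a = 0.

Lemma box_ords s : in_box (@ords p s).
Proof. by case: s => [[i j] l]; rewrite /in_box /= !ltn_ord. Qed.

Lemma pbw_ext (V : lmodType F) (f g : A -> V) : linear f -> linear g ->
  (forall s, in_box s -> f (pbw W E Z s) = g (pbw W E Z s)) -> f =1 g.
Proof.
move=> fl gl fg a.
pose f' := HB.pack_for {linear A -> V} f (GRing.isLinear.Build F A V *:%R f fl).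
pose g' := HB.pack_for {linear A -> V} g (GRing.isLinear.Build F A V *:%R g gl).
rewrite -[f a]/(f' a) -[g a]/(g' a) (cfE a) !linear_sum; apply: eq_bigr => s _.
by rewrite !linearZ -[f' _]/(f _) -[g' _]/(g _) fg ?box_ords.
Qed.

Lemma tripleE (i j l i' j' l' : nat) :
  ((i, j, l) == (i', j', l')) = [&& i == i', j == j' & l == l'].
Proof. by rewrite -!pair_eqE /pair_eq /= andbA. Qed.

(** The rule for [E] is demanded only on monomials without [W]. For the operator dual to [Z], the
    relation [E * W = W * E - Z] adds to it minus the derivative along [W], which vanishes exactly
    on those monomials. *)
Lemma deriv_pbw (D : A -> A) (aW aE aZ : F) : D 1 = 0 ->
  (forall m, D (W * m) = aW *: m + W * D m) ->
  (forall j l, D (E * (E ^+ j * Z ^+ l)) =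
     aE *: (E ^+ j * Z ^+ l) + E * D (E ^+ j * Z ^+ l)) ->
  (forall m, D (Z * m) = aZ *: m + Z * D m) ->
  forall i j l, D (pbw W E Z (i, j, l)) =
    (i%:R * aW) *: pbw W E Z (i.-1, j, l) + (j%:R * aE) *: pbw W E Z (i, j.-1, l)
    + (l%:R * aZ) *: pbw W E Z (i, j, l.-1).
Proof.
move=> D1 DW DE DZ i j l; rewrite /pbw /=.
have EZ : D (Z ^+ l) = (l%:R * aZ) *: Z ^+ l.-1.
  elim: l => [|l IH]; first by rewrite D1 mul0r scale0r.
  rewrite exprS DZ IH -scalerAr /=; case: l {IH} => [|l] /=.
    by rewrite mul0r scale0r addr0 !(mulr1n, mul1r).
  by rewrite -exprS -scalerDl -[l.+2%:R]natr1 mulrDl mul1r addrC.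
have EE : D (E ^+ j * Z ^+ l) = (j%:R * aE) *: (E ^+ j.-1 * Z ^+ l)
    + (l%:R * aZ) *: (E ^+ j * Z ^+ l.-1).
  elim: j => [|j IH]; first by rewrite !expr0 !mul1r EZ mul0r scale0r add0r.
  rewrite exprS -mulrA DE IH mulrDr -!scalerAr addrA !mulrA -(exprS E j); congr (_ + _).
  case: j {IH} => [|j] /=; first by rewrite mul0r scale0r addr0 !(mulr1n, mul1r).
  by rewrite -exprS -scalerDl -[j.+2%:R]natr1 mulrDl mul1r addrC.
elim: i => [|i IH]; first by rewrite !expr0 !mul1r mul0r scale0r add0r EE.
rewrite exprS -!mulrA DW !mulrA in IH *; rewrite IH !mulrDr -!scalerAr !addrA !mulrA -!(exprS W i).
congr (_ + _ + _); case: i {IH} => [|i] /=; first by rewrite mul0r scale0r addr0 !(mulr1n, mul1r).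
by rewrite -exprS -scalerDl -[i.+2%:R]natr1 mulrDl mul1r addrC.
Qed.

End Coordinates.

Section Directions.
Implicit Types (t : nat * nat * nat) (d : nat).

Definition entry d t : nat := match d with 0 => t.1.1 | 1 => t.1.2 | _ => t.2 end.

Definition bump_dir d t : nat * nat * nat :=
  match d with
  | 0 => (t.1.1.+1, t.1.2, t.2)
  | 1 => (t.1.1, t.1.2.+1, t.2)
  | _ => (t.1.1, t.1.2, t.2.+1)
  end.

Definition drop_dir d t : nat * nat * nat :=
  match d with
  | 0 => (t.1.1.-1, t.1.2, t.2)
  | 1 => (t.1.1, t.1.2.-1, t.2)
  | _ => (t.1.1, t.1.2, t.2.-1)
  end.

Definition weight t : nat := (t.1.1 + t.1.2 + t.2)%N.

Lemma dir_ind (P : nat -> Prop) : P 0%N -> P 1%N -> P 2%N -> forall d, (d < 3)%N -> P d.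
Proof. by move=> P0 P1 P2 [|[|[|]]]. Qed.

Lemma tripleE_dir i j : (i < 3)%N -> (j < 3)%N -> i != j ->
  (bump_dir i (0, 0, 0)%N == bump_dir j (0, 0, 0)%N) = false.
Proof. by case: i j => [|[|[|]]] // [|[|[|]]]. Qed.

End Directions.

(* [conv l] stands for the operator [(l (x) id) o Delta]: as the generators are
   primitive, it acts on the monomials [W^i E^j Z^l] as a partial derivative
   when [l] is the coordinate of a generator. *)
Section StableSubalgebra.
Variables (F : fieldType) (A : falgType F) (p : nat) (W E Z : A).
Hypothesis charp : p \in [pchar F].
Hypothesis heis : heis_triple p 1 W E Z.
Variable cf : nat * nat * nat -> {scalar A}.
Hypothesis cfE : forall a, a = \sum_(s : 'I_p * 'I_p * 'I_p) cf (ords s) a *: pbw W E Z (ords s).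
Hypothesis cf_pbw : forall t s, cf t (pbw W E Z s) = (in_box p s && (s == t))%:R.
Hypothesis cf_out : forall t, ~~ in_box p t -> forall a, cf t a = 0.
Variable conv : (A -> F) -> A -> A.
Hypothesis conv_linear : forall l, linear (conv l).
Hypothesis conv1 : forall l : {scalar A}, conv l 1 = l 1 *: 1.
Hypothesis conv_id : forall a, conv (cf (0, 0, 0)%N) a = a.
Hypothesis conv0 : forall a, conv (fun=> 0) a = 0.
Hypothesis convN : forall (l : {scalar A}) a, conv (fun b => - l b) a = - conv l a.
Definition primitive_for G := forall (l : {scalar A}) a,
  conv l (G * a) = conv (fun b => l (G * b)) a + G * conv l a.
Hypotheses (primW : primitive_for W) (primE : primitive_for E) (primZ : primitive_for Z).

Let p_gt1 : (1 < p)%N. Proof. by case/andP: charp => /prime_gt1. Qed.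

Definition gen_dir d : A := match d with 0 => W | 1 => E | _ => Z end.
Local Notation D d := (conv (cf (bump_dir d (0, 0, 0)%N))).

Lemma gen_dirE d : (d < 3)%N -> gen_dir d = pbw W E Z (bump_dir d (0, 0, 0)%N).
Proof.
by move: d; apply: dir_ind; rewrite /pbw /= ?expr0 ?expr1 ?mulr1 ?mul1r.
Qed.

Lemma cf_mul (t : nat * nat * nat) (G : A) (f : {scalar A}) :
  (forall s, in_box p s -> cf t (G * pbw W E Z s) = f (pbw W E Z s)) ->
  (fun a => cf t (G * a)) = f.
Proof.
move=> h; apply/funext; apply: (pbw_ext (V := F^o) cfE) => [e a b|e a b|s sb]; last exact: h.
  by rewrite mulrDr -scalerAr linearP.
by rewrite linearP.
Qed.

Let mulZ t : Z * pbw W E Z t = pbw W E Z (bump_dir 2 t).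
Proof. by case: t => [[i j] l]; rewrite (mulZ_pbw heis). Qed.

Let mulW t : W * pbw W E Z t = pbw W E Z (bump_dir 0 t).
Proof. by case: t => [[i j] l]; rewrite mulX_pbw. Qed.

Let mulE t : E * pbw W E Z t =
  pbw W E Z (bump_dir 1 t) - t.1.1%:R *: pbw W E Z (t.1.1.-1, t.1.2, t.2.+1).
Proof. by case: t => [[i j] l]; rewrite (mulY_pbw heis) mulr1. Qed.

Let cf_mulW0 : (fun a => cf (1, 0, 0)%N (W * a)) = cf (0, 0, 0)%N.
Proof.
apply: cf_mul => -[[i j] l] sb; rewrite mulW !cf_pbw !tripleE /=; congr (_%:R).
by move: sb p_gt1; rewrite /in_box /=; lia.
Qed.

Let zero_scalar : {scalar A} := HB.pack_for {scalar A} (fun _ : A => (0 : F))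
  (GRing.isLinear.Build F A F^o *:%R (fun _ : A => (0 : F^o))
     (fun e a b => esym (etrans (congr2 +%R (scaler0 _ e) erefl) (addr0 0)))).

Let cf_mul0 t G : (forall s, in_box p s -> cf t (G * pbw W E Z s) = 0) ->
  (fun a => cf t (G * a)) = (fun=> 0).
Proof. by move=> h; apply: (@cf_mul t G zero_scalar). Qed.

Let cf_mulE0 : (fun a => cf (1, 0, 0)%N (E * a)) = (fun=> 0).
Proof.
apply: cf_mul0 => -[[i j] l] sb; rewrite mulE linearB linearZ /= !cf_pbw !tripleE /=.
by rewrite !andbF mulr0 subr0.
Qed.

Let cf_mulZ0 : (fun a => cf (1, 0, 0)%N (Z * a)) = (fun=> 0).
Proof.
by apply: cf_mul0 => -[[i j] l] sb; rewrite mulZ !cf_pbw !tripleE /= !andbF.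
Qed.

Let cf_mulW1 : (fun a => cf (0, 1, 0)%N (W * a)) = (fun=> 0).
Proof.
by apply: cf_mul0 => -[[i j] l] sb; rewrite mulW !cf_pbw !tripleE /= !andbF.
Qed.

Let cf_mulE1 : (fun a => cf (0, 1, 0)%N (E * a)) = cf (0, 0, 0)%N.
Proof.
apply: cf_mul => -[[i j] l] sb; rewrite mulE linearB linearZ /= !cf_pbw !tripleE /=.
rewrite !andbF mulr0 subr0; congr (_%:R).
by move: sb p_gt1; rewrite /in_box /=; lia.
Qed.

Let cf_mulZ1 : (fun a => cf (0, 1, 0)%N (Z * a)) = (fun=> 0).
Proof.
by apply: cf_mul0 => -[[i j] l] sb; rewrite mulZ !cf_pbw !tripleE /= !andbF.
Qed.

Let cf_mulW2 : (fun a => cf (0, 0, 1)%N (W * a)) = (fun=> 0).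
Proof.
by apply: cf_mul0 => -[[i j] l] sb; rewrite mulW !cf_pbw !tripleE /= !andbF.
Qed.

Let cf_mulZ2 : (fun a => cf (0, 0, 1)%N (Z * a)) = cf (0, 0, 0)%N.
Proof.
apply: cf_mul => -[[i j] l] sb; rewrite mulZ !cf_pbw !tripleE /=; congr (_%:R).
by move: sb p_gt1; rewrite /in_box /=; lia.
Qed.

Let cf_mulE2 a : cf (0, 0, 1)%N (E * a) = - cf (1, 0, 0)%N a.
Proof.
move: a; apply: (pbw_ext (V := F^o) cfE) => [e a b|e a b|[[i j] l] sb].
- by rewrite mulrDr -scalerAr linearP.
- by rewrite linearP opprD scalerN.
rewrite mulE linearB linearZ /= !cf_pbw !tripleE /= !andbF sub0r; congr (- _).
case: i sb => [|i] sb; first by rewrite mul0r andbF.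
rewrite /=; have -> : in_box p (i, j, l.+1) && [&& i == 0, j == 0 & l.+1 == 1] =
    in_box p (i.+1, j, l) && [&& i.+1 == 1, j == 0 & l == 0] :> bool.
  by move: sb p_gt1; rewrite /in_box /=; lia.
by case: i {sb} => [|i]; rewrite ?mul1r // !andbF mulr0.
Qed.

Let D0 d : (d < 3)%N -> D d 1 = 0.
Proof.
have one : 1 = pbw W E Z (0, 0, 0)%N by rewrite /pbw !expr0 !mulr1.
move=> d3; rewrite conv1 [X in cf _ X]one cf_pbw.
by move: d d3; apply: dir_ind; rewrite !tripleE /= ?andbF scale0r.
Qed.

Lemma conv_dir_pbw d s : (d < 3)%N ->
  D d (pbw W E Z s) = (entry d s)%:R *: pbw W E Z (drop_dir d s).
Proof.
have PW : forall s, D 0 (pbw W E Z s) = (entry 0 s)%:R *: pbw W E Z (drop_dir 0 s).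
  move=> [[i j] l]; rewrite (@deriv_pbw F A W E Z _ 1 0 0) ?D0 // => [|m|j' l'|m].
  - by rewrite !mulr0 !scale0r !addr0 mulr1.
  - by rewrite primW cf_mulW0 conv_id scale1r.
  - by rewrite primE cf_mulE0 conv0 scale0r.
  - by rewrite primZ cf_mulZ0 conv0 scale0r.
move: d; apply: dir_ind => //.
  case: s => [[i j] l]; rewrite (@deriv_pbw F A W E Z _ 0 1 0) ?D0 // => [|m|j' l'|m].
  - by rewrite !mulr0 !scale0r addr0 add0r mulr1.
  - by rewrite primW cf_mulW1 conv0 scale0r.
  - by rewrite primE cf_mulE1 conv_id scale1r.
  - by rewrite primZ cf_mulZ1 conv0 scale0r.
case: s => [[i j] l]; rewrite (@deriv_pbw F A W E Z _ 0 0 1) ?D0 // => [|m|j' l'|m].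
- by rewrite !mulr0 !scale0r !add0r mulr1.
- by rewrite primW cf_mulW2 conv0 scale0r.
- rewrite primE (funext cf_mulE2) convN.
  have := PW (0, j', l')%N; rewrite {1}/pbw /= expr0 mul1r => ->.
  by rewrite scale0r oppr0 add0r scale0r add0r.
- by rewrite primZ cf_mulZ2 conv_id scale1r.
Qed.

Lemma cf_conv_dir d t a : (d < 3)%N -> cf t (D d a) = (entry d t).+1%:R * cf (bump_dir d t) a.
Proof.
move=> d3; move: a; apply: (pbw_ext (V := F^o) cfE) => [e a b|e a b|s sb].
- by rewrite conv_linear linearP.
- by rewrite linearP mulrDr; congr (_ + _); exact: mulrCA.
rewrite conv_dir_pbw // linearZ /= !cf_pbw sb /=.
case: s t sb => [[i j] l] [[i' j'] l'] sb.
have M (n n' : nat) (b b' : bool) : (n * b = n' * b')%N -> n%:R * b%:R = n'%:R * b'%:R :> F.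
  by move=> nb; rewrite -!natrM nb.
by apply: M; move: d d3; apply: dir_ind; rewrite /= !tripleE; move: sb; rewrite /in_box /=; lia.
Qed.

(** The hypothesis on [e] says that a generator outside [B] does not occur in the linear elements of
    [B]. Derivatives that keep such a generator reduce any coefficient involving it to one of weight
    1. *)
Lemma stable_subalgebra (B : {vspace A}) : 1 \in B ->
  (forall a b, a \in B -> b \in B -> a * b \in B) ->
  (forall d b, (d < 3)%N -> b \in B -> D d b \in B) ->
  (forall e : nat -> F, \sum_(d < 3) e d *: gen_dir d \in B ->
     forall d, (d < 3)%N -> gen_dir d \notin B -> e d = 0) ->
  forall b d t, b \in B -> (d < 3)%N -> gen_dir d \notin B -> (0 < entry d t)%N -> cf t b = 0.
Proof.
move=> B1 BM BD Bgen b; suff: forall n b d t, b \in B -> (d < 3)%N -> gen_dir d \notin B ->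
    (0 < entry d t)%N -> (forall s, (n <= weight s)%N -> cf s b = 0) -> cf t b = 0.
  (* Exponents in the box are below p, so no monomial in it reaches weight [3 * p]. *)
  move=> IH d t bB d3 dB dt; apply: (IH (3 * p)%N b d t) => // s sw; apply: cf_out.
  by move: sw; rewrite /weight /in_box; lia.
elim=> [|n IH] {}b d t bB d3 dB dt bn; first exact: bn.
have char0 m : (0 < m < p)%N -> m%:R != 0 :> F.
  by move=> /andP[m0 mp]; rewrite -(dvdn_pcharf charp) gtnNdvd.
(* A direction [j] is chosen in which [s] can be lowered without losing its entry in direction [i].
   Up to a factor prime to p, the coefficient is then one of the derivative of [b] along [j], to
   which the induction hypothesis applies. *)
have low i s : (i < 3)%N -> gen_dir i \notin B -> (0 < entry i s)%N ->
    (1 < weight s)%N -> cf s b = 0.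
  move=> i3 iB is0 s1; have [sb|/cf_out //] := boolP (in_box p s).
  have [j [s' [j3 sE s'i]]] : exists j s', [/\ (j < 3)%N, s = bump_dir j s' & (0 < entry i s')%N].
    have ok j : [&& j < 3, 0 < entry j s & 0 < entry i (drop_dir j s)]%N ->
        exists j s', [/\ (j < 3)%N, s = bump_dir j s' & (0 < entry i s')%N].
      move=> /and3P[j3 js jis]; exists j, (drop_dir j s); split=> //.
      by move: j j3 js {jis}; apply: dir_ind; case: s {sb is0 s1} => [[s0 s1] s2] /=;
        move=> pos; rewrite prednK.
    suff /or3P[] : [|| [&& 0 < 3, 0 < entry 0 s & 0 < entry i (drop_dir 0 s)],
        [&& 1 < 3, 0 < entry 1 s & 0 < entry i (drop_dir 1 s)]
      | [&& 2 < 3, 0 < entry 2 s & 0 < entry i (drop_dir 2 s)]]%N by exact: ok.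
    by move: s1 is0; rewrite /weight; move: i i3 {iB ok}; apply: dir_ind => /=; lia.
  have E0 := cf_conv_dir s' b j3.
  have low_deg s'' : (n <= weight s'')%N -> cf s'' (D j b) = 0.
    move=> sn; rewrite cf_conv_dir // bn ?mulr0 //; move: sn; move: j j3 {sE E0}.
    by apply: dir_ind; rewrite /weight /=; lia.
  rewrite (IH _ _ _ (BD _ _ j3 bB) i3 iB s'i low_deg) in E0.
  apply/eqP; move/esym/eqP: E0; rewrite mulf_eq0 -sE => /orP[|//].
  rewrite (negPf (char0 _ _)) //; move: sb; rewrite sE.
  by move: j j3 {sE low_deg}; apply: dir_ind; rewrite /in_box /=; lia.
have [w1|w1] := ltnP 1 (weight t); first exact: (low d).
(* Weight 1 is out of reach of derivatives. Once the linear part of [b] on generators outside [B] is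
   removed, a combination of products of generators in [B] is left; hence that linear part lies in
   [B]. *)
pose e i := if gen_dir i \in B then 0 else cf (bump_dir i (0, 0, 0)%N) b.
have e0 s : cf s (b - \sum_(i < 3) e i *: gen_dir i) =
    cf s b - \sum_(i < 3) e i * (s == bump_dir i (0, 0, 0)%N)%:R.
  rewrite linearB linear_sum; congr (_ - _); apply: eq_bigr => -[i i3] _ /=.
  rewrite linearZ /= gen_dirE // cf_pbw [_ == s]eq_sym; congr (_ * (nat_of_bool _)%:R).
  by move: i i3; apply: dir_ind; rewrite /in_box /= ?p_gt1 (ltnW p_gt1).
have dt1 i s : (i < 3)%N -> (0 < entry i s)%N -> (weight s <= 1)%N ->
    s = bump_dir i (0, 0, 0)%N.
  case: s => [[s0 s1] s2]; rewrite /weight; move: i.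
  by apply: dir_ind => /= pos w; congr (_, _, _); lia.
have sumE i : (i < 3)%N -> gen_dir i \notin B ->
    \sum_(j < 3) e j * (bump_dir i (0, 0, 0)%N == bump_dir j (0, 0, 0)%N)%:R =
    cf (bump_dir i (0, 0, 0)%N) b.
  move=> i3 iB; rewrite (bigD1 (Ordinal i3)) //= eqxx mulr1 /e (negPf iB) big1 ?addr0 //.
  move=> [j j3] ji; rewrite tripleE_dir //; last by rewrite eq_sym.
  by rewrite mulr0.
have in_B : b - \sum_(i < 3) e i *: gen_dir i \in B.
  rewrite (cfE (b - _)); apply: memv_suml => s _; move: (ords s) => {}s.
  have [|/hasPn sB] := boolP (has (fun i => (0 < entry i s)%N && (gen_dir i \notin B)) (iota 0 3)).
    case/hasP => i; rewrite mem_iota => /= i3 /andP[is0 iB].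
    have [s1|s1] := ltnP 1 (weight s).
      rewrite e0 (low i) // big1 ?subr0 ?scale0r ?mem0v // => -[j j3] _ /=.
      case: eqP => [sj|]; rewrite ?mulr0 //; move: s1; rewrite sj.
      by move: j j3 {sj}; apply: dir_ind.
    by rewrite e0 (dt1 i s) // sumE // subrr scale0r mem0v.
  have BX i : (i < 3)%N -> gen_dir i ^+ entry i s \in B.
    move=> i3; have := sB i; rewrite mem_iota /= => /(_ i3); rewrite negb_and negbK -eqn0Ngt.
    case/orP => [/eqP -> |iB]; first by rewrite expr0.
    by elim: (entry i s) => [|m mB]; rewrite ?expr0 ?exprS ?BM.
  by apply: memvZ; rewrite /pbw BM ?BM ?(BX 0%N) ?(BX 1%N) ?(BX 2%N).
have tE := dt1 d t d3 dt w1.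
have : \sum_(i < 3) e i *: gen_dir i \in B.
  by rewrite -[\sum_(i < 3) _](subKr b) memvB.
by move=> /Bgen/(_ d d3 dB); rewrite /e (negPf dB) tE.
Qed.

End StableSubalgebra.

(** * Commutative Hopf subalgebras of A_K *)

Section AdaptedTriple.
Variables (k : fieldType) (A : falgType k) (eps : {lrmorphism A -> k^o}) (H : hopf eps).
Variables (p : nat) (charp : p \in [pchar k]) (p_gt2 : (2 < p)%N) (X Y Z : A).
Hypothesis heis : heis_triple p 1 X Y Z.
Hypothesis gen : left_generates X Y Z.
Hypothesis dimA : \dim {:A} = (p ^ 3)%N.
Definition primitive_elt (g : A) := comult H g = tprod g 1 + tprod 1 g.
Hypotheses (primX : primitive_elt X) (primY : primitive_elt Y) (primZ : primitive_elt Z).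
Hypotheses (eX : eps X = 0) (eY : eps Y = 0) (eZ : eps Z = 0).
Variables (K : fieldType) (iota : {rmorphism k -> K}).
Local Notation AK := (bc iota A).
Local Notation "a %:K" := (bc_in iota a) (at level 2, format "a %:K").

Let p_gt1 : (1 < p)%N. Proof. exact: ltnW. Qed.

Lemma bc_heis_triple : heis_triple p 1 X%:K Y%:K Z%:K.
Proof.
case: heis => XY ZX ZY [Xp Yp Zp].
split; rewrite -?bc_inM -?bc_inX ?XY ?ZX ?ZY ?Xp ?Yp ?Zp ?bc_in0 //.
by rewrite bc_inD !scale1r.
Qed.

Lemma bc_left_generates : left_generates X%:K Y%:K Z%:K.
Proof.
move=> U U1 UP; have bcU a : a%:K \in U.
  have [co ->] := pbw_span heis gen a.
  rewrite (iota_linear_sum (@bc_in_linear _ _ iota A)); apply: memv_suml => t _.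
  apply: memvZ; case: (ords t) => [[i j] l]; rewrite /pbw /= !bc_inM !bc_inX -mulrA.
  have pw (G : AK) n w : (forall w, w \in U -> G * w \in U) -> w \in U -> G ^+ n * w \in U.
    by move=> GU wU; elim: n => [|n IH]; rewrite ?mul1r ?exprS -?mulrA ?GU.
  apply: (pw) => [w /UP[]//|]; apply: (pw) => [w /UP[]//|]; rewrite -[_ ^+ l]mulr1.
  by apply: (pw) => // w /UP[].
by move=> a; rewrite (bc_sum a); apply: memv_suml => i _; apply: memvZ.
Qed.

Lemma bc_dim : \dim {:AK} = (p ^ 3)%N.
Proof. by rewrite dimvf -dimA; exact: mul1n. Qed.

(** [E] is normalised so that the commutator of [W] and [E] is exactly [Z]; which of [X] and [Y]
    serves depends on the coefficient that is nonzero. *)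
Lemma triple_exchange a b c : (a != 0) || (b != 0) ->
  let W := a *: X%:K + b *: Y%:K + c *: Z%:K in
  let E := if a != 0 then a^-1 *: Y%:K else - b^-1 *: X%:K in
  heis_triple p 1 W E Z%:K /\ left_generates W E Z%:K.
Proof.
move=> ab W E.
have [XY ZX ZY [Xp Yp Zp]] := bc_heis_triple.
have charK : p \in [pchar K] by rewrite (fmorph_pchar iota).
have pth a' b' c' := heis_pth charK p_gt2 a' b' c' bc_heis_triple.
have ZW : Z%:K * W = W * Z%:K.
  by rewrite /W !mulrDr !mulrDl -!scalerAr -!scalerAl ZX ZY.
split; last first.
  move=> U U1 UP; apply: bc_left_generates => // w /UP[Ww Ew Zw].
  have XYw : (a *: X%:K + b *: Y%:K) * w \in U.
    have -> : a *: X%:K + b *: Y%:K = W - c *: Z%:K by rewrite /W addrK.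
    by rewrite mulrBl -scalerAl memvB ?memvZ.
  move: Ew XYw; rewrite /E; have [a0|a0] := eqVneq a 0 => /=.
    have b0 : b != 0 by move: ab; rewrite a0 eqxx.
    rewrite a0 scale0r add0r -!scalerAl => /(memvZ (- b)) + /(memvZ b^-1).
    by rewrite !scalerA mulrNN mulfV // mulVf // !scale1r.
  rewrite mulrDl -!scalerAl => /(memvZ a); rewrite scalerA mulfV // scale1r => Yw aXw.
  split=> //; have : a^-1 *: (a *: (X%:K * w) + b *: (Y%:K * w) - b *: (Y%:K * w)) \in U.
    by rewrite memvZ // memvB // memvZ.
  by rewrite addrK scalerA mulVf // scale1r.
have Ep : E ^+ p = 0 by rewrite /E; case: ifP => _; rewrite exprZn ?Xp ?Yp scaler0.
split=> //; last by split=> //; exact: pth.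
- rewrite scale1r /W /E; have [a0|a0] := eqVneq a 0 => /=.
    have b0 : b != 0 by move: ab; rewrite a0 eqxx.
    rewrite a0 scale0r add0r !mulrDl !mulrDr -!scalerAr -!scalerAl !scalerA.
    rewrite XY ZX scale1r scalerDr mulrN mulNr mulfV // mulVf // !scaleN1r.
    by rewrite mulrN mulNr (mulrC c) addrAC subrK.
  rewrite !mulrDl !mulrDr -!scalerAr -!scalerAl !scalerA XY ZY scale1r scalerDr.
  rewrite mulfV // mulVf // !scale1r (mulrC b) (mulrC c).
  by rewrite -!addrA; congr (_ + _); rewrite addrC -addrA.
- by rewrite /E; case: ifP => _; rewrite -scalerAr -scalerAl ?ZX ?ZY.
Qed.

Variable B : {aspace AK}.
Hypothesis hopfB : hopf_sub H B.
Hypothesis commB : {in B &, commutative *%R}.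

Local Notation cv := (conv H (K := K) (iota := iota)).

Lemma primitive_for_in (g : A) : primitive_elt g -> primitive_for cv g%:K.
Proof. by move=> gp l a; apply: conv_mul => // e u v; rewrite linearP. Qed.

Lemma primitive_for_comb e (G G' : AK) :
  primitive_for cv G -> primitive_for cv G' -> primitive_for cv (e *: G + G').
Proof.
move=> PG PG' l a; rewrite mulrDl -scalerAl conv_linear PG PG'.
have -> : (fun b => l ((e *: G + G') * b)) = (fun b => e * l (G * b) + l (G' * b)).
  by apply/funext => b; rewrite mulrDl -scalerAl linearP.
by rewrite conv_lin mulrDl -scalerAl scalerDr addrACA.
Qed.

Lemma conv0 u : cv (fun=> 0) u = 0.
Proof.
have := conv_lin H (-1) (fun=> 0 : K) (fun=> 0) u.
by rewrite scaleN1r addNr mulr0 addr0.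
Qed.

Lemma primitive_for0 : primitive_for cv 0.
Proof.
move=> l a; rewrite !mul0r linear0 addr0.
have -> : (fun b : AK => l (0 * b)) = (fun=> 0) by apply/funext => b; rewrite mul0r linear0.
by rewrite conv0.
Qed.

Lemma sub_span_pbw a b c : (a != 0) || (b != 0) ->
  let W := a *: X%:K + b *: Y%:K + c *: Z%:K in
  let E := if a != 0 then a^-1 *: Y%:K else - b^-1 *: X%:K in
  (forall e : nat -> K, \sum_(d < 3) e d *: gen_dir W E Z%:K d \in B ->
     forall d, (d < 3)%N -> gen_dir W E Z%:K d \notin B -> e d = 0) ->
  E \notin B -> forall u, u \in B ->
  exists f : 'I_p -> 'I_p -> K, u = \sum_i \sum_j f i j *: (W ^+ i * Z%:K ^+ j).
Proof.
move=> ab W E Bgen EB u uB; have [T g] := triple_exchange c ab; rewrite -/W -/E in T g.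
have charK : p \in [pchar K] by rewrite (fmorph_pchar iota).
have [cf [cfE cf_pbw cf_out]] := pbw_coordinates p_gt1 T g bc_dim.
have [B1 BB _ _] := hopfB.
have e0 a' : epsK eps (bc_in iota a') = iota (eps a') by exact: epsK_in.
have E0 : epsK eps (0 : AK) = 0 by rewrite -(bc_in0 iota) e0 linear0 rmorph0.
have eX' (v : AK) n : epsK eps (v ^+ n) = epsK eps v ^+ n.
  by elim: n => [|n IH]; [rewrite !expr0 epsK1 | rewrite !exprS epsKM IH].
have eW : epsK eps W = 0.
  rewrite /W -addrA -[c *: _]addr0 !epsK_lin !e0 eX eY eZ E0 rmorph0.
  by rewrite !mulr0 !addr0.
have eE : epsK eps E = 0.
  by rewrite /E -[if _ then _ else _]addr0; case: ifP => _; rewrite epsK_lin e0 ?eX ?eY E0 rmorph0 mulr0 addr0.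
(* The constant coordinate is the counit, so its convolution operator is the identity. *)
have cf0 : cf (0, 0, 0)%N =1 epsK eps (iota := iota).
  apply: (pbw_ext (V := K^o) cfE) => [e v w|e v w|[[i j] l] sb].
  - by rewrite linearP.
  - by rewrite epsK_lin.
  rewrite cf_pbw sb tripleE /pbw /= !epsKM !eX' eW eE e0 eZ rmorph0 !expr0n -!natrM !mulnb.
  by rewrite andbA.
have pW : primitive_for cv W.
  rewrite /W -addrA; apply: primitive_for_comb; first exact: primitive_for_in.
  apply: primitive_for_comb; first exact: primitive_for_in.
  rewrite -[_ *: _]addr0; apply: primitive_for_comb; first exact: primitive_for_in.
  exact: primitive_for0.
have pE : primitive_for cv E.
  rewrite /E -[if _ then _ else _]addr0; case: ifP => _.
    by apply: primitive_for_comb; [exact: primitive_for_in | exact: primitive_for0].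
  by apply: primitive_for_comb; [exact: primitive_for_in | exact: primitive_for0].
have S := @stable_subalgebra K AK p W E Z%:K charK T cf cfE cf_pbw cf_out cv
  (@conv_linear _ _ _ H _ iota).
have {S} zero := S
  (fun l => conv1 H (fun e v w => linearP l e v w))
  (fun v => etrans (eq_conv H cf0 v) (conv_counit H v e0))
  conv0 _ pW pE (primitive_for_in primZ) B B1 _ _ Bgen.
have {}zero : forall d t, (d < 3)%N -> gen_dir W E Z%:K d \notin B ->
    (0 < entry d t)%N -> cf t u = 0.
  move=> d t; apply: zero => // [l v|v w vB wB|d' v d3 vB].
  - have := conv_lin H (-1) l (fun=> 0) v; rewrite conv0 addr0 scaleN1r => <-.
    by congr (cv _ v); apply/funext => w; rewrite mulN1r addr0.
  - by apply: (subvP BB); exact: memv_mul.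
  by apply: conv_sub => // e w w'; rewrite linearP.
exists (fun i j => cf (i : nat, 0, j : nat)%N u); rewrite {1}(cfE u).
have p0 : (0 < p)%N := ltnW p_gt1.
transitivity (\sum_(s : 'I_p * 'I_p) \sum_(j < p)
    cf (ords (s, j)) u *: pbw W E Z%:K (ords (s, j))).
  by rewrite pair_bigA; apply: eq_bigr => -[s j] _.
transitivity (\sum_(i < p) \sum_(e < p) \sum_(j < p)
    cf (ords (i, e, j)) u *: pbw W E Z%:K (ords (i, e, j))).
  by rewrite [RHS]pair_bigA; apply: eq_bigr => -[i e] _.
apply: eq_bigr => i _; rewrite (bigD1 (Ordinal p0)) //= [X in _ + X]big1 ?addr0.
  by apply: eq_bigr => j _; rewrite /pbw /= mulr1.
move=> e e0'; rewrite big1 // => j _; rewrite (zero 1%N) ?scale0r //= lt0n.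
by apply: contraNneq e0' => ee; apply/eqP/val_inj.
Qed.

Lemma hopf_sub_adapted : exists a b c, ((a != 0) || (b != 0)) /\
  forall u, u \in B -> exists f : 'I_p -> 'I_p -> K,
    u = \sum_i \sum_j f i j *: ((a *: X%:K + b *: Y%:K + c *: Z%:K) ^+ i * Z%:K ^+ j).
Proof.
have sum3 (f : nat -> AK) : \sum_(d < 3) f d = f 0%N + f 1%N + f 2%N.
  by rewrite !big_ord_recr big_ord0 /= add0r.
have onlyZ (f : K) : f *: Z%:K \in B -> Z%:K \notin B -> f = 0.
  move=> fB ZB; apply: contraNeq ZB => f0.
  by rewrite -[Z%:K]scale1r -(mulVf f0) -scalerA memvZ.
(* Either [B] contains a linear element outside the line of [Z], which is taken as [W], or all its
   linear elements are multiples of [Z], and then [X] serves as [W]. *)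
have [[a [b [c [ab WB]]]]|none] := pselect (exists a b c, ((a != 0) || (b != 0)) /\
    a *: X%:K + b *: Y%:K + c *: Z%:K \in B).
  exists a, b, c; split=> //; have [T _] := triple_exchange c ab.
  set W := a *: _ + _ + _ in T WB *; set E := if _ then _ else _ in T.
  have [WE ZW ZE _] := T.
  have Z0 : Z%:K != 0.
    apply/eqP => Z0; have := pbw_coordinates p_gt1 bc_heis_triple bc_left_generates bc_dim.
    move=> [cf [_ cf_pbw _]]; have := cf_pbw (0, 0, 1)%N (0, 0, 1)%N.
    rewrite /pbw /= !expr0 !mul1r expr1 Z0 linear0 eqxx /in_box /= p_gt1 (ltnW p_gt1) /=.
    by move/esym/eqP; rewrite oner_eq0.
  (* Elements of [B] commute with [W], and the commutator of [W] with this one is [e1 *: Z%:K]. *)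
  have EB e1 e2 : e1 *: E + e2 *: Z%:K \in B -> e1 = 0.
    move=> eB; have := commB WB eB; rewrite mulrDr (mulrDl (e1 *: E)) -!scalerAr -!scalerAl WE ZW scale1r.
    rewrite scalerDr => /addIr/eqP; rewrite -subr_eq0 addrAC subrr add0r scaler_eq0.
    by rewrite (negPf Z0) orbF => /eqP.
  apply: sub_span_pbw => //; rewrite -/W -/E.
    move=> e; rewrite (sum3 (fun d => e d *: gen_dir W E Z%:K d)) /= => eB.
    have eB' : e 1%N *: E + e 2%N *: Z%:K \in B.
      have := memvB eB (memvZ (e 0%N) WB).
      by rewrite -(addrA (e 0%N *: W)) (addrC (e 0%N *: W)) addrK.
    have e1 := EB _ _ eB'; move: eB'; rewrite e1 scale0r add0r => /onlyZ e2.
    by apply: dir_ind => //=; rewrite WB.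
  apply/negP => EinB; have := EB 1 0; rewrite scale1r scale0r addr0 => /(_ EinB)/eqP.
  by rewrite oner_eq0.
exists 1, 0, 0; rewrite oner_neq0; split=> //.
have no a b c : a *: X%:K + b *: Y%:K + c *: Z%:K \in B -> a = 0 /\ b = 0.
  move=> abB; have [a0|a0] := eqVneq a 0; last by case: none; exists a, b, c; rewrite a0.
  have [b0|b0] := eqVneq b 0; last by case: none; exists a, b, c; rewrite b0 orbT.
  by [].
have := @sub_span_pbw 1 0 0; rewrite oner_neq0 /= invr1 => /(_ isT).
rewrite !scale1r !scale0r !addr0; apply.
  move=> e; rewrite (sum3 (fun d => e d *: gen_dir _ _ _ d)) /= => eB.
  have [e0 e1] := no _ _ _ eB; move: eB; rewrite e0 e1 !scale0r !add0r => /onlyZ e2.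
  by apply: dir_ind.
apply/negP => YB; have := no 0 1 0; rewrite !scale0r scale1r add0r addr0 => /(_ YB)[_ /eqP].
by rewrite oner_eq0.
Qed.
End AdaptedTriple.

(** * The induced module restricted along a pi-point *)

Section CyclicModule.
Variables (K : fieldType) (R : falgType K) (p : nat) (X Y Z : R).
Hypotheses (charp : p \in [pchar K]) (p_gt2 : (2 < p)%N).
Hypothesis heis : heis_triple p 1 X Y Z.
Hypothesis gen : left_generates X Y Z.
Hypothesis dimR : \dim {:R} = (p ^ 3)%N.
Variables (d : nat) (rep : {lrmorphism R -> 'M[K]_d}) (m0 : 'cV[K]_d).
Hypothesis Xm0 : rep X *m m0 = 0.
Hypothesis m0_gen : forall v, exists a, v = rep a *m m0.
Hypothesis dimV : d = (p ^ 2)%N.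

Let p_gt1 : (1 < p)%N. Proof. exact: ltnW. Qed.

Definition orb (a : R) : 'cV[K]_d := rep a *m m0.

Lemma orb_linear : linear orb.
Proof. by move=> c a b; rewrite /orb linearP mulmxDl -scalemxAl. Qed.

HB.instance Definition _ := GRing.isLinear.Build K R 'cV[K]_d *:%R orb orb_linear.

Lemma orbM a b : orb (a * b) = rep a *m orb b.
Proof. by rewrite /orb rmorphM mulmxA. Qed.

Lemma orb_mulX a : orb (a * X) = 0.
Proof. by rewrite orbM /orb Xm0 mulmx0. Qed.

(* The orbit map is injective on any set of monomials that spans a complement
   of [R * X]. *)
Lemma orb_inj (m : 'I_p -> 'I_p -> R) :
  (forall a, exists f : 'I_p -> 'I_p -> K, orb a = orb (\sum_i \sum_j f i j *: m i j)) ->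
  forall a, a \in <<[seq m i j | i <- enum 'I_p, j <- enum 'I_p]>>%VS -> orb a = 0 -> a = 0.
Proof.
move=> span; set C := <<_>>%VS => a aC a0.
have mC i j : m i j \in C by apply: memv_span; apply/allpairsP; exists (i, j); rewrite /= !mem_enum.
have full : (linfun orb @: C = fullv)%VS.
  apply/eqP; rewrite eqEsubv subvf; apply/subvP => v _; have [b ->] := m0_gen v.
  rewrite -/(orb b); have [f ->] := span b; apply/memv_imgP.
  exists (\sum_i \sum_j f i j *: m i j); rewrite ?lfunE //.
  by apply: memv_suml => i _; apply: memv_suml => j _; apply: memvZ.
have dimC : (\dim C <= p ^ 2)%N.
  by apply: leq_trans (dim_span _) _; rewrite size_allpairs size_enum_ord.
have := limg_ker_dim (linfun orb) C; rewrite full dimvf.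
have -> : dim 'cV[K]_d = d by rewrite /dim /= muln1.
move=> E; have /eqP : \dim (C :&: lker (linfun orb)) = 0%N by move: dimC E; rewrite -dimV; lia.
rewrite dimv_eq0 => /eqP C0; apply/eqP; rewrite -memv0 -C0 memv_cap aC memv_ker lfunE.
by apply/eqP.
Qed.

Lemma span_mul_closed (m : 'I_p -> 'I_p -> R) (W : R) :
  (forall i j, W * m i j \in <<[seq m i j | i <- enum 'I_p, j <- enum 'I_p]>>%VS) ->
  forall a, a \in <<[seq m i j | i <- enum 'I_p, j <- enum 'I_p]>>%VS ->
  W * a \in <<[seq m i j | i <- enum 'I_p, j <- enum 'I_p]>>%VS.
Proof.
set C := <<_>>%VS => mC a aC.
suff /subvP/(_ a aC) : (C <= linfun (W \*o @idfun R) @^-1: C)%VS by rewrite -memv_preim lfunE.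
apply/span_subvP => _ /allpairsP[[i j] /= [_ _ ->]].
by rewrite -memv_preim lfunE; exact: mC.
Qed.

Section Monomials.
Variable W : R.
Hypotheses (ZW : Z * W = W * Z) (Wp : W ^+ p = 0).
Definition mono (i j : 'I_p) := W ^+ i * Z ^+ j.
Definition monoV : {vspace R} := <<[seq mono i j | i <- enum 'I_p, j <- enum 'I_p]>>%VS.

Let Zp : Z ^+ p = 0. Proof. by case: heis => _ _ _ []. Qed.

Lemma mono_in (i j : nat) : W ^+ i * Z ^+ j \in monoV.
Proof.
have big (a : R) n : a ^+ p = 0 -> (p <= n)%N -> a ^+ n = 0.
  by move=> ap pn; rewrite -(subnKC pn) exprD ap mul0r.
have [ip|ip] := ltnP i p; last by rewrite (big W) ?mul0r ?mem0v.
have [jp|jp] := ltnP j p; last by rewrite (big Z) ?mulr0 ?mem0v.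
by apply: memv_span; apply/allpairsP; exists (Ordinal ip, Ordinal jp); rewrite /= !mem_enum.
Qed.

Lemma monoV_W a : a \in monoV -> W * a \in monoV.
Proof. by apply: span_mul_closed => i j; rewrite mulrA -exprS; exact: mono_in. Qed.

Lemma monoV_Z a : a \in monoV -> Z * a \in monoV.
Proof.
apply: span_mul_closed => i j; have -> : Z * mono i j = W ^+ i * Z ^+ j.+1.
  by rewrite /mono mulrA (commrX i (ZW : GRing.comm Z W)) -mulrA -exprS.
exact: mono_in.
Qed.

Lemma monoV_mul a b : a \in monoV -> b \in monoV -> a * b \in monoV.
Proof.
move=> aC bC; suff /subvP/(_ a aC) : (monoV <= linfun (b \o* @idfun R) @^-1: monoV)%VS.
  by rewrite -memv_preim lfunE.
apply/span_subvP => _ /allpairsP[[i j] /= [_ _ ->]].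
rewrite -memv_preim lfunE /= /mono -mulrA.
have ZC n : Z ^+ n * b \in monoV.
  by elim: n => [|n IH]; rewrite ?mul1r // exprS -mulrA monoV_Z.
by elim: (i : nat) => [|n IH]; rewrite ?mul1r // exprS -mulrA monoV_W.
Qed.

Lemma monoVX a n : a \in monoV -> a ^+ n \in monoV.
Proof.
move=> aC; elim: n => [|n IH]; last by rewrite exprS monoV_mul.
by have := mono_in 0 0; rewrite !expr0 mulr1.
Qed.

Lemma monoVE a : a \in monoV -> exists f : 'I_p -> 'I_p -> K, a = \sum_i \sum_j f i j *: mono i j.
Proof.
rewrite /monoV; set s := [seq _ | _ <- _, _ <- _].
have : forall b, b \in s -> exists f : 'I_p -> 'I_p -> K, b = \sum_i \sum_j f i j *: mono i j.
  move=> _ /allpairsP[[i j] /= [_ _ ->]]; exists (fun i' j' => ((i' == i) && (j' == j))%:R).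
  rewrite (bigD1 i) //= (bigD1 j) //= !eqxx scale1r !big1 ?addr0 // => [i' ii'|j' jj'].
    by rewrite big1 // => j' _; rewrite (negPf ii') scale0r.
  by rewrite (negPf jj') scale0r.
elim: s a => [|b s IH] a sP.
  rewrite span_nil memv0 => /eqP ->; exists (fun _ _ => 0).
  by rewrite big1 // => i _; rewrite big1 // => j _; rewrite scale0r.
rewrite span_cons => /memv_addP[_ /vlineP[e ->] [a' a's ->]].
have [|f ->] := IH a' _ a's; first by move=> b' bs; apply: sP; rewrite inE bs orbT.
have [g ->] := sP b (mem_head _ _); exists (fun i j => e * g i j + f i j).
rewrite scaler_sumr -big_split; apply: eq_bigr => i _ /=.
rewrite scaler_sumr -big_split; apply: eq_bigr => j _ /=.
by rewrite scalerDl scalerA.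
Qed.

End Monomials.

(** A monomial with a positive power of [X] kills the generator, because [Z] commutes with [X] and
    [X] kills [m0]. *)
Lemma orb_mono (W : R) (c : K) (cf : nat * nat * nat -> {scalar R}) :
  heis_triple p c W X Z ->
  (forall a, a = \sum_(s : 'I_p * 'I_p * 'I_p) cf (ords s) a *: pbw W X Z (ords s)) ->
  forall a, orb a = orb (\sum_(i < p) \sum_(j < p) cf (i : nat, 0, j : nat)%N a *: mono W i j).
Proof.
move=> [_ ZW ZX _] cfE a; rewrite {1}(cfE a); have p0 : (0 < p)%N := ltnW p_gt1.
have orb0 (i e j : nat) : (0 < e)%N -> orb (pbw W X Z (i, e, j)) = 0.
  case: e => // e _; rewrite /pbw /= exprSr !mulrA -mulrA (_ : X * Z ^+ j = Z ^+ j * X).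
    by rewrite mulrA orb_mulX.
  by apply: commrX; exact: esym.
rewrite !linear_sum.
transitivity (\sum_(s : 'I_p * 'I_p) \sum_(j < p)
    orb (cf (ords (s, j)) a *: pbw W X Z (ords (s, j)))).
  by rewrite pair_bigA; apply: eq_bigr => -[s j] _.
transitivity (\sum_(i < p) \sum_(e < p) \sum_(j < p)
    orb (cf (ords (i, e, j)) a *: pbw W X Z (ords (i, e, j)))).
  by rewrite [RHS]pair_bigA; apply: eq_bigr => -[i e] _.
apply: eq_bigr => i _; rewrite (bigD1 (Ordinal p0)) //= [X in _ + X]big1 ?addr0.
  by rewrite linear_sum; apply: eq_bigr => j _; rewrite /pbw /= mulr1.
move=> e e0; rewrite big1 // => j _; rewrite linearZ /= orb0 ?scaler0 // lt0n.
by apply: contraNneq e0 => ee; apply/eqP/val_inj.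
Qed.

Lemma monoV_sub (W W' : R) : Z * W' = W' * Z -> W' ^+ p = 0 -> W \in monoV W' ->
  (monoV W <= monoV W')%VS.
Proof.
move=> ZW Wp WC; apply/span_subvP => _ /allpairsP[[i j] /= [_ _ ->]].
rewrite /mono monoV_mul ?monoVX //; have := mono_in Wp 0 1.
by rewrite expr0 mul1r expr1.
Qed.

Let hZX : Z * X = X * Z. Proof. by case: heis. Qed.
Let hXp : X ^+ p = 0. Proof. by case: heis => _ _ _ []. Qed.
Let Zp' : Z ^+ p = 0. Proof. by case: heis => _ _ _ []. Qed.

Lemma monoV_comm q : q \in monoV X -> X * q = q * X /\ Z * q = q * Z.
Proof.
move=> /monoVE[f ->]; rewrite !mulr_sumr !mulr_suml; split; apply: eq_bigr => i _;
  rewrite mulr_sumr mulr_suml; apply: eq_bigr => j _; rewrite -scalerAr -scalerAl; congr (_ *: _).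
  by rewrite /mono mulrA -exprS exprSr -!mulrA; congr (_ * _); apply: commrX; exact: esym.
rewrite /mono mulrA (commrX i (hZX : GRing.comm Z X)) -!mulrA; congr (_ * _).
by rewrite -exprS exprSr.
Qed.

Lemma monoV_split a : a \in monoV X -> exists c m q1 q2,
  [/\ q1 \in monoV X, q2 \in monoV X & a = c%:A + m *: Z + (X * q1 + Z ^+ 2 * q2)].
Proof.
pose P a := exists c m q1 q2,
  [/\ q1 \in monoV X, q2 \in monoV X & a = c%:A + m *: Z + (X * q1 + Z ^+ 2 * q2)].
have PD e b b' : P b -> P b' -> P (e *: b + b').
  move=> [c [m [q1 [q2 [q1C q2C ->]]]]] [c' [m' [q1' [q2' [q1C' q2C' ->]]]]].
  exists (e * c + c'), (e * m + m'), (e *: q1 + q1'), (e *: q2 + q2').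
  rewrite !memvD ?memvZ //; split=> //; rewrite !scalerDr !scalerA !mulrDr !scalerDl -!scalerAr.
  by rewrite [LHS]addrACA; congr (_ + _); rewrite addrACA.
have P0 : P 0.
  by exists 0, 0, 0, 0; rewrite !mem0v !mulr0 !scale0r !addr0.
move=> /monoVE[f ->]; apply: (big_ind P) => // [b b' Pb Pb'|i _].
  by rewrite -[b]scale1r; apply: PD.
apply: (big_ind P) => // [b b' Pb Pb'|j _]; first by rewrite -[b]scale1r; apply: PD.
rewrite -[_ *: _]addr0; apply: PD => //; rewrite /mono.
case: (i : nat) => [|i']; last first.
  exists 0, 0, (X ^+ i' * Z ^+ j), 0; rewrite mem0v mono_in //; split=> //.
  by rewrite !scale0r mulr0 !addr0 !add0r mulrA -exprS.
case: (j : nat) => [|[|j']].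
- by exists 1, 0, 0, 0; rewrite !mem0v !mulr0 !scale0r !addr0 scale1r mulr1.
- by exists 0, 1, 0, 0; rewrite !mem0v !mulr0 !scale0r !addr0 scale1r mul1r add0r expr1.
exists 0, 0, 0, (Z ^+ j'); rewrite mem0v; have := mono_in hXp 0 j'; rewrite expr0 mul1r => ->.
by split=> //; rewrite !scale0r mulr0 !add0r mul1r -exprD.
Qed.

(** Modulo the left ideal generated by [X] this is a power of [Z ^+ 2 * q2], in which [Z] has the
    exponent [2 * p.-1], at least p. *)
Lemma power_in_ideal q1 q2 : q1 \in monoV X -> q2 \in monoV X ->
  exists e, (X * q1 + Z ^+ 2 * q2) ^+ p.-1 = e * X.
Proof.
move=> q1C q2C; set r := Z ^+ 2 * q2; set v := X * q1 + r.
have [Xq1 _] := monoV_comm q1C; have [Xq2 Zq2] := monoV_comm q2C.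
have rX n : X * r ^+ n = r ^+ n * X.
  apply: commrX; rewrite /GRing.comm /r mulrA (_ : X * Z ^+ 2 = Z ^+ 2 * X).
    by rewrite -mulrA Xq2 mulrA.
  by apply: commrX; exact: esym.
have vn n : exists e, v ^+ n = r ^+ n + e * X.
  elim: n => [|n [e IH]]; first by exists 0; rewrite mul0r addr0.
  exists (q1 * r ^+ n + v * e); rewrite exprS IH mulrDr {1}/v Xq1 mulrDl -exprS -mulrA rX.
  rewrite [in RHS]mulrDl -(mulrA q1) -(mulrA v) addrA; congr (_ + _); exact: addrC.
have [e ->] := vn p.-1; exists e; rewrite /r exprMn_comm; last first.
  by apply/commr_sym/commrX/commr_sym; exact: Zq2.
rewrite -exprM (_ : (2 * p.-1 = p + (p - 2))%N); last by move: p_gt2; lia.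
by rewrite exprD Zp' !mul0r add0r.
Qed.

Section Flat.
Variable alpha : {lrmorphism truncated K p -> R}.
Hypothesis flat_alpha : flat (along alpha).
Let u := alpha (truncX K p).

Lemma exact_projective :
  (forall v : 'cV[K]_d, rep u ^+ p.-1 *m v = 0 -> exists w, v = rep u *m w) ->
  projective (@repmod (truncated K p) K d (rep \o alpha)).
Proof.
move=> ex; apply: (@projective_exact _ _ p_gt1) => [c r|v]; last exact: ex.
by rewrite /= !linearZ.
Qed.

(** For [b != 0] the monomials in [W] and [Z] map [m0] to a basis, so the module is free of rank one
    over K[W, Z], which contains [u]. An equation [u ^+ p.-1 *m v = 0] therefore lifts to the
    algebra, where flatness solves it. *)
Lemma projective_transverse (a b c : K) : b != 0 ->
  u \in monoV (a *: X + b *: Y + c *: Z) -> projective (@repmod (truncated K p) K d (rep \o alpha)).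
Proof.
move=> b0; set W := a *: X + b *: Y + c *: Z => uC.
have [XY ZX ZY [Xp Yp Zp]] := heis.
have Wp : W ^+ p = 0 := heis_pth charp p_gt2 a b c heis.
have ZW : Z * W = W * Z by rewrite /W !mulrDr !mulrDl -!scalerAr -!scalerAl ZX ZY.
have T : heis_triple p (- b) W X Z.
  split=> //; rewrite /W !mulrDr !mulrDl -!scalerAr -!scalerAl ZX XY scale1r scalerDr scaleNr.
  by rewrite [RHS]addrAC (addrA (a *: _)) addrK.
have g : left_generates W X Z.
  move=> U U1 UP; apply: gen => // w /UP[Ww Xw Zw]; split=> //.
  have : b^-1 *: (W * w - a *: (X * w) - c *: (Z * w)) \in U.
    by rewrite memvZ // !memvB // memvZ.
  rewrite /W !mulrDl -!scalerAl addrAC addrK addrAC subrr add0r.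
  by rewrite scalerA mulVf // scale1r.
have orbC a' : exists f : 'I_p -> 'I_p -> K, orb a' = orb (\sum_i \sum_j f i j *: mono W i j).
  have [cf [cfE _ _]] := pbw_coordinates p_gt1 T g dimR.
  by eexists; exact: (orb_mono T cfE a').
apply: exact_projective => v; have [a' ->] := m0_gen v; rewrite -/(orb a').
have [f ->] := orbC a'; set e := \sum_i _ => ue.
have eC : e \in monoV W.
  by apply: memv_suml => i _; apply: memv_suml => j _; apply: memvZ; apply: mono_in.
have ue0 : u ^+ p.-1 * e = 0.
  apply: (orb_inj orbC); first by apply: monoV_mul => //; apply: monoVX.
  by rewrite orbM rmorphXn.
have [w wE] := flat_exact p_gt1 flat_alpha ue0.
by exists (orb w); rewrite -orbM -/u wE.
Qed.

(* Order the basis [Y^j Z^l] of the module by decreasing [j], then increasing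
   [l]: up to terms of higher index, [u] acts as [m *: Z]. *)
Lemma projective_central (m : K) q1 q2 : m != 0 -> q1 \in monoV X -> q2 \in monoV X ->
  u = m *: Z + (X * q1 + Z ^+ 2 * q2) -> projective (@repmod (truncated K p) K d (rep \o alpha)).
Proof.
move=> mn0 q1C q2C uE; set r := X * q1 + Z ^+ 2 * q2 in uE.
have T := heis_tripleC heis; have gT := left_generatesC gen.
have [cf [cfE cf_pbw cf_out]] := pbw_coordinates p_gt1 T gT dimR.
have M (n n' : nat) (b b' : bool) : (n * b = n' * b')%N -> n%:R * b%:R = n'%:R * b'%:R :> K.
  by move=> nb; rewrite -!natrM nb.
have cfX j l a : in_box p (j, 0, l)%N -> cf (j, 0, l)%N (X * a) =
    if l is l'.+1 then j.+1%:R * cf (j.+1, 0, l')%N a else 0.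
  move=> jl; move: a; apply: (pbw_ext (V := K^o) cfE) => [e a b|e a b|[[j' i'] l'] sb].
  - by rewrite mulrDr -scalerAr linearP.
  - case: l {jl} => [|l']; first by rewrite scaler0 addr0.
    by rewrite linearP mulrDr; congr (_ + _); exact: mulrCA.
  rewrite (mulY_pbw T) mulrN1 scaleNr opprK linearD linearZ /= !cf_pbw !tripleE /= !andbF add0r.
  case: l jl => [|l] jl.
    by rewrite !andbF mulr0.
  by rewrite cf_pbw tripleE /=; apply: M; move: jl sb p_gt1; rewrite /in_box /=; lia.
have cfZ j l a : in_box p (j, 0, l)%N -> cf (j, 0, l)%N (Z * a) =
    if l is l'.+1 then cf (j, 0, l')%N a else 0.
  move=> jl; move: a; apply: (pbw_ext (V := K^o) cfE) => [e a b|e a b|[[j' i'] l'] sb].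
  - by rewrite mulrDr -scalerAr linearP.
  - by case: l {jl} => [|l']; rewrite ?linearP // scaler0 addr0.
  rewrite (mulZ_pbw T) !cf_pbw !tripleE /=.
  case: l jl => [|l] jl; first by rewrite !andbF.
  rewrite cf_pbw tripleE; congr (_%:R).
  by move: jl sb p_gt1; rewrite /in_box /=; lia.
(* The index of Y^j Z^l is [(p.-1 - j) * p + l]. Coordinates with a positive power of [X] are left
   out, as those monomials kill the generator. *)
pose Fil n a := forall j l, (j < p)%N -> (l < p)%N -> ((p.-1 - j) * p + l < n)%N ->
  cf (j, 0, l)%N a = 0.
have FD n e a b : Fil n a -> Fil n b -> Fil n (e *: a + b).
  by move=> fa fb j l jp lp jl; rewrite linearP /= fa // fb // mulr0 addr0.
have F0 n : Fil n 0 by move=> j l _ _ _; rewrite linear0.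
have FA n a b : Fil n a -> Fil n b -> Fil n (a + b) by rewrite -{2}[a]scale1r; apply: FD.
have FZs n e a : Fil n a -> Fil n (e *: a) by move=> fa; rewrite -[_ *: _]addr0; apply: FD.
have Fle n n' a : (n <= n')%N -> Fil n' a -> Fil n a.
  by move=> nn fa j l jp lp jl; apply: fa => //; apply: leq_trans nn.
have p0 : (0 < p)%N := ltnW p_gt1.
have box j l : (j < p)%N -> (l < p)%N -> in_box p (j, 0, l)%N by rewrite /in_box /= => -> ->; rewrite p0.
(* On the generator, [X] turns Y^j Z^l into a multiple of Y^(j-1) Z^(l+1), which raises the index by
   p + 1, hence by at least 2. *)
have FX n a : Fil n a -> Fil n.+2 (X * a).
  move=> fa j [|l] jp lp jl; rewrite cfX ?box //.
  have [jp'|jp'] := ltnP j.+1 p; last by rewrite cf_out ?mulr0 // /in_box /= ltnNge jp'.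
  rewrite fa ?mulr0 // ?(ltnW lp) //; move: jl.
  by rewrite (_ : (p.-1 - j = (p.-1 - j.+1).+1)%N) ?mulSn; lia.
have FZ n a : Fil n a -> Fil n.+1 (Z * a).
  move=> fa j [|l] jp lp jl; rewrite cfZ ?box //.
  by rewrite fa // ?(ltnW lp) //; move: jl; lia.
have Fq n q a : q \in monoV X -> Fil n a -> Fil n (q * a).
  move=> /monoVE[f ->] fa; rewrite mulr_suml; apply: (big_ind (Fil n)) => // [b b'|i _]; first exact: FA.
  rewrite mulr_suml; apply: (big_ind (Fil n)) => // [b b'|j _]; first exact: FA.
  rewrite -scalerAl; apply: FZs; rewrite /mono -mulrA.
  have fZ : Fil n (Z ^+ j * a).
    elim: (j : nat) => [|j' IH]; rewrite ?mul1r // exprS -mulrA.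
    by apply: (Fle n n.+1) => //; apply: FZ.
  elim: (i : nat) => [|i' IH]; rewrite ?mul1r // exprS -mulrA.
  by apply: (Fle n n.+2); [rewrite ltnW | apply: FX].
have Fr n a : Fil n a -> Fil n.+2 (r * a).
  move=> fa; rewrite /r mulrDl; apply: FA; rewrite -mulrA; first by apply/FX/Fq.
  by rewrite expr2 -mulrA; apply/FZ/FZ/Fq.
have uM a : u * a = m *: (Z * a) + r * a by rewrite uE mulrDl -scalerAl.
have Fu n a : Fil n a -> Fil n.+1 (u * a).
  by move=> fa; rewrite uM; apply: FD; [apply: FZ | apply: (Fle _ n.+2) => //; apply: Fr].
have FZn n a i : Fil n a -> Fil (n + i)%N (Z ^+ i * a).
  move=> fa; elim: i => [|i IH]; first by rewrite mul1r addn0.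
  by rewrite exprS -mulrA addnS; apply: FZ.
have Fun n a i : Fil n a -> Fil (n + i).+1 (u ^+ i * a - m ^+ i *: (Z ^+ i * a)).
  move=> fa; elim: i => [|i IH]; first by rewrite !mul1r scale1r subrr.
  have -> : u ^+ i.+1 * a - m ^+ i.+1 *: (Z ^+ i.+1 * a) =
      u * (u ^+ i * a - m ^+ i *: (Z ^+ i * a)) + m ^+ i *: (r * (Z ^+ i * a)).
    rewrite mulrBr -scalerAr (mulrA u (u ^+ i)) -(exprS u) -addrA; congr (_ + _).
    by rewrite uM scalerDr opprD -addrA addNr addr0 scalerA -exprSr (mulrA Z (Z ^+ i)) -(exprS Z).
  rewrite addnS; apply: FA; first exact: Fu.
  by apply/FZs/Fr/FZn.
have orb0 a : Fil (p ^ 2)%N a -> orb a = 0.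
  move=> fa; rewrite (orb_mono T cfE) big1 ?linear0 // => i _; rewrite big1 // => j _.
  rewrite fa ?scale0r //; have := ltn_ord i; have := ltn_ord j => jp ip.
  have : ((p.-1 - i) * p <= p.-1 * p)%N by rewrite leq_mul2r leq_subr orbT.
  have : (p ^ 2 = p.-1 * p + p)%N by rewrite expnS expn1 -{1}(prednK p0) mulSn addnC.
  by lia.
have orb_cf a : orb a = 0 -> forall j l, cf (j, 0, l)%N a = 0.
  move=> a0 j l; have [jl|/cf_out -> //] := boolP (in_box p (j, 0, l)%N).
  have := @orb_inj (@mono Y) _ (\sum_(i < p) \sum_(j < p) cf (i : nat, 0, j : nat)%N a *: mono Y i j).
  rewrite -(orb_mono T cfE) a0 => E.
  have {}E := E (fun a => ex_intro _ _ (orb_mono T cfE a)) _ erefl.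
  have : cf (j, 0, l)%N (\sum_(i < p) \sum_(j < p) cf (i : nat, 0, j : nat)%N a *: mono Y i j) = 0.
    rewrite E ?linear0 //; apply: memv_suml => i _; apply: memv_suml => j' _; apply: memvZ.
    by apply: memv_span; apply/allpairsP; exists (i, j'); rewrite /= !mem_enum.
  have mE i j' : mono Y i j' = pbw Y X Z (i : nat, 0, j' : nat)%N by rewrite /pbw /= mulr1.
  case/and3P: (jl) => /= jp _ lp; rewrite linear_sum (bigD1 (Ordinal jp)) //= linear_sum.
  rewrite (bigD1 (Ordinal lp)) //= linearZ /= mE cf_pbw jl eqxx mulr1 !big1 ?addr0 //.
    move=> i ij; rewrite linear_sum big1 // => j' _; rewrite linearZ /= mE cf_pbw tripleE /=.
    by rewrite -val_eqE /= in ij; rewrite (negPf ij) andbF mulr0.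
  move=> j' jj'; rewrite linearZ /= mE cf_pbw tripleE /=.
  by rewrite -val_eqE /= in jj'; rewrite (negPf jj') !andbF mulr0.
have up : u ^+ p = 0 by rewrite -rmorphXn truncXp // rmorph0.
suff key k n a : (p ^ 2 - n <= k)%N -> Fil n a -> orb (u ^+ p.-1 * a) = 0 -> exists w, orb a = orb (u * w).
  apply: exact_projective => v; have [a ->] := m0_gen v; rewrite -/(orb a) => ua.
  have [w ->] : exists w, orb a = orb (u * w).
    by apply: (key (p ^ 2)%N 0%N a); rewrite ?subn0 // orbM rmorphXn.
  by exists (orb w); rewrite orbM.
elim: k n a => [|k IH] n a nk fa ua.
  exists 0; rewrite mulr0 linear0 orb0 //; apply: (Fle _ n) => //.
  by rewrite leqNgt; apply/negP => /[dup] h; move: nk h; lia.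
have [n2|n2] := leqP (p ^ 2) n.
  by exists 0; rewrite mulr0 linear0 orb0 //; apply: (Fle _ n).
pose j := (p.-1 - n %/ p)%N; pose l := (n %% p)%N.
have np : (n %/ p < p)%N by rewrite ltn_divLR // -expnSr.
have lp : (l < p)%N by rewrite ltn_mod.
have jp : (j < p)%N by rewrite (leq_ltn_trans (leq_subr _ _)) // ltn_predL.
have njl : ((p.-1 - j) * p + l = n)%N.
  by rewrite /j subKn /l -?divn_eq // -ltnS prednK.
have jl_inj j' l' : (j' < p)%N -> (l' < p)%N -> ((p.-1 - j') * p + l' = n)%N -> j' = j /\ l' = l.
  move=> jp' lp' E; rewrite /j /l -E modnMDl modn_small // divnMDl // divn_small // addn0.
  by rewrite subKn // -ltnS prednK.
have FS b : Fil n b -> cf (j, 0, l)%N b = 0 -> Fil n.+1 b.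
  move=> fb b0 j' l' jp' lp'; rewrite ltnS leq_eqVlt => /orP[/eqP/jl_inj[]// -> -> //|].
  exact: fb.
(* For [l = 0] the leading coefficient survives multiplication by [Z ^+ p.-1], so it must be 0 when
   [u ^+ p.-1] kills the element; for [l > 0] it is removed by subtracting [u * w]. *)
case: (posnP l) => l0.
  apply: (IH n.+1) => //; first by rewrite subnS; move: nk; lia.
  apply: FS => //; have := Fun _ _ p.-1 fa j p.-1 jp; rewrite prednK // => /(_ (leqnn _)).
  have -> : ((p.-1 - j) * p + p.-1 < (n + p.-1).+1)%N by rewrite -njl l0 addn0.
  move=> /(_ isT); rewrite linearB linearZ /= (orb_cf _ ua) sub0r => /eqP.
  rewrite oppr_eq0 mulf_eq0 expf_eq0 (negPf mn0) andbF /= l0 => /eqP.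
  have cfZn i : (i < p)%N -> cf (j, 0, i)%N (Z ^+ i * a) = cf (j, 0, 0)%N a.
    elim: i => [|i IHi] ip; first by rewrite mul1r.
    by rewrite exprS -mulrA cfZ ?box // IHi // ltnW.
  by rewrite cfZn // prednK.
pose w := (cf (j, 0, l)%N a / m) *: pbw Y X Z (j, 0, l.-1)%N.
have Zw : m *: (Z * w) = cf (j, 0, l)%N a *: pbw Y X Z (j, 0, l)%N.
  by rewrite /w -scalerAr scalerA mulrCA mulfV // mulr1 (mulZ_pbw T) prednK.
have fp l' : (l' < p)%N -> (n <= (p.-1 - j) * p + l' + 1)%N -> Fil n.-1 (pbw Y X Z (j, 0, l')%N).
  move=> lp' nl j' l'' jp' lp'' jl; rewrite cf_pbw tripleE.
  by case: eqP jl => [<-|]; case: (l' =P l'') => [<-|]; rewrite ?andbF //; move: nl; lia.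
have fuw : Fil n.+1 (u * w - m *: (Z * w)).
  rewrite uM addrC addKr; apply: (Fle _ n.-1.+2); first by move: l0 njl; lia.
  by apply/Fr/FZs/fp; move: lp l0 njl; lia.
have fa' : Fil n.+1 (a - u * w).
  have -> : a - u * w = (a - m *: (Z * w)) + (-1) *: (u * w - m *: (Z * w)).
    by rewrite scaleN1r opprB addrA subrK.
  apply: FA; last exact: FZs.
  rewrite Zw; apply: FS.
    rewrite -scaleNr addrC; apply: FD => // j' l' jp' lp' jl; rewrite cf_pbw tripleE /=.
    by case: eqP jl => [<-|]; case: (l =P l') => [<-|]; rewrite ?andbF // njl ltnn.
  by rewrite linearB linearZ /= cf_pbw box // eqxx mulr1 subrr.
have ua' : orb (u ^+ p.-1 * (a - u * w)) = 0.
  by rewrite mulrBr linearB /= ua mulrA -exprSr prednK // up mul0r linear0 subr0.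
have nk' : (p ^ 2 - n.+1 <= k)%N by move: nk; lia.
have [w' E] := IH _ _ nk' fa' ua'.
by exists (w' + w); rewrite mulrDr linearD /= -E -linearD subrK.
Qed.

End Flat.
End CyclicModule.

(** Trades the coordinates of [quot_module] for the projection A -> A / U. *)
Lemma quot_orbit (k : fieldType) (A : falgType k) (U : {vspace A})
    (idealU : ({:A} * U <= U)%VS) :
  exists q : A -> 'cV[k]_(mdim (quot_module idealU)),
  [/\ linear q, forall a w, quot_module idealU a *m q w = q (a * w),
      forall v, exists w, v = q w & forall w, (q w == 0) = (w \in U)].
Proof.
pose pr : 'End(A) := daddv_pi U^C U.
have dUC : (U^C :&: U = 0)%VS by rewrite capvC capv_compl.
have prE w : pr w + daddv_pi U U^C w = w.
  by have := @daddv_pi_add _ _ _ _ w dUC; rewrite addvC addv_complf memvf; apply.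
have pr_mem w : pr w \in (U^C)%VS by exact: memv_pi.
have pr_mod w : w - pr w \in U by rewrite -{1}(prE w) addrAC subrr add0r memv_pi.
have pr_ker w : (pr w == 0) = (w \in U).
  apply/idP/idP => [/eqP p0|wU]; first by rewrite -(prE w) p0 add0r memv_pi.
  by apply/eqP; move: (prE w); rewrite (daddv_pi_id (capv_compl U) wU) -[in RHS](add0r w) => /addIr.
pose q (w : A) : 'cV[k]_(\dim U^C) := \col_i coord (vbasis U^C) i (pr w).
have q_lin : linear q by move=> c a b; apply/colP => i; rewrite !mxE !linearP.
have q_ker w : (q w == 0) = (w \in U).
  rewrite -pr_ker; apply/eqP/eqP => [/colP q0|p0]; last first.
    by apply/colP => i; rewrite !mxE p0 linear0.
  rewrite (coord_vbasis (pr_mem w)) big1 // => i _.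
  by have := q0 i; rewrite !mxE => ->; rewrite scale0r.
have qB a b : q (a - b) = q a - q b by have := q_lin (-1) b a; rewrite !scaleN1r => E; rewrite (addrC a) E addrC.
exists q; split=> // [a w|v].
  have -> : q (a * w) = q (a * pr w).
    apply/eqP; rewrite -subr_eq0 -qB q_ker -mulrBr.
    by apply: (subvP idealU); rewrite memv_mul ?memvf.
  apply/colP => i; rewrite !mxE [in RHS](coord_vbasis (pr_mem w)) mulr_sumr !linear_sum.
  by apply: eq_bigr => j _; rewrite !mxE -scalerAr !linearZ /= mulrC.
exists (\sum_j v j 0 *: (vbasis U^C)`_j); apply/colP => i; rewrite mxE.
have -> : pr (\sum_j v j 0 *: (vbasis U^C)`_j) = \sum_j v j 0 *: (vbasis U^C)`_j.
  rewrite /pr daddv_pi_id //; apply: memv_suml => j _; apply: memvZ.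
  by rewrite vbasis_mem // mem_nth // size_tuple.
by apply/esym/coord_sum_free/basis_free/vbasisP.
Qed.

(** The augmentation ideal of the subalgebra generated by [x] consists of left multiples of [x]. *)
Lemma ind_ideal_line (k : fieldType) (A : falgType k) (eps : {lrmorphism A -> k^o}) (x : A) :
  eps x = 0 -> forall a, (a \in ind_ideal eps (agenv <[x]>)) = (a \in limg (linfun (x \o* @idfun A))).
Proof.
move=> ex; set L := limg _; have LP b : b * x \in L.
  by have := memv_img (linfun (x \o* @idfun A)) (memvf b); rewrite lfunE.
have agen b : b \in agenv <[x]> -> exists c d, b = c%:A + d * x.
  have : (agenv <[x]> <= <[1]> + L)%VS.
    apply: agenv_sub_modr; first exact: addvSl.
    apply/prodvP => u w _ /vlineP[e ->]; rewrite -scalerAr.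
    by apply/memvZ/(subvP (addvSr _ _)); exact: LP.
  move=> /subvP sub /sub /memv_addP[_ /vlineP[c ->] [_ /memv_imgP[d _ ->] ->]].
  by exists c, d; rewrite lfunE.
move=> a; apply/idP/idP.
  move: a; apply/subvP/prodvP => u b _; rewrite memv_cap memv_ker lfunE /=.
  move=> /andP[/agen[c [d ->]] /eqP].
  have dx : eps (d * x) = 0 by rewrite rmorphM /= ex; exact: mulr0.
  have -> : eps (c%:A + d * x) = c.
    by rewrite linearD linearZ /= rmorph1 dx addr0; exact: mulr1.
  by move=> ->; rewrite scale0r add0r mulrA.
move=> /memv_imgP[b _ ->]; rewrite lfunE /= memv_mul ?memvf // memv_cap memv_ker lfunE /= ex eqxx andbT.
by apply: (subvP (sub_agenv _)); exact: memv_line.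
Qed.

(** * Pi-points generated by a primitive element *)

Section PrimitivePoint.
Variables (k : fieldType) (A : falgType k) (eps : {lrmorphism A -> k^o}) (H : hopf eps).
Variables (p : nat) (p_gt2 : (2 < p)%N) (t : A) (tp : t ^+ p = 0).
Hypothesis prim : primitive_elt H t.
Hypothesis et : eps t = 0.
Local Notation AK := (bc idfun A).
Local Notation "a %:K" := (bc_in idfun a) (at level 2, format "a %:K").
Local Notation alpha := (base_point p_gt2 tp).

Let p_gt1 : (1 < p)%N. Proof. exact: ltnW. Qed.

Lemma base_pointE r : alpha r = powmap t%:K r. Proof. by []. Qed.

Definition point_image : {vspace AK} := limg (linfun alpha).

Lemma point_imageP b : b \in point_image <-> exists r, b = alpha r.
Proof.
split=> [/memv_imgP[r _ ->]|[r ->]]; first by exists r; rewrite lfunE.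
by have := memv_img (linfun alpha) (memvf r); rewrite lfunE.
Qed.

Lemma point_image1 : 1 \in point_image.
Proof. by apply/point_imageP; exists 1; rewrite rmorph1. Qed.

Lemma point_imageM : (point_image * point_image <= point_image)%VS.
Proof.
apply/prodvP => u w /point_imageP[r ->] /point_imageP[r' ->].
by apply/point_imageP; exists (r * r'); rewrite rmorphM.
Qed.

Lemma point_imageX n : (t ^+ n)%:K \in point_image.
Proof.
apply/point_imageP; exists (truncX k p ^+ n); rewrite rmorphXn /= ?base_pointE powmapX //.
  by rewrite bc_inX.
exact: bc_in_pth.
Qed.

(** The strict bound on the left exponent makes the recursion for the antipode in [antipode_power]
    well founded. *)
Definition power_tens n : {vspace tens A A} :=
  <<[seq tprod (t ^+ i) (t ^+ j) | i <- iota 0 n, j <- iota 0 n.+1]>>%VS.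

Lemma comult_power n : comult H (t ^+ n) - tprod (t ^+ n) 1 \in power_tens n.
Proof.
elim: n => [|n IH]; first by rewrite comult1 subrr mem0v.
have lin a b : linear (fun X : tens A A => tmul (tprod a b) X).
  have E X : tmul (tprod a b) X = tlift (fun c d => tprod (a * c) (b * d)) X.
    rewrite /tmul tlift_tprod // => [y|x] e v w.
      rewrite /tlift scaler_sumr -big_split; apply: eq_bigr => i _.
      rewrite scaler_sumr -big_split; apply: eq_bigr => j _ /=.
      by rewrite mulrDl -scalerAl tprod_linearl scalerDr !scalerA mulrC.
    rewrite /tlift scaler_sumr -big_split; apply: eq_bigr => i _.
    rewrite scaler_sumr -big_split; apply: eq_bigr => j _ /=.
    by rewrite mulrDl -scalerAl tprod_linearr scalerDr !scalerA mulrC.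
  by move=> e X Y; rewrite !E linearP.
pose L a b := linfun (HB.pack_for {linear tens A A -> tens A A} (tmul (tprod a b))
   (GRing.isLinear.Build k (tens A A) (tens A A) *:%R (tmul (tprod a b)) (lin a b))).
have inS i j : (i <= n)%N -> (j <= n.+1)%N -> tprod (t ^+ i) (t ^+ j) \in power_tens n.+1.
  by move=> ni nj; apply: memv_span; apply/allpairsP; exists (i, j); split; rewrite ?mem_iota.
have LP a b (X : tens A A) : (forall i j, (i < n)%N -> (j <= n)%N ->
    tprod (a * t ^+ i) (b * t ^+ j) \in power_tens n.+1) ->
    X \in power_tens n -> tmul (tprod a b) X \in power_tens n.+1.
  move=> ab XS; suff /subvP/(_ X XS) : (power_tens n <= L a b @^-1: power_tens n.+1)%VS.
    by rewrite -memv_preim lfunE.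
  apply/span_subvP => _ /allpairsP[[i j] [ni nj ->]]; rewrite !mem_iota /= in ni nj; rewrite /=.
  by rewrite -memv_preim lfunE /= tmul_tprod ab.
set C := comult H (t ^+ n) in IH *.
have -> : comult H (t ^+ n.+1) - tprod (t ^+ n.+1) 1 =
    tmul (tprod t 1) (C - tprod (t ^+ n) 1) + (tmul (tprod 1 t) (C - tprod (t ^+ n) 1)
     + tprod (t ^+ n) t).
  rewrite exprS comultM prim tmulDl -/C.
  have LB a b (X Y : tens A A) : tmul (tprod a b) (X - Y) = tmul (tprod a b) X - tmul (tprod a b) Y.
    by have := lin a b (-1) Y X; rewrite !scaleN1r => E; rewrite (addrC X) E addrC.
  by rewrite !LB !tmul_tprod !mul1r !mulr1 subrK addrAC.
apply: memvD; last apply: memvD.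
- apply: (LP) => // i j ni nj; rewrite mul1r -exprS; apply: inS => //; exact: leqW.
- by apply: (LP) => // i j ni nj; rewrite mul1r -exprS; apply: inS => //; exact: ltnW.
by have := inS n 1%N; rewrite expr1; apply.
Qed.

Lemma antipode_power n : (antipode H (t ^+ n))%:K \in point_image.
Proof.
elim/ltn_ind: n => n IH.
pose h := linfun (tlift (fun b c : A => (antipode H b * c)%:K : AK)).
have hl : linear (fun X : tens A A => tlift (fun b c : A => (antipode H b * c)%:K : AK) X).
  exact: tlift_linear.
have hE X : h X = (tlift (fun b c : A => antipode H b * c) X)%:K.
  rewrite lfunE /= /tlift (big_morph _ (@bc_inD _ _ idfun A) (@bc_in0 _ _ idfun A)).
  apply: eq_bigr => i _; rewrite (big_morph _ (@bc_inD _ _ idfun A) (@bc_in0 _ _ idfun A)).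
  by apply: eq_bigr => j _; rewrite bc_inZ.
have hT b c : h (tprod b c) = (antipode H b * c)%:K.
  rewrite hE tlift_tprod // => [y|x] e v w.
    by rewrite antipode_linear mulrDl -scalerAl.
  by rewrite mulrDr -scalerAr.
have rest : h (comult H (t ^+ n) - tprod (t ^+ n) 1) \in point_image.
  suff /subvP/(_ _ (comult_power n)) : (power_tens n <= h @^-1: point_image)%VS.
    by rewrite -memv_preim.
  apply/span_subvP => _ /allpairsP[[i j] [ni _ ->]]; rewrite mem_iota /= in ni; rewrite /=.
  by rewrite -memv_preim hT bc_inM (subvP point_imageM) // memv_mul ?IH ?point_imageX.
move: rest; rewrite linearB /= hT mulr1 hE antipodel bc_inZ => rest.
have := memvB (memvZ (eps (t ^+ n) : k) point_image1) rest.
by rewrite opprB addrC subrK.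
Qed.

Lemma point_image_hopf : hopf_sub H point_image.
Proof.
have gens (Q : {vspace AK}) (f : AK -> AK) : linear f ->
    (forall n, f (t ^+ n)%:K \in Q) -> forall b, b \in point_image -> f b \in Q.
  move=> fl fQ _ /point_imageP[r ->]; rewrite base_pointE powmapE //.
  pose F := HB.pack_for {linear AK -> AK} f (GRing.isLinear.Build k AK AK *:%R f fl).
  rewrite -[f _]/(F _) linear_sum; apply: memv_suml => i _.
  by rewrite linearZ memvZ // -bc_inX; exact: fQ.
split; [exact: point_image1 | exact: point_imageM | |]; last first.
  apply: gens => [|n]; first exact: bc_lift_linear.
  rewrite /bc_antipode bc_liftK ?antipode_power // => c a b.
  by rewrite antipode_linear bc_in_linear.
move=> _ /point_imageP[r ->]; rewrite base_pointE powmapE // /bc_comult linear_sum.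
apply: memv_suml => n _; rewrite linearZ memvZ // -bc_inX.
have sl := slift_linear idfun (fun c d => tprod c%:K d%:K : tens AK AK).
rewrite /= bc_liftK; last by move=> c x y; rewrite comult_linear; exact: sl.
set h := (X in X \in _).
have tP i j : tprod (t ^+ i)%:K (t ^+ j)%:K \in tensv point_image point_image.
  move: (point_imageX i) (point_imageX j); move: (_%:K) (_%:K) => u w.
  move=> /coord_vbasis -> /coord_vbasis ->.
  pose lin1 (b : AK) := HB.pack_for {linear AK -> tens AK AK} (@tprod k AK AK ^~ b)
    (GRing.isLinear.Build k AK (tens AK AK) *:%R (@tprod k AK AK ^~ b) (tprod_linearl b)).
  pose lin2 (a : AK) := HB.pack_for {linear AK -> tens AK AK} (@tprod k AK AK a)
    (GRing.isLinear.Build k AK (tens AK AK) *:%R (@tprod k AK AK a) (tprod_linearr a)).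
  rewrite -[tprod _ _]/(lin1 _ _) linear_sum; apply: memv_suml => a _.
  rewrite linearZ memvZ // -[lin1 _ _]/(lin2 _ _) linear_sum; apply: memv_suml => b _.
  rewrite linearZ memvZ // memv_span //; apply/allpairsP.
  by exists ((vbasis point_image)`_a, (vbasis point_image)`_b); rewrite !mem_nth ?size_tuple.
pose s X : tens AK AK := slift idfun (fun c d => tprod c%:K d%:K) X.
have sL : linear s := sl.
pose S := linfun (HB.pack_for {linear tens A A -> tens AK AK} s
   (GRing.isLinear.Build k (tens A A) (tens AK AK) *:%R s sL)).
have sT a b : s (tprod a b) = tprod a%:K b%:K.
  by rewrite /s slift_tprod //; split=> [y|x] c v w; rewrite bc_in_linear ?tprod_linearl ?tprod_linearr.
have -> : h = S (comult H (t ^+ n) - tprod (t ^+ n) 1) + s (tprod (t ^+ n) 1).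
  by rewrite linearB /= !lfunE /= subrK.
apply: memvD; last by rewrite sT -(expr0 t) tP.
suff /subvP/(_ _ (comult_power n)) : (power_tens n <= S @^-1: tensv point_image point_image)%VS.
  by rewrite -memv_preim.
apply/span_subvP => _ /allpairsP[[i j] /= [_ _ ->]].
by rewrite -memv_preim lfunE /= sT tP.
Qed.

Lemma point_image_aspace : is_aspace point_image.
Proof. by rewrite /is_aspace point_imageM has_algid1 ?point_image1. Qed.

(** The image of [alpha] serves as the Hopf subalgebra; as a quotient of K[t]/t^p it is commutative
    and local. *)
Lemma primitive_pi_point : flat (along alpha) -> pi_point H alpha.
Proof.
move=> fl; split=> //; pose B : {aspace AK} := ASpace point_image_aspace.
exists B; split=> [|u w uB wB||r].
- exact: point_image_hopf.
- have [r ->] := (point_imageP u).1 uB; have [r' ->] := (point_imageP w).1 wB.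
  by rewrite -!rmorphM mulrC.
- have e0 : forall a : AK, a \in point_image -> epsK eps a = 0 -> a ^+ p = 0.
    move=> _ /point_imageP[r ->]; rewrite epsK_alpha // => r0.
    by rewrite -rmorphXn (trunc_head p_gt1 r) r0 scale0r add0r exprMn truncXp // mul0r rmorph0.
  have v1 : vsval (1 : subvs_of B) = 1.
    by apply/eqP; rewrite -[vsval _]/(algid B) algid_eq1; exact: point_image1.
  apply: (@nil_augmentation_local k (subvs_of B) (fun b => epsK eps (vsval b))).
  + by move=> c a b; rewrite linearP epsK_lin.
  + by move=> a b; rewrite -epsKM.
  + by rewrite v1 epsK1.
  move=> b eb; exists p; apply: val_inj; rewrite /= -(e0 _ (subvsP b) eb).
  suff E n : (0 < n)%N -> vsval (b ^+ n) = vsval b ^+ n by rewrite E // ltnW.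
  elim: n => // -[|n] IH _; first by rewrite !expr1.
  by rewrite exprS [in RHS]exprS -IH.
by apply/point_imageP; exists r.
Qed.

End PrimitivePoint.

(** * The support of the induced module *)

Section InducedModule.
Variables (k : fieldType) (A : falgType k) (eps : {lrmorphism A -> k^o}) (H : hopf eps).
Variables (p : nat) (charp : p \in [pchar k]) (p_gt2 : (2 < p)%N) (X Y Z : A).
Hypothesis heis : heis_triple p 1 X Y Z.
Hypothesis gen : left_generates X Y Z.
Hypothesis dimA : \dim {:A} = (p ^ 3)%N.
Hypotheses (eX : eps X = 0) (eY : eps Y = 0) (eZ : eps Z = 0).

Let p_gt1 : (1 < p)%N. Proof. exact: ltnW. Qed.
Hypothesis Xp : X ^+ p = 0.
Local Notation V := (induced_trivial eps (agenv <[X]>)).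
Local Notation L := (limg (linfun (X \o* @idfun A))).

Lemma mulX_in_line b : b * X \in L.
Proof. by have := memv_img (linfun (X \o* @idfun A)) (memvf b); rewrite lfunE. Qed.

Lemma module_orbit : exists q : A -> 'cV[k]_(mdim V),
  [/\ linear q, forall a w, V a *m q w = q (a * w),
      forall v, exists w, v = q w & forall w, (q w == 0) = (w \in L)].
Proof.
have [q [ql qM qs qk]] := quot_orbit (@ind_idealP k A eps (agenv <[X]>)).
by exists q; split=> // w; rewrite qk ind_ideal_line.
Qed.

Lemma flat_base_point : flat (along (base_point p_gt2 Xp)).
Proof.
have [co [col coE coD]] := left_frame_exists p_gt1 (bc_heis_triple heis idfun)
  (bc_left_generates heis gen (iota := idfun)) (bc_dim dimA idfun).
apply: (@flat_left_frame k p (bc idfun A) (base_point p_gt2 Xp) _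
  (fun i : 'I_p * 'I_p => (bc_in idfun Y) ^+ i.1 * (bc_in idfun Z) ^+ i.2) co).
- exact: col.
- exact: coE.
move=> i r a; rewrite base_pointE.
pose f i' := HB.pack_for {linear bc idfun A -> truncated k p} (co i')
  (GRing.isLinear.Build k (bc idfun A) (truncated k p) *:%R (co i') (col i')).
rewrite {1}(coE a) mulr_sumr -[co i _]/(f i _) linear_sum (bigD1 i) //= big1 => [|j ji].
  rewrite mulrA -(rmorphM (base_point p_gt2 Xp)) /= -[powmap _ _]/(powmap _ (r * co i a)).
  by rewrite coD eqxx addr0.
rewrite mulrA -[powmap _ r * powmap _ _]/(base_point p_gt2 Xp r * base_point p_gt2 Xp (co j a)).
by rewrite -rmorphM /= coD eq_sym (negPf ji).
Qed.

(** The upper bound counts the monomials that contain [X]; the lower one counts the [p ^ 2]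
    monomials without [X], which span A together with A X. *)
Lemma line_dim : (\dim L = p ^ 3 - p ^ 2)%N.
Proof.
have T := heis_tripleC heis; have gT := left_generatesC gen.
have [cf [cfE cf_pbw cf_out]] := pbw_coordinates p_gt1 T gT dimA.
have [_ ZX _ _] := heis.
have pbwX j i l : pbw Y X Z (j, i, l) * X = pbw Y X Z (j, i.+1, l).
  rewrite /pbw /= -mulrA (_ : Z ^+ l * X = X * Z ^+ l); first by rewrite !mulrA -(mulrA (Y ^+ j) (X ^+ i) X) -exprSr.
  by apply/esym/commrX; exact: esym.
pose S1 := <<[seq pbw Y X Z (nat_of_ord j.1, (nat_of_ord j.2).+1, nat_of_ord l)
  | j <- enum (predT : pred ('I_p * 'I_p.-1)), l <- enum 'I_p]>>%VS.
have LS1 : (L <= S1)%VS.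
  apply/subvP => _ /memv_imgP[b _ ->]; rewrite lfunE /= (cfE b) mulr_suml.
  apply: memv_suml => -[[j i] l] _; rewrite -scalerAl memvZ // pbwX /=.
  have [ip|ip] := ltnP i.+1 p; last by rewrite (pbw_big T) ?mem0v //= ip orbT.
  have ip' : (i < p.-1)%N by rewrite -ltnS prednK // ltnW.
  apply: memv_span; apply/allpairsP.
  by exists ((j, Ordinal ip'), l); rewrite !mem_enum.
have d1 : (\dim L <= p * p.-1 * p)%N.
  apply: leq_trans (dimvS LS1) _; apply: leq_trans (dim_span _) _.
  by rewrite size_allpairs -!cardE !card_prod !card_ord.
pose S0 := <<[seq pbw Y X Z (nat_of_ord j, 0, nat_of_ord l)%N | j <- enum 'I_p, l <- enum 'I_p]>>%VS.
have full : (fullv <= S0 + L)%VS.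
  apply/subvP => a _; rewrite (cfE a); apply: memv_suml => -[[j i] l] _; rewrite memvZ //= /ords /=.
  case: (i : nat) => [|i'].
    apply: (subvP (addvSl _ _)); apply: memv_span; apply/allpairsP.
    by exists (j, l); rewrite !mem_enum.
  by apply: (subvP (addvSr _ _)); rewrite -pbwX; exact: mulX_in_line.
have d0 : (\dim S0 <= p * p)%N.
  by apply: leq_trans (dim_span _) _; rewrite size_allpairs size_enum_ord.
have := leq_trans (dimvS full) (dimv_add_leqif S0 L).1; rewrite dimA.
have p0 : (0 < p)%N := ltnW p_gt1.
have E2 : (p ^ 2 = p * p)%N by rewrite expnS expn1.
have E3 : (p ^ 3 = p * p.-1 * p + p * p)%N.
  have -> : (p * p.-1 * p = p.-1 * (p * p))%N by rewrite (mulnC p) mulnA.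
  by rewrite expnS E2 -{1}(prednK p0) mulSn addnC.
by move: d0 d1; rewrite E3 E2; lia.
Qed.

Lemma module_dim : mdim V = (p ^ 2)%N.
Proof.
have [q [ql qM qs qk]] := module_orbit.
pose f := HB.pack_for {linear A -> 'cV[k]_(mdim V)} q
  (GRing.isLinear.Build k A 'cV[k]_(mdim V) *:%R q ql).
have full : limg (linfun f) = fullv.
  apply/eqP; rewrite eqEsubv subvf; apply/subvP => v _; have [w ->] := qs v.
  by have := memv_img (linfun f) (memvf w); rewrite lfunE.
have ker : lker (linfun f) = L.
  by apply/vspaceP => w; rewrite memv_ker lfunE /= qk.
have := limg_ker_dim (linfun f) fullv; rewrite capfv ker full line_dim dimA.
have -> : \dim {:'cV[k]_(mdim V)} = mdim V by rewrite dimvf /dim /= muln1.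
have : (p ^ 2 <= p ^ 3)%N by rewrite leq_pexp2l // ltnW.
by lia.
Qed.

Lemma bc_module_orbit (K : fieldType) (iota : {rmorphism k -> K}) :
  exists m0 : 'cV[K]_(mdim V), bc_rep V (bc_in iota X) *m m0 = 0 /\
    forall v, exists a : bc iota A, v = bc_rep V a *m m0.
Proof.
have [q [ql qM qs qk]] := module_orbit.
have in_rep a : bc_rep V (bc_in iota a) = map_mx iota (V a).
  by rewrite /bc_rep bc_liftK //; exact: bc_rep_iota.
exists (map_mx iota (q 1)); split=> [|v].
  rewrite in_rep -map_mxM qM mulr1.
  have /eqP -> : q X == 0 by rewrite qk -{1}[X]mul1r mulX_in_line.
  by rewrite map_mx0.
have /choice[w wE] : forall i : 'I_(mdim V), exists w, delta_mx i 0 = q w by move=> i; exact: qs.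
exists (\sum_i v i 0 *: bc_in iota (w i)).
rewrite linear_sum /= mulmx_suml {1}(matrix_sum_delta v); apply: eq_bigr => i _.
rewrite big_ord1 linearZ /= -scalemxAl in_rep -map_mxM qM mulr1 -wE.
by rewrite map_delta_mx.
Qed.

Lemma base_point_support : homog_prime eps (point_of eps (base_point p_gt2 Xp)) ->
  primitive_elt H X -> pi_support p H V (point_of eps (base_point p_gt2 Xp)).
Proof.
move=> hp primX; split=> //; exists k, idfun, (base_point p_gt2 Xp); split=> //.
  by apply: primitive_pi_point => //; exact: flat_base_point.
have [q [ql qM qs qk]] := module_orbit.
have /choice[w wE] : forall i : 'I_(mdim V), exists w, delta_mx i 0 = q w by move=> i; exact: qs.
pose f := HB.pack_for {linear A -> 'cV[k]_(mdim V)} q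
  (GRing.isLinear.Build k A 'cV[k]_(mdim V) *:%R q ql).
(* [eps] kills A X and so induces a functional on the module; together with the class of 1 it
   exhibits a trivial summand. *)
pose e : 'rV[k]_(mdim V) := \row_i (eps (w i) : k).
have eE a : (e *m q a) 0 0 = eps a.
  have : q (a - \sum_i q a i 0 *: w i) == 0.
    rewrite -[q _]/(f _) linearB subr_eq0; apply/eqP.
    rewrite linear_sum {1}[f a]matrix_sum_delta; apply: eq_bigr => i _.
    by rewrite big_ord1 linearZ /= wE.
  rewrite qk => /memv_imgP[b _]; rewrite lfunE /= => E.
  have -> : a = b * X + \sum_i q a i 0 *: w i by rewrite -E subrK.
  have -> : q (b * X + \sum_i q a i 0 *: w i) = q a by rewrite -E subrK.
  rewrite linearD linear_sum /= rmorphM /= eX mxE.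
  rewrite [X in _ = X + _](mulr0 (eps b : k)) add0r; apply: eq_bigr => i _.
  by rewrite mxE linearZ /= mulrC.
have rhoE : bc_rep V (base_point p_gt2 Xp (truncX k p)) = V X.
  rewrite base_pointE powmapX //; last exact: bc_in_pth.
  by rewrite /bc_rep bc_liftK ?map_mx_id //; exact: bc_rep_iota.
apply: (@fixed_not_projective k p p_gt1 _ _ _ e (q 1)).
- by move=> c r; rewrite /= !linearZ.
- rewrite /= rhoE; apply/rowP => j; rewrite [RHS]mxE.
  have -> : (e *m V X) 0 j = (e *m V X *m (delta_mx j 0 : 'cV[k]_(mdim V))) 0 0.
    by rewrite -colE [RHS]mxE.
  by rewrite -mulmxA wE qM eE rmorphM /= eX; exact: mul0r.
- rewrite /= rhoE qM mulr1; apply/eqP; rewrite qk -{1}[X]mul1r; exact: mulX_in_line.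
by apply/eqP => e0; have := eE 1; rewrite e0 mxE rmorph1 => /eqP; rewrite eq_sym oner_eq0.
Qed.

Hypotheses (primX : primitive_elt H X) (primY : primitive_elt H Y) (primZ : primitive_elt H Z).

Lemma support_base_point P : closed_point eps (point_of eps (base_point p_gt2 Xp)) ->
  pi_support p H V P -> P = point_of eps (base_point p_gt2 Xp).
Proof.
move=> [_ closed] [hP [K [iota [alpha [[fl [B [hB cB lB aB]]] PE nproj]]]]].
(* Closedness of the base point reduces the equality to one inclusion, which has the form given by
   [point_inclusion]. *)
apply: closed => //; rewrite PE.
have [a [b [c [ab uE]]]] := hopf_sub_adapted charp p_gt2 heis gen dimA primX primY primZ eX eY eZ hB cB.
have [f fE] := uE _ (aB (truncX K p)); set u := alpha _ in fE.
have charK : p \in [pchar K] by rewrite (fmorph_pchar iota).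
have T := bc_heis_triple heis iota; have gT := bc_left_generates heis gen (iota := iota).
have dT := bc_dim dimA iota; have [m0 [Xm0 m0g]] := bc_module_orbit iota.
set XK := bc_in iota X in fE T gT Xm0; set YK := bc_in iota Y in fE T gT.
set ZK := bc_in iota Z in fE T gT; set W := a *: XK + b *: YK + c *: ZK in fE.
have Wp : W ^+ p = 0 := heis_pth charK p_gt2 a b c T.
have uW : u \in monoV p ZK W.
  rewrite fE; apply: memv_suml => i _; apply: memv_suml => j _; apply: memvZ.
  exact: (mono_in T Wp).
have [b0|b0] := eqVneq b 0; last first.
  by case: nproj; apply: (projective_transverse charK p_gt2 T gT dT Xm0 m0g module_dim fl b0 uW).
have [_ ZX _ [XKp _ _]] := T.
have uX : u \in monoV p ZK XK.
  have WX : W \in monoV p ZK XK.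
    rewrite /W b0 scale0r addr0 memvD ?memvZ //.
      by have := mono_in T XKp 1 0; rewrite expr0 mulr1 expr1.
    by have := mono_in T XKp 0 1; rewrite expr0 mul1r expr1.
  exact: (subvP (monoV_sub T ZX XKp WX)).
have [c0 [m [q1 [q2 [q1C q2C uS]]]]] := monoV_split T uX.
have e0 (d : A) : epsK eps (bc_in iota d) = iota (eps d) by exact: epsK_in.
have c00 : c0 = 0.
  have := epsK_alpha eps p_gt2 alpha (truncX K p); rewrite trunc_epsX // -/u uS expr2.
  have E0 : epsK eps (0 : bc iota A) = 0 by rewrite -(bc_in0 iota) e0 linear0 rmorph0.
  have eD (v w : bc iota A) : epsK eps (v + w) = epsK eps v + epsK eps w.
    by rewrite -[v in LHS]scale1r epsK_lin mul1r.
  have eS d (v : bc iota A) : epsK eps (d *: v) = d * epsK eps v.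
    by rewrite -[_ *: _]addr0 epsK_lin E0 addr0.
  have eX' : epsK eps XK = 0 by rewrite e0 eX rmorph0.
  have eZ' : epsK eps ZK = 0 by rewrite e0 eZ rmorph0.
  by rewrite !eD !eS epsK1 !epsKM eX' eZ' !mul0r mulr0 mulr1 !addr0.
move: uS; rewrite c00 scale0r add0r => uS.
have [m00|m0n] := eqVneq m 0; last first.
  by case: nproj; apply: (projective_central charK p_gt2 T gT dT Xm0 m0g module_dim m0n q1C q2C uS).
have [e eE] := power_in_ideal charK p_gt2 T dT module_dim q1C q2C.
have [i0 [co fr]] : exists i0 co, @right_frame k p A X _ i0 (fun i : 'I_p * 'I_p => Y ^+ i.1 * Z ^+ i.2) co.
  have [co fr] := right_frame_exists (ltnW p_gt1) p_gt1 heis gen dimA.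
  by exists (Ordinal (ltnW p_gt1), Ordinal (ltnW p_gt1)), co.
have uP : alpha (truncX K p) ^+ p.-1 = e * bc_in iota X by rewrite -/u uS m00 scale0r add0r.
have sub := @point_inclusion k A eps p p_gt2 X Xp _ i0 _ co fr K iota alpha e uP.
exact: sub.
Qed.

End InducedModule.

(** * A class of degree 2 that makes the base point closed *)

Section Carry.
Variables (k : fieldType) (p : nat) (p_gt1 : (1 < p)%N).
Local Notation R := (truncated k p).

(* The cocycle of the extension of [k[s]/s^p] given by [k[s]/s^(p+1)]. *)
Definition carry (l : seq R) : k :=
  if l is [:: a; b] then ((a : {poly k}) * (b : {poly k}))`_p else 0.

Lemma trunc_mulE (a b : R) :
  ((a * b : R) : {poly k}) = take_poly p ((a : {poly k}) * (b : {poly k})).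
Proof.
apply/polyP => i; rewrite coef_take_poly; case: ltnP => ip.
  exact: (truncpM_coef p_gt1 a b ip).
by rewrite nth_default // (leq_trans (size_trunc p_gt1 _)).
Qed.

Lemma coef_take_mul (P Q : {poly k}) : (take_poly p P * Q)`_p = (P * Q)`_p - P`_p * Q`_0.
Proof.
suff -> : (P * Q)`_p = (take_poly p P * Q)`_p + P`_p * Q`_0 by rewrite addrK.
rewrite -{1}(poly_take_drop p P) mulrDl coefD; congr (_ + _).
by rewrite -mulrA (mulrC 'X^p) mulrA coefMXn ltnn subnn coefM big_ord1 coef_drop_poly add0n.
Qed.

Lemma carry_multilinear : multilinear carry.
Proof.
have f1 c (a b y : R) : (((c *: a + b : R) : {poly k}) * (y : {poly k}))`_p =
    c * ((a : {poly k}) * (y : {poly k}))`_p + ((b : {poly k}) * (y : {poly k}))`_p.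
  have -> : ((c *: a + b : R) : {poly k}) = c *: (a : {poly k}) + (b : {poly k}) by [].
  by rewrite mulrDl -scalerAl coefD coefZ.
have f2 c (a b y : R) : ((y : {poly k}) * ((c *: a + b : R) : {poly k}))`_p =
    c * ((y : {poly k}) * (a : {poly k}))`_p + ((y : {poly k}) * (b : {poly k}))`_p.
  by rewrite mulrC f1 (mulrC (a : {poly k})) (mulrC (b : {poly k})).
move=> [|x [|x' s1]] s2 c a b; last by case: s1 => [|? ?]; rewrite /= mulr0 addr0.
  by case: s2 => [|y [|? ?]]; [rewrite /= mulr0 addr0 | exact: f1 | rewrite /= mulr0 addr0].
by case: s2 => [|y s2]; [exact: f2 | rewrite /= mulr0 addr0].
Qed.

(** Associativity of the product of polynomials before truncation, read off in degree p, is the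
    cocycle identity. *)
Lemma carry_cocycle : cocycle (@trunc_eps k p) 2 carry.
Proof.
have cc : cochain 2 carry.
  by split; [exact: carry_multilinear | case=> [|a [|b [|c s]]]].
split=> // s; have [s3|s3] := eqVneq (size s) 3; last first.
  by have [_] := cochain_cobound (@trunc_eps_lin k p) cc; apply.
case: s s3 => [|a [|b [|c [|? ?]]]] // _.
rewrite coboundE !barE2 barE1 /carry !trunc_mulE coef_take_mul.
rewrite [(a : {poly k}) * take_poly p _]mulrC coef_take_mul /trunc_eps.
rewrite -mulrA [(_ * _) * (a : {poly k})]mulrC; ring.
Qed.

Lemma carry_top : carry [:: truncX k p; truncX k p ^+ p.-1] = 1.
Proof.
have pp : (p.-1 < p)%N by rewrite ltn_predL ltnW.
have E n : (n < p)%N -> ((truncX k p ^+ n : R) : {poly k}) = 'X^n.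
  move=> np; apply/polyP => i; rewrite truncXn coef_truncp //; case: ltnP => // pi.
  by rewrite coefXn gtn_eqF // (leq_trans np).
by rewrite /carry E // -[truncX k p]expr1 E // -exprS prednK ?(ltnW p_gt1) // coefXn eqxx.
Qed.

End Carry.

Section ClosedBasePoint.
Variables (k : fieldType) (A : falgType k) (eps : {lrmorphism A -> k^o}).
Variables (p : nat) (p_gt2 : (2 < p)%N).
Variable theta : {lrmorphism A -> truncated k p}.
Hypothesis eps_theta : forall a, trunc_eps (theta a) = eps a.

Let p_gt1 : (1 < p)%N. Proof. exact: ltnW. Qed.

(** The pullback of [carry] along [theta] takes the value 1 on the cycle of [t], so
    [closed_point_rational] applies in degree 2. *)
Lemma base_point_closed t (tp : t ^+ p = 0) : theta t = truncX k p ->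
  closed_point eps (point_of eps (base_point p_gt2 tp)).
Proof.
move=> tt; have fc : cocycle (K := k) eps 2 (fun s => carry (map theta s)).
  exact: (@cocycle_comp k A (truncated k p) theta eps (@trunc_eps k p) eps_theta 2 _ (carry_cocycle k p_gt1)).
apply: (closed_point_rational p_gt2 (n := 0) fc).
rewrite /point_class base_pointE powmapX //; last exact: bc_in_pth.
have -> : zeta p (bc_in idfun t) 1 = map (@bc_in k k idfun A) [:: t; t ^+ p.-1].
  by rewrite /zeta /= bc_inX.
rewrite bc_cochain_in; last by case: fc => -[].
have -> : map theta [:: t; t ^+ p.-1] = [:: truncX k p; truncX k p ^+ p.-1].
  by rewrite /= rmorphXn /= tt.
by rewrite carry_top // rmorph1 => /eqP; rewrite oner_eq0.
Qed.

End ClosedBasePoint.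

(** * The shear that adds a socle element to X *)

Section Shear.
Variables (k : fieldType) (A : falgType k).
Variables (p : nat) (charp : p \in [pchar k]) (p_gt2 : (2 < p)%N) (X Y Z : A).
Hypothesis heis : heis_triple p 1 X Y Z.

Let p_gt1 : (1 < p)%N. Proof. exact: ltnW. Qed.

Definition socle := Y ^+ p.-1 * Z ^+ p.-1.

(** Moving [X] past [Y ^+ p.-1] costs a term with a further factor [Z], which [Z ^+ p.-1] kills. *)
Lemma socleX : socle * X = X * socle.
Proof.
have T := heis_tripleC heis; have [_ ZX _ [_ _ Zp]] := heis.
have p0 : (0 < p)%N := ltnW p_gt1.
rewrite /socle mulrA (heis_YXn T) mulrBl -scalerAl -[_ * Z * _]mulrA -exprS prednK //.
by rewrite Zp mulr0 scaler0 subr0 -!mulrA; congr (_ * _); apply/esym/commrX; exact: esym.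
Qed.

Lemma socleY : socle * Y = 0 /\ Y * socle = 0.
Proof.
have [_ _ ZY [_ Yp _]] := heis; have p0 : (0 < p)%N := ltnW p_gt1.
rewrite /socle; split; last by rewrite mulrA -exprS prednK // Yp mul0r.
rewrite -mulrA (_ : Z ^+ p.-1 * Y = Y * Z ^+ p.-1); last by apply/esym/commrX; exact: esym.
by rewrite mulrA -exprSr prednK // Yp mul0r.
Qed.

Lemma socleZ : socle * Z = 0 /\ Z * socle = 0.
Proof.
have [_ _ ZY [_ _ Zp]] := heis; have p0 : (0 < p)%N := ltnW p_gt1.
rewrite /socle; split; first by rewrite -mulrA -exprSr prednK // Zp mulr0.
rewrite mulrA (_ : Z * Y ^+ p.-1 = Y ^+ p.-1 * Z); last by apply: commrX.
by rewrite -mulrA -exprS prednK // Zp mulr0.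
Qed.

Lemma socle_sq : socle * socle = 0.
Proof.
rewrite {2}/socle; case: p p_gt2 (socleY) => // -[//|q] _ [sY _].
by rewrite /= exprS !mulrA sY !mul0r.
Qed.

Lemma socle_exp n : (1 < n)%N -> socle ^+ n = 0.
Proof. by case: n => [|[|n]] // _; rewrite !exprS mulrA socle_sq mul0r. Qed.

(** As [socle] commutes with [X] and squares to 0, the p-th power is additive on the sum. The scalar
    [c] is 1 for the automorphism and -1 for its inverse. *)
Lemma shear_triple c : heis_triple p 1 (X + c *: socle) Y Z.
Proof.
have [XY ZX ZY [Xp Yp Zp]] := heis; have [sY Ys] := socleY; have [sZ Zs] := socleZ.
split=> //.
- by rewrite mulrDl mulrDr -scalerAl -scalerAr sY Ys !scaler0 !addr0.
- by rewrite mulrDl mulrDr -scalerAl -scalerAr sZ Zs ZX.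
split=> //.
have chA : p \in [pchar A] by rewrite pchar_lalg.
have cm : GRing.comm X (c *: socle) by rewrite /GRing.comm -scalerAl -scalerAr socleX.
have := pFrobenius_autD_comm chA cm; rewrite !pFrobenius_autE => ->.
by rewrite Xp add0r exprZn socle_exp ?scaler0.
Qed.

Lemma shear_generates c : left_generates X Y Z -> left_generates (X + c *: socle) Y Z.
Proof.
move=> g U U1 UP; apply: g => // w wU; have [Xw Yw Zw] := UP w wU; split=> //.
have pw (G : A) n v : (forall v, v \in U -> G * v \in U) -> v \in U -> G ^+ n * v \in U.
  by move=> GU vU; elim: n => [|n IH]; rewrite ?mul1r ?exprS -?mulrA ?GU.
have sU : socle * w \in U.
  rewrite /socle -mulrA; apply: (pw) => [v /UP[]//|].
  by apply: (pw) => // v /UP[].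
have -> : X * w = (X + c *: socle) * w - c *: (socle * w).
  by rewrite mulrDl -scalerAl addrK.
by rewrite memvB // memvZ.
Qed.

(** In the expansion only the pure power of [socle] has no factor [X], and it vanishes because p - 1
    > 1. *)
Lemma shear_power c : exists e, (X + c *: socle) ^+ p.-1 = e * X.
Proof.
pose r := c *: socle; have rX n : X * r ^+ n = r ^+ n * X.
  by apply: commrX; rewrite /GRing.comm /r -scalerAl -scalerAr socleX.
have vn n : exists e, (X + r) ^+ n = r ^+ n + e * X.
  elim: n => [|n [e IH]]; first by exists 0; rewrite mul0r addr0.
  exists (r ^+ n + (X + r) * e); rewrite exprS IH mulrDr mulrDl -exprS rX mulrA.
  by rewrite [in RHS]mulrDl addrA; congr (_ + _); exact: addrC.
have [e ->] := vn p.-1; exists e.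
have p1 : (1 < p.-1)%N by move: p_gt2; lia.
by rewrite /r exprZn socle_exp // scaler0 add0r.
Qed.

End Shear.

(** * Twisted Hopf structures *)

Section TensorMaps.
Variable k : fieldType.
Implicit Types (U V W : vectType k) (P : lmodType k).

Lemma tens_sum V W (X : tens V W) :
  X = \sum_i \sum_j X i j *: tprod (evec i) (evec j).
Proof.
rewrite {1}(matrix_sum_delta X); apply: eq_bigr => i _; apply: eq_bigr => j _; congr (_ *: _).
apply/matrixP => a b; rewrite !mxE /evec !(coord_free _ _ (basis_free (vbasisP _))).
by rewrite -natrM mulnb; congr ((_ && _)%:R); exact: eq_sym.
Qed.

Lemma tens_ext V W P (f g : tens V W -> P) : linear f -> linear g ->
  (forall v w, f (tprod v w) = g (tprod v w)) -> f =1 g.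
Proof.
move=> fl gl fg X.
pose F := HB.pack_for {linear tens V W -> P} f (GRing.isLinear.Build k (tens V W) P *:%R f fl).
pose G := HB.pack_for {linear tens V W -> P} g (GRing.isLinear.Build k (tens V W) P *:%R g gl).
rewrite -[f X]/(F X) -[g X]/(G X) (tens_sum X) !linear_sum; apply: eq_bigr => i _.
rewrite !linear_sum; apply: eq_bigr => j _; rewrite !linearZ /=; congr (_ *: _); exact: fg.
Qed.

Lemma tmap_linear V W V' W' (f : V -> V') (g : W -> W') : linear (tmap f g).
Proof. exact: tlift_linear. Qed.

Lemma tmap_tprod V W V' W' (f : V -> V') (g : W -> W') v w : linear f -> linear g ->
  tmap f g (tprod v w) = tprod (f v) (g w).
Proof.
move=> fl gl; rewrite /tmap tlift_tprod // => [y|x] c a b.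
  by rewrite fl tprod_linearl.
by rewrite gl tprod_linearr.
Qed.

Lemma tassoc_linear U V W : linear (@tassoc k U V W).
Proof. exact: tlift_linear. Qed.

Lemma tassoc_tprodl U V W (X : tens U V) (w : W) :
  tassoc (tprod X w) = tlift (fun u v => tprod u (tprod v w)) X.
Proof.
rewrite /tassoc tlift_tprod // => [y|Y] c a b; first exact: tlift_linear.
rewrite /tlift scaler_sumr -big_split; apply: eq_bigr => i _.
rewrite scaler_sumr -big_split; apply: eq_bigr => j _ /=.
by rewrite tprod_linearr tprod_linearr scalerDr !scalerA mulrC.
Qed.

Lemma tassoc_tprod U V W (u : U) (v : V) (w : W) :
  tassoc (tprod (tprod u v) w) = tprod u (tprod v w).
Proof.
rewrite tassoc_tprodl tlift_tprod // => [y|x] c a b; first exact: tprod_linearl.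
by rewrite tprod_linearl tprod_linearr.
Qed.

Lemma tmul_linearl (A : falgType k) (Y : tens A A) : linear (fun X : tens A A => tmul X Y).
Proof. by move=> c X X'; rewrite /tmul tlift_linear. Qed.

Lemma tmul_tprodl (A : falgType k) (a b : A) (Y : tens A A) :
  tmul (tprod a b) Y = tlift (fun c d => tprod (a * c) (b * d)) Y.
Proof.
rewrite /tmul tlift_tprod // => [y|x] e u v.
  rewrite /tlift scaler_sumr -big_split; apply: eq_bigr => i _.
  rewrite scaler_sumr -big_split; apply: eq_bigr => j _ /=.
  by rewrite mulrDl -scalerAl tprod_linearl scalerDr !scalerA mulrC.
rewrite /tlift scaler_sumr -big_split; apply: eq_bigr => i _.
rewrite scaler_sumr -big_split; apply: eq_bigr => j _ /=.
by rewrite mulrDl -scalerAl tprod_linearr scalerDr !scalerA mulrC.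
Qed.

Lemma tmul_linearr (A : falgType k) (X : tens A A) : linear (tmul X).
Proof.
move=> c Y Y'; move: X; apply: tens_ext => [e u v|e u v|a b].
- exact: tmul_linearl.
- by rewrite !tmul_linearl !scalerDr !scalerA mulrC addrACA.
by rewrite !tmul_tprodl tlift_linear.
Qed.

Definition tswap (A : falgType k) (X : tens A A) : tens A A := tlift (fun b c => tprod c b) X.

Lemma tswap_linear (A : falgType k) : linear (@tswap A).
Proof. exact: tlift_linear. Qed.

Lemma tswap_tprod (A : falgType k) (a b : A) : tswap (tprod a b) = tprod b a.
Proof.
by rewrite /tswap tlift_tprod // => [y|x] c u v; rewrite ?tprod_linearl ?tprod_linearr.
Qed.

End TensorMaps.

Section TwistedHopf.
Variables (k : fieldType) (A : falgType k) (eps : {lrmorphism A -> k^o}) (H : hopf eps).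
Variable phi : aug_aut eps.
Local Notation psi := (aut_inv phi).
Local Notation phi2 := (tmap phi phi).

Let phil : linear phi. Proof. by move=> c a b; rewrite linearP. Qed.
Let psil : linear psi. Proof. by move=> c a b; rewrite linearP. Qed.
Let cl : linear (comult H). Proof. exact: comult_linear. Qed.

Lemma phi2_tprod a b : phi2 (tprod a b) = tprod (phi a) (phi b).
Proof. exact: tmap_tprod. Qed.

Lemma twist_linear : linear (twist phi (comult H)).
Proof. by move=> c a b; rewrite /twist psil cl tmap_linear. Qed.

(** Evaluation at [phi a] removes the inverse, so that the axioms of the twisted structure are
    images of the original ones. *)
Lemma twist_phi a : twist phi (comult H) (phi a) = phi2 (comult H a).
Proof. by rewrite /twist autK. Qed.

Lemma phi2_tmul X Y : phi2 (tmul X Y) = tmul (phi2 X) (phi2 Y).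
Proof.
move: X; apply: tens_ext => [c u v|c u v|a b].
- by rewrite tmul_linearl tmap_linear.
- by rewrite tmap_linear tmul_linearl.
move: Y; apply: tens_ext => [c u v|c u v|c d].
- by rewrite tmul_linearr tmap_linear.
- by rewrite tmap_linear tmul_linearr.
by rewrite tmul_tprod !phi2_tprod tmul_tprod !rmorphM.
Qed.

Lemma twist1 : twist phi (comult H) 1 = tprod 1 1.
Proof. by rewrite -[1 in LHS](rmorph1 phi) twist_phi comult1 phi2_tprod rmorph1. Qed.

Lemma twistM a b : twist phi (comult H) (a * b) =
  tmul (twist phi (comult H) a) (twist phi (comult H) b).
Proof. by rewrite /twist rmorphM comultM phi2_tmul. Qed.

Lemma tmap_twistl X : tassoc (tmap (twist phi (comult H)) idfun (phi2 X)) =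
  tmap phi phi2 (tassoc (tmap (comult H) idfun X)).
Proof.
have idl : linear (@idfun A) by [].
have p2l : linear phi2 by exact: tmap_linear.
move: X; apply: tens_ext => [c u v|c u v|a b].
- by rewrite tmap_linear tmap_linear tassoc_linear.
- by rewrite tmap_linear tassoc_linear tmap_linear.
rewrite phi2_tprod !(tmap_tprod _ _ _ idl) //; last exact: twist_linear.
rewrite twist_phi /=; move: (comult H a); apply: tens_ext => [c u v|c u v|u v].
- by rewrite p2l tprod_linearl tassoc_linear.
- by rewrite tprod_linearl tassoc_linear tmap_linear.
by rewrite phi2_tprod !tassoc_tprod !tmap_tprod // phi2_tprod.
Qed.

Lemma tmap_twistr X : tmap idfun (twist phi (comult H)) (phi2 X) =
  tmap phi phi2 (tmap idfun (comult H) X).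
Proof.
have idl : linear (@idfun A) by [].
have p2l : linear phi2 by exact: tmap_linear.
move: X; apply: tens_ext => [c u v|c u v|a b].
- by rewrite tmap_linear tmap_linear.
- by rewrite tmap_linear tmap_linear.
rewrite phi2_tprod !(tmap_tprod _ _ idl) //; last exact: twist_linear.
by rewrite twist_phi tmap_tprod.
Qed.

Lemma twistA a : tassoc (tmap (twist phi (comult H)) idfun (twist phi (comult H) a)) =
  tmap idfun (twist phi (comult H)) (twist phi (comult H) a).
Proof. by rewrite {2 4}/twist tmap_twistl tmap_twistr comultA. Qed.

Lemma tlift_twist (f g : A -> A -> A) a :
  (forall b, linear (f^~ b)) -> (forall b, linear (f b)) ->
  (forall b, linear (g^~ b)) -> (forall b, linear (g b)) ->
  (forall b c, f (phi b) (phi c) = phi (g b c)) ->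
  tlift f (twist phi (comult H) a) = phi (tlift g (comult H (psi a))).
Proof.
move=> fl fr gl gr fg; rewrite /twist; move: (comult H _).
apply: tens_ext => [c u v|c u v|u v].
- by rewrite tmap_linear tlift_linear.
- by rewrite tlift_linear phil.
by rewrite phi2_tprod !tlift_tprod.
Qed.

Lemma twist_counitl a : tlift (fun b c => eps b *: c) (twist phi (comult H) a) = a.
Proof.
rewrite (@tlift_twist _ (fun b c => eps b *: c)) ?counitl ?aut_invK //.
- by move=> b c u v; rewrite linearP /= scalerDl scalerA.
- by move=> b c u v; rewrite scalerDr !scalerA mulrC.
- by move=> b c u v; rewrite linearP /= scalerDl scalerA.
- by move=> b c u v; rewrite scalerDr !scalerA mulrC.
by move=> b c; rewrite aut_eps linearZ.
Qed.

Lemma twist_counitr a : tlift (fun b c => eps c *: b) (twist phi (comult H) a) = a.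
Proof.
rewrite (@tlift_twist _ (fun b c => eps c *: b)) ?counitr ?aut_invK //.
- by move=> b c u v; rewrite scalerDr !scalerA mulrC.
- by move=> b c u v; rewrite linearP /= scalerDl scalerA.
- by move=> b c u v; rewrite scalerDr !scalerA mulrC.
- by move=> b c u v; rewrite linearP /= scalerDl scalerA.
by move=> b c; rewrite aut_eps linearZ.
Qed.

Definition twist_antipode a := phi (antipode H (psi a)).

Lemma twist_antipode_linear : linear twist_antipode.
Proof. by move=> c a b; rewrite /twist_antipode psil antipode_linear phil. Qed.

Lemma eps_psi a : eps (psi a) = eps a.
Proof. by rewrite -(aut_eps phi) aut_invK. Qed.

Lemma twist_antipodel a :
  tlift (fun b c => twist_antipode b * c) (twist phi (comult H) a) = eps a *: 1.
Proof.
rewrite (@tlift_twist _ (fun b c => antipode H b * c)) ?antipodel ?eps_psi.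
- by rewrite linearZ /= rmorph1.
- by move=> b c u v; rewrite twist_antipode_linear mulrDl -scalerAl.
- by move=> b c u v; rewrite mulrDr -scalerAr.
- by move=> b c u v; rewrite antipode_linear mulrDl -scalerAl.
- by move=> b c u v; rewrite mulrDr -scalerAr.
by move=> b c; rewrite /twist_antipode autK rmorphM.
Qed.

Lemma twist_antipoder a :
  tlift (fun b c => b * twist_antipode c) (twist phi (comult H) a) = eps a *: 1.
Proof.
rewrite (@tlift_twist _ (fun b c => b * antipode H c)) ?antipoder ?eps_psi.
- by rewrite linearZ /= rmorph1.
- by move=> b c u v; rewrite mulrDl -scalerAl.
- by move=> b c u v; rewrite twist_antipode_linear mulrDr -scalerAr.
- by move=> b c u v; rewrite mulrDl -scalerAl.
- by move=> b c u v; rewrite antipode_linear mulrDr -scalerAr.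
by move=> b c; rewrite /twist_antipode autK rmorphM.
Qed.

Definition twisted_hopf : hopf eps :=
  Hopf twist_linear twist1 twistM twistA twist_counitl twist_counitr
    twist_antipode_linear twist_antipodel twist_antipoder.

Lemma twisted_primitive g : primitive_elt H g -> primitive_elt twisted_hopf (phi g).
Proof.
move=> gp; rewrite /primitive_elt /= twist_phi gp.
have := tmap_linear phi phi 1 (tprod g 1) (tprod 1 g); rewrite !scale1r => ->.
by rewrite !phi2_tprod rmorph1.
Qed.

Lemma twisted_cocommutative : cocommutative H -> cocommutative twisted_hopf.
Proof.
move=> cc a; rewrite -[tlift _ _]/(tswap _) /= /twist -[in RHS]cc -/(tswap _).
move: (comult H _); apply: tens_ext => [c u v|c u v|u v].
- by rewrite tmap_linear tswap_linear.
- by rewrite tswap_linear tmap_linear.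
by rewrite tswap_tprod !phi2_tprod tswap_tprod.
Qed.

(** The elements with symmetric comultiplication contain 1 and are stable under left multiplication
    by primitive elements. *)
Lemma primitive_cocommutative (X Y Z : A) : left_generates X Y Z ->
  primitive_elt H X -> primitive_elt H Y -> primitive_elt H Z -> cocommutative H.
Proof.
move=> gen pX pY pZ.
pose f a := tswap (comult H a) - comult H a.
have fl : linear f.
  by move=> c a b; rewrite /f cl tswap_linear scalerBr opprD addrACA.
pose F := HB.pack_for {linear A -> tens A A} f (GRing.isLinear.Build k A (tens A A) *:%R f fl).
suff fW a : a \in lker (linfun F).
  by move=> a; have := fW a; rewrite memv_ker lfunE /= subr_eq0 => /eqP.
apply: (gen (lker (linfun F))).
  by rewrite memv_ker lfunE /= /f comult1 tswap_tprod subrr.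
have st g w : primitive_elt H g -> w \in lker (linfun F) -> g * w \in lker (linfun F).
  rewrite !memv_ker !lfunE /= !subr_eq0 => gp /eqP w0; apply/eqP.
  rewrite comultM gp -[in RHS]w0; move: (comult H w) => U.
  have D (V W : tens A A) : tswap (V + W) = tswap V + tswap W.
    by have := @tswap_linear _ A 1 V W; rewrite !scale1r.
  rewrite !tmulDl D; move: U; apply: tens_ext => [c u v|c u v|u v].
  - by rewrite !tmul_linearr !tswap_linear scalerDr addrACA.
  - by rewrite !tswap_linear !tmul_linearr scalerDr addrACA.
  by rewrite !tmul_tprod !tswap_tprod !tmul_tprod !mul1r addrC.
by move=> w wW; split; exact: st.
Qed.

End TwistedHopf.

Import FalgLfun.

(** * Invariant forms on the tensor square *)

Section SkewForms.
Variables (k : fieldType) (A : falgType k) (E : lmodType k) (f : A -> A -> E).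

Lemma form_shift g : (forall a b, f (g * a) b = - f a (g * b)) ->
  forall n a b, f (g ^+ n * a) b = (-1) ^+ n *: f a (g ^+ n * b).
Proof.
move=> fg; elim=> [|n IH] a b; first by rewrite !mul1r scale1r.
by rewrite {1}exprS -mulrA fg IH mulrA -exprSr [(-1) ^+ n.+1]exprS mulN1r scaleNr.
Qed.

Lemma form_socle p (Y Z : A) : Z * Y = Y * Z ->
  (forall a b, f (Y * a) b = - f a (Y * b)) -> (forall a b, f (Z * a) b = - f a (Z * b)) ->
  forall a b, f (socle p Y Z * a) b = f a (socle p Y Z * b).
Proof.
move=> ZY fY fZ a b; rewrite /socle -mulrA (form_shift fY) (form_shift fZ) scalerA -exprD.
rewrite -signr_odd oddD addbb expr0 scale1r mulrA; congr (f a (_ * b)).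
by apply: commrX; apply: commr_sym; apply: commrX; exact: esym.
Qed.

End SkewForms.

Section TensorSquare.
Variables (k : fieldType) (A : falgType k) (eps : {lrmorphism A -> k^o}) (H : hopf eps).
Variable V : fdmod A.
Local Notation d := (mdim V).

Lemma tens_linearl m n (M : 'M[k]_(m, n)) c (N N' : 'M[k]_(m, n)) :
  (c *: N + N') *t M = c *: (N *t M) + N' *t M :> 'M[k]_(m * m, n * n).
Proof. by apply/matrixP => i j; rewrite !mxE mulrDl mulrA. Qed.

Lemma tens_linearr m n (M : 'M[k]_(m, n)) c (N N' : 'M[k]_(m, n)) :
  M *t (c *: N + N') = c *: (M *t N) + M *t N' :> 'M[k]_(m * m, n * n).
Proof. by apply/matrixP => i j; rewrite !mxE mulrDr mulrCA. Qed.

Definition trep (h : A -> A) (X : tens A A) : 'M[k]_(d * d) :=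
  tlift (fun b c => V (h b) *t V (h c)) X.

Lemma trep_linear h : linear (trep h).
Proof. exact: tlift_linear. Qed.

Lemma trep_tprod (h : {lrmorphism A -> A}) a b : trep h (tprod a b) = V (h a) *t V (h b).
Proof.
rewrite /trep tlift_tprod // => [y|x] c u v; first by rewrite !linearP tens_linearl.
by rewrite !linearP tens_linearr.
Qed.

Definition tact (g : A) : 'M[k]_(d * d) := V g *t 1%:M + 1%:M *t V g.

Lemma trep_mul (h : {lrmorphism A -> A}) g a : primitive_elt H g ->
  trep h (comult H (g * a)) = tact (h g) *m trep h (comult H a).
Proof.
move=> gp; rewrite comultM gp tmulDl; move: (comult H a).
apply: tens_ext => [c X Y|c X Y|u v].
- by rewrite !tmul_linearr addrACA -scalerDr trep_linear.
- by rewrite trep_linear linearP.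
have D X Y : trep h (X + Y) = trep h X + trep h Y.
  by have := trep_linear h 1 X Y; rewrite !scale1r.
rewrite !tmul_tprod !mul1r D !trep_tprod !rmorphM /tact mulmxDl !tensmx_mul !mul1mx.
by [].
Qed.

Lemma trep_prim (h : {lrmorphism A -> A}) g : primitive_elt H g ->
  trep h (comult H g) = tact (h g).
Proof.
move=> gp; rewrite gp.
have := trep_linear h 1 (tprod g 1) (tprod 1 g); rewrite !scale1r => ->.
by rewrite !trep_tprod !rmorph1.
Qed.

Lemma tensor_repE a : tensor_rep (comult H) V V a = trep idfun (comult H a).
Proof. by []. Qed.

Lemma tensor_rep_twist (phi : aug_aut eps) a :
  tensor_rep (twist phi (comult H)) V V a = trep phi (comult H (aut_inv phi a)).
Proof.
rewrite /tensor_rep /twist -[LHS]/(trep idfun (tmap phi phi (comult H (aut_inv phi a)))).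
move: (comult H _); apply: tens_ext => [c X Y|c X Y|u v].
- by rewrite tmap_linear trep_linear.
- by rewrite trep_linear.
by rewrite phi2_tprod !trep_tprod.
Qed.

Variable q : A -> 'cV[k]_d.
Hypothesis q_linear : linear q.
Hypothesis qM : forall a w, V a *m q w = q (a * w).
Hypothesis q_surj : forall v, exists w, v = q w.

Definition pt a b : 'cV[k]_(d * d) := q a *t q b.

Lemma tact_pt g a b : tact g *m pt a b = pt (g * a) b + pt a (g * b).
Proof.
have E (B C : 'M[k]_d) : (B *t C) *m pt a b = (B *m q a) *t (C *m q b) :> 'cV[k]_(d * d).
  exact: (@tensmx_mul k d d d d 1 1 B C (q a) (q b)).
by rewrite /tact mulmxDl !E !qM !mul1mx.
Qed.

Lemma pt_ext m (M : 'M[k]_(m, d * d)) : (forall a b, M *m pt a b = 0) -> M = 0.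
Proof.
move=> M0; apply/matrixP => i j; rewrite mxE.
rewrite -[j](@mxtens_unindexK d d); case: (mxtens_unindex j) => x y; have [w wE] := q_surj (delta_mx x 0).
have [w' w'E] := q_surj (delta_mx y 0).
have := M0 w w'; rewrite /pt -wE -w'E => /matrixP/(_ i 0).
suff -> : ((delta_mx x 0 : 'cV[k]_d) *t (delta_mx y 0 : 'cV[k]_d) : 'cV[k]_(d * d)) = delta_mx (mxtens_index (x, y)) 0.
  by rewrite -colE !mxE.
apply/matrixP => r c; rewrite -[r](@mxtens_unindexK d d); case: (mxtens_unindex r) => r1 r2.
rewrite !mxE mxtens_indexK /= !ord1 !eqxx !andbT -natrM mulnb; congr (_%:R).
by rewrite (can_eq (@mxtens_indexK d d)).
Qed.

End TensorSquare.

Section NotIsomorphic.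
Variables (k : fieldType) (A : falgType k) (eps : {lrmorphism A -> k^o}) (H : hopf eps).
Variables (p : nat) (charp : p \in [pchar k]) (p_gt2 : (2 < p)%N) (X Y Z : A).
Hypothesis heis : heis_triple p 1 X Y Z.
Hypothesis gen : left_generates X Y Z.
Hypothesis dimA : \dim {:A} = (p ^ 3)%N.
Hypotheses (primX : primitive_elt H X) (primY : primitive_elt H Y) (primZ : primitive_elt H Z).
Hypotheses (eX : eps X = 0) (eY : eps Y = 0) (eZ : eps Z = 0).
Hypothesis envelope : forall (B : algType k) (X' Y' Z' : B), heis_triple p 1 X' Y' Z' ->
  exists F : {lrmorphism A -> B}, [/\ F X = X', F Y = Y' & F Z = Z'].
Local Notation V := (induced_trivial eps (agenv <[X]>)).
Local Notation d := (mdim V).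
Local Notation L := (limg (linfun (X \o* @idfun A))).
Local Notation s := (socle p Y Z).

Let p_gt1 : (1 < p)%N. Proof. exact: ltnW. Qed.

Variable q : A -> 'cV[k]_d.
Hypothesis q_linear : linear q.
Hypothesis qM : forall a w, V a *m q w = q (a * w).
Hypothesis q_surj : forall v, exists w, v = q w.
Hypothesis q_ker : forall w, (q w == 0) = (w \in L).
Local Notation pt := (pt q).
Local Notation D := (tact V).

Let qD a b : q (a + b) = q a + q b.
Proof. by have := q_linear 1 a b; rewrite !scale1r. Qed.

(** The class of 1 spans V modulo Y V + Z V. As [Y] and [Z] kill [s], an invariant form with [s] in
    one variable is then determined by its value at the class of 1. *)
Lemma orbit_span a : exists c y z, q a = q (c%:A + Y * y + Z * z).
Proof.
have T := heis_tripleC heis; have gT := left_generatesC gen.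
have [cf [cfE _ _]] := pbw_coordinates p_gt1 T gT dimA.
have qX : V X *m q 1 = 0 by rewrite qM mulr1; apply/eqP; rewrite q_ker -{1}[X]mul1r mulX_in_line.
have orbE b : orb (mrep V) (q 1) b = q b by rewrite /orb qM mulr1.
have E := @orb_mono k A p X Z p_gt2 d (mrep V) (q 1) qX Y (-1) cf T cfE a.
rewrite !orbE in E; rewrite {}E.
pose P b := exists c y z, b = c%:A + Y * y + Z * z.
suff [c [y [z ->]]] : P (\sum_(i < p) \sum_(j < p) cf (i : nat, 0, j : nat)%N a *: mono Z Y i j).
  by exists c, y, z.
have PD b b' : P b -> P b' -> P (b + b').
  move=> [c [y [z ->]]] [c' [y' [z' ->]]]; exists (c + c'), (y + y'), (z + z').
  by rewrite !mulrDr scalerDl [LHS]addrACA; congr (_ + _); rewrite addrACA.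
have P0 : P 0 by exists 0, 0, 0; rewrite scale0r !mulr0 !addr0.
apply: (big_ind P) => // i _; apply: (big_ind P) => // j _.
move: (cf _ a) => e; rewrite /mono; case: (i : nat) => [|i']; last first.
  by exists 0, (e *: (Y ^+ i' * Z ^+ j)), 0; rewrite scale0r mulr0 add0r addr0 exprS -mulrA scalerAr.
case: (j : nat) => [|j']; first by exists e, 0, 0; rewrite !mulr0 !addr0 mulr1.
by exists 0, 0, (e *: Z ^+ j'); rewrite scale0r mulr0 !add0r mul1r exprS scalerAr.
Qed.

Section Invariant.
Variables (m : nat) (M : 'M[k]_(m, d * d)) (N : 'M[k]_(d * d)).
Hypotheses (MY : M *m D Y = 0) (MZ : M *m D Z = 0).
Hypothesis MX : M *m (D (X + s) - D Y *m N) = 0.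
Let f a b := M *m pt a b.

Let fD g a b : M *m D g *m pt a b = f (g * a) b + f a (g * b).
Proof. by rewrite -mulmxA (tact_pt qM) mulmxDr. Qed.

Let fY a b : f (Y * a) b = - f a (Y * b).
Proof. by apply/eqP; rewrite -addr_eq0 -fD MY mul0mx. Qed.

Let fZ a b : f (Z * a) b = - f a (Z * b).
Proof. by apply/eqP; rewrite -addr_eq0 -fD MZ mul0mx. Qed.

Let fX a b : f ((X + s) * a) b + f a ((X + s) * b) = 0.
Proof.
have MX' : M *m D (X + s) = 0 by move: MX; rewrite mulmxBr mulmxA MY mul0mx subr0.
by rewrite -fD MX' mul0mx.
Qed.

Let f_lin1 c a a' b : f (c *: a + a') b = c *: f a b + f a' b.
Proof. by rewrite /f /pt q_linear tens_linearl linearP. Qed.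

Let f_lin2 c a b b' : f a (c *: b + b') = c *: f a b + f a b'.
Proof. by rewrite /f /pt q_linear tens_linearr linearP. Qed.

Let f0l b : f 0 b = 0.
Proof. by have := f_lin1 (-1) 0 0 b; rewrite scaler0 addr0 scaleN1r addNr. Qed.

Let f0r a : f a 0 = 0.
Proof. by have := f_lin2 (-1) a 0 0; rewrite scaler0 addr0 scaleN1r addNr. Qed.

Let fDl a a' b : f (a + a') b = f a b + f a' b.
Proof. by have := f_lin1 1 a a' b; rewrite !scale1r. Qed.

Let fDr a b b' : f a (b + b') = f a b + f a b'.
Proof. by have := f_lin2 1 a b b'; rewrite !scale1r. Qed.

Let fs a b : f (s * a) b = f a (s * b).
Proof. have [_ _ ZY _] := heis; exact: (@form_socle k A _ f p Y Z ZY fY fZ a b). Qed.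

(** The rows of [M] are forms, treated all at once. The term [D Y *m N] in the hypothesis on [X]
    accounts for the difference between the twisted action of [X] and the action of [X + s]; it
    disappears because [M] kills [D Y]. *)
Lemma invariant_socle : f s 1 = 0.
Proof.
have qX : q X = 0 by apply/eqP; rewrite q_ker -{1}[X]mul1r mulX_in_line.
have fX0 b : f X b = 0 by rewrite -[f X b]/(M *m (q X *t q b)) qX tens0mx mulmx0.
have f0X a : f a X = 0 by rewrite -[f a X]/(M *m (q a *t q X)) qX tensmx0 mulmx0.
have := fX 1 1; rewrite !mulr1 fDl fDr fX0 f0X !add0r.
have -> : f 1 s = f s 1 by rewrite -{1}[s]mulr1 -fs mulr1.
rewrite -mulr2n -scaler_nat => /eqP; rewrite scaler_eq0 -(dvdn_pcharf charp).
by rewrite gtnNdvd //= => /eqP.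
Qed.

Lemma invariant_untwisted : M *m D X = 0.
Proof.
have [sY Ys] := socleY p_gt2 heis; have [sZ Zs] := socleZ p_gt2 heis.
have qf a a' b b' : q a = q a' -> q b = q b' -> f a b = f a' b'.
  by rewrite /f /pt => -> ->.
have fs1 b : f s b = 0.
  (* The summands in Y V and Z V contribute nothing: the generator moves to the other variable,
     where it kills [s]. *)
  have [c [y [z bE]]] := orbit_span b; rewrite (qf s s b _ erefl bE) !fDr.
  rewrite -[c%:A]addr0 f_lin2 invariant_socle scaler0 f0r !add0r.
  have -> : f s (Y * y) = 0 by apply: oppr_inj; rewrite -fY Ys f0l oppr0.
  have -> : f s (Z * z) = 0 by apply: oppr_inj; rewrite -fZ Zs f0l oppr0.
  by rewrite addr0.
have fsa a b : f (s * a) b = 0.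
  have [c [y [z aE]]] := orbit_span a.
  have E : q (s * a) = q (s * (c%:A + Y * y + Z * z)) by rewrite -!qM aE.
  rewrite (qf _ _ b b E erefl) !mulrDr !mulrA sY sZ !mul0r !addr0 mulr_algr.
  by rewrite -[c *: _]addr0 f_lin1 fs1 scaler0 f0l addr0.
apply: (pt_ext q_surj) => a b; rewrite fD.
have := fX a b; rewrite !mulrDl fDl fDr fsa -fs fsa !addr0; exact.
Qed.

End Invariant.

(** The form is lam(S(a) b), where S is the antiautomorphism that is -1 on the generators and lam is
    the coordinate of [s]. Skewness of S gives invariance; lam vanishes on X A and A X, so the form
    descends to V; its value at (s, 1) equals the one at (1, s), which is lam(s) = 1. *)
Lemma invariant_form : exists beta : 'rV[k]_(d * d),
  [/\ beta *m D X = 0, beta *m D Y = 0, beta *m D Z = 0 & beta *m pt s 1 != 0].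
Proof.
have [XY ZX ZY [Xp Yp Zp]] := heis.
have T := heis_tripleC heis; have gT := left_generatesC gen.
have [cf [cfE cf_pbw cf_out]] := pbw_coordinates p_gt1 T gT dimA.
have ampow (u : A) (n : nat) : (amull u : 'End(A)) ^+ n = amull (u ^+ n).
  elim: n => [|n IH]; first by rewrite expr0 amull1.
  by rewrite exprS IH exprSr amullM.
have amN (u : A) : - amull u = amull (- u) by rewrite linearN.
(* The product of ['End(A)] composes in the opposite order, so this triple yields [F] with [F a b]
   equal to S(a) b. *)
have T' : heis_triple p 1 (- amull X : 'End(A)) (- amull Y) (- amull Z).
  have am0 (u : A) : u ^+ p = 0 -> (- amull u : 'End(A)) ^+ p = 0.
    by move=> up; rewrite exprNn ampow up linear0 mulr0.
  split; rewrite ?mulrNN -?amullM ?ZX ?ZY //; last by split; exact: am0.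
  by rewrite scale1r XY scale1r linearD addrK.
have [F [FX FY FZ]] := envelope T'.
pose lam : A -> k := cf (p.-1, 0, p.-1)%N.
have lamX a : lam (a * X) = 0.
  move: a; apply: (pbw_ext (V := k^o) cfE) => [c a b|c a b|[[j i] l] _].
  - by rewrite mulrDl -scalerAl /lam linearP.
  - by rewrite scaler0 addr0.
  have -> : pbw Y X Z (j, i, l) * X = pbw Y X Z (j, i.+1, l).
    rewrite /pbw /= -!mulrA exprSr -mulrA; congr (_ * (_ * _)).
    by apply/esym/commrX; exact: esym.
  by rewrite /lam cf_pbw tripleE !andbF.
(* Commuting [X] to the right lowers the exponent of [Y]; to reach [p.-1] it would have to start at
   p. *)
have lamX' a : lam (X * a) = 0.
  move: a; apply: (pbw_ext (V := k^o) cfE) => [c a b|c a b|[[j i] l] sb].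
  - by rewrite mulrDr -scalerAr /lam linearP.
  - by rewrite scaler0 addr0.
  rewrite (mulY_pbw T) /lam linearB linearZ /= !cf_pbw !tripleE /= !andbF sub0r.
  case: j sb => [|j] sb; first by rewrite mul0r mul0r oppr0.
  by rewrite /= (_ : (j == p.-1) = false) ?andbF ?mulr0 ?oppr0 //; move: sb; rewrite /in_box /=; lia.
pose Phi a b : k := lam (F a b).
have PhiG g : F g = - amull g -> forall a b, Phi (g * a) b = - Phi a (g * b).
  move=> Fg a b; rewrite /Phi rmorphM /= lfun_mulE Fg opp_lfunE lfunE /= linearN.
  by rewrite /lam linearN.
have FR a b : F a (b * X) = F a b * X.
  have comX : forall a, F a * amulr X = amulr X * F a.
    pose G a := F a * amulr X - amulr X * F a.
    have Gl : linear G.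
      by move=> c u v; rewrite /G linearP mulrDl mulrDr -scalerAl -scalerAr scalerBr opprD addrACA.
    pose GL := HB.pack_for {linear A -> 'End(A)} G (GRing.isLinear.Build k A 'End(A) *:%R G Gl).
    have GP u : (u \in lker (linfun GL)) = (F u * amulr X == amulr X * F u).
      by rewrite memv_ker lfunE /= subr_eq0.
    move=> a'; apply/eqP; rewrite -GP; apply: gen => [|w].
      by rewrite GP rmorph1 mul1r mulr1.
    have st g : F g = - amull g -> w \in lker (linfun GL) -> g * w \in lker (linfun GL).
      rewrite !GP => Fg /eqP wG; apply/eqP; rewrite rmorphM /= -mulrA wG !mulrA; congr (_ * _).
      rewrite Fg mulNr mulrN; congr (- _); apply/lfunP => v.
      by rewrite !lfun_mulE !lfunE /= mulrA.
    by move=> wW; split; exact: st.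
  by have /lfunP/(_ b) := comX a; rewrite !lfun_mulE !lfunE.
have PhiX1 a b : Phi (a * X) b = 0.
  rewrite /Phi rmorphM /= lfun_mulE FX opp_lfunE lfunE /= /lam linearN.
  by rewrite -/lam lamX' oppr0.
have PhiX2 a b : Phi a (b * X) = 0 by rewrite /Phi FR lamX.
have Phi_lin1 b : linear (fun a => Phi a b : k^o).
  by move=> c u v; rewrite /Phi linearP add_lfunE scale_lfunE /lam linearP.
have Phi_lin2 a : linear (fun b => Phi a b : k^o).
  by move=> c u v; rewrite /Phi linearP /lam linearP.
have /choice[w wE] : forall i : 'I_d, exists w, delta_mx i 0 = q w by move=> i; exact: q_surj.
pose q' := HB.pack_for {linear A -> 'cV[k]_d} q (GRing.isLinear.Build k A 'cV[k]_d *:%R q q_linear).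
have qw a : exists b, a = b * X + \sum_i q a i 0 *: w i.
  have : q' (a - \sum_i q a i 0 *: w i) == 0.
    rewrite linearB subr_eq0; apply/eqP.
    rewrite linear_sum {1}[q' a]matrix_sum_delta; apply: eq_bigr => i _.
    by rewrite big_ord1 linearZ /= wE.
  rewrite q_ker => /memv_imgP[b _]; rewrite lfunE /= => E.
  by exists b; rewrite -E subrK.
pose beta : 'rV[k]_(d * d) := \row_r Phi (w (mxtens_unindex r).1) (w (mxtens_unindex r).2).
have betaE a b : (beta *m pt a b) 0 0 = Phi a b.
  pose P1 b' := HB.pack_for {linear A -> k^o} (fun a => Phi a b' : k^o)
    (GRing.isLinear.Build k A k^o *:%R (fun a => Phi a b' : k^o) (Phi_lin1 b')).
  pose P2 a' := HB.pack_for {linear A -> k^o} (fun b => Phi a' b : k^o)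
    (GRing.isLinear.Build k A k^o *:%R (fun b => Phi a' b : k^o) (Phi_lin2 a')).
  have E1 a' b' : Phi a' b' = \sum_i q a' i 0 * Phi (w i) b'.
    have [e aE] := qw a'; rewrite {1}aE -[Phi _ _]/(P1 b' _) linearD linear_sum /= PhiX1 add0r.
    by apply: eq_bigr => i _; exact: (linearZ_LR (P1 b')).
  have E2 a' b' : Phi a' b' = \sum_i q b' i 0 * Phi a' (w i).
    have [e bE] := qw b'; rewrite {1}bE -[Phi _ _]/(P2 a' _) linearD linear_sum /= PhiX2 add0r.
    by apply: eq_bigr => i _; exact: (linearZ_LR (P2 a')).
  rewrite E1 mxE (reindex (@mxtens_index d d)) /=; last first.
    by exists (@mxtens_unindex d d) => r _; rewrite ?mxtens_indexK ?mxtens_unindexK.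
  under [RHS]eq_bigr do rewrite E2 mulr_sumr.
  rewrite pair_bigA; apply: eq_bigr => -[i j] _.
  by rewrite !mxE mxtens_indexK /= !ord1 mulrC mulrA.
have betaD g : F g = - amull g -> beta *m D g = 0.
  move=> Fg; apply: (pt_ext q_surj) => a b; rewrite -mulmxA (tact_pt qM) mulmxDr.
  apply/matrixP => i j; rewrite !ord1 [LHS]mxE !betaE (PhiG g Fg) addNr mxE.
  by [].
exists beta; split; [exact: betaD | exact: betaD | exact: betaD |].
apply/eqP => /matrixP/(_ 0 0); rewrite betaE mxE.
have -> : Phi s 1 = Phi 1 s.
  have := @form_socle k A k^o Phi p Y Z ZY (PhiG Y FY) (PhiG Z FZ) 1 1.
  by rewrite !mulr1.
rewrite /Phi rmorph1 id_lfunE /lam; have -> : s = pbw Y X Z (p.-1, 0, p.-1)%N.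
  by rewrite /pbw /= mulr1.
rewrite cf_pbw eqxx andbT /in_box /= ltn_predL (ltnW p_gt1) => /eqP.
by rewrite oner_eq0.
Qed.

Lemma twist_not_iso (phi : aug_aut eps) : phi X = X + s -> phi Y = Y -> phi Z = Z ->
  aut_inv phi X = X - s ->
  ~ rep_iso (tensor_rep (comult H) V V) (tensor_rep (twist phi (comult H)) V V).
Proof.
move=> pX pY pZ psX [P [Q [QP PQ PT]]].
have psi_fix g : phi g = g -> aut_inv phi g = g by move=> gE; rewrite -{1}gE autK.
have T0 g : primitive_elt H g -> tensor_rep (comult H) V V g = D g.
  by move=> gp; rewrite tensor_repE trep_prim.
have T2 g : primitive_elt H g -> phi g = g ->
    tensor_rep (twist phi (comult H)) V V g = D g.
  by move=> gp gE; rewrite tensor_rep_twist psi_fix // trep_prim // gE.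
(* The inverse of [phi] sends [X] to [X - s]. The summand [X] acts as [D (X + s)]; the summand [s]
   starts with the action of [Y], which divides [s] on the left and is fixed by [phi]. *)
have [N T2X] : exists N, tensor_rep (twist phi (comult H)) V V X = D (X + s) - D Y *m N.
  rewrite tensor_rep_twist psX.
  have sE : s = Y * (Y ^+ p.-2 * Z ^+ p.-1).
    by rewrite mulrA -exprS /socle; congr (_ ^+ _ * _); move: p_gt2; lia.
  exists (trep V phi (comult H (Y ^+ p.-2 * Z ^+ p.-1))).
  have -> : D Y *m trep V phi (comult H (Y ^+ p.-2 * Z ^+ p.-1)) = trep V phi (comult H s).
    by rewrite sE (trep_mul V phi _ primY) pY.
  rewrite -pX -(trep_prim V phi primX).
  have := trep_linear V phi (-1) (comult H s) (comult H X); rewrite !scaleN1r => E2.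
  have := comult_linear H (-1) s X; rewrite !scaleN1r => E.
  by rewrite (addrC X) E E2 addrC.
(* The left kernels of [N0] and [N2] are the spaces of forms killed by the generators in the
   untwisted and the twisted action. *)
pose N0 := row_mx (D X) (row_mx (D Y) (D Z)).
pose N2 := row_mx (D (X + s) - D Y *m N) (row_mx (D Y) (D Z)).
have ker3 m (B : 'M[k]_(m, d * d)) (C1 C2 C3 : 'M[k]_(d * d)) :
    B *m row_mx C1 (row_mx C2 C3) = 0 <-> [/\ B *m C1 = 0, B *m C2 = 0 & B *m C3 = 0].
  rewrite !mul_mx_row; split=> [E|[-> -> ->]]; last by rewrite !row_mx0.
  move: E; rewrite -(row_mx0 _ m (d * d) (d * d + d * d)) => /eq_row_mx[-> E].
  by move: E; rewrite -(row_mx0 _ m (d * d) (d * d)) => /eq_row_mx[-> ->].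
have TQ a : tensor_rep (comult H) V V a *m Q = Q *m tensor_rep (twist phi (comult H)) V V a.
  rewrite -[LHS]mul1mx -QP -[RHS]mulmx1 -PQ !mulmxA -(mulmxA Q P) PT.
  by rewrite -!mulmxA.
have k2 : kermx N2 *m N2 = 0 by exact: mulmx_ker.
have [k2X k2Y k2Z] := (ker3 _ _ _ _ _).1 k2.
have sub20 : (kermx N2 <= kermx N0)%MS.
  apply/sub_kermxP/ker3; split=> //; exact: (invariant_untwisted k2Y k2Z k2X).
have k0 : kermx N0 *m N0 = 0 by exact: mulmx_ker.
have [k0X k0Y k0Z] := (ker3 _ _ _ _ _).1 k0.
have sub02 : (kermx N0 *m Q <= kermx N2)%MS.
  apply/sub_kermxP/ker3; split.
  - by rewrite -T2X -mulmxA -TQ T0 // mulmxA k0X mul0mx.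
  - by rewrite -(T2 _ primY pY) -mulmxA -TQ T0 // mulmxA k0Y mul0mx.
  by rewrite -(T2 _ primZ pZ) -mulmxA -TQ T0 // mulmxA k0Z mul0mx.
have rQ : \rank (kermx N0 *m Q) = \rank (kermx N0).
  apply/eqP; rewrite eqn_leq mxrankM_maxl /= -{1}[kermx N0]mulmx1 -QP mulmxA.
  by rewrite mxrankM_maxl.
have [beta [bX bY bZ bs]] := invariant_form.
have b0 : (beta <= kermx N0)%MS by apply/sub_kermxP/ker3.
(* The isomorphism embeds the space of untwisted forms into that of the twisted ones, so the
   inclusion [sub20] becomes an equality. *)
have b2 : (beta <= kermx N2)%MS.
  have /eqmxP E : (kermx N2 == kermx N0)%MS.
    by rewrite -(geq_leqif (mxrank_leqif_eq sub20)) -rQ mxrankS.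
  by rewrite E.
have /ker3[b2X b2Y b2Z] : beta *m N2 = 0 by apply/sub_kermxP.
by move: bs; rewrite (invariant_socle b2Y b2Z b2X) eqxx.
Qed.

End NotIsomorphic.

Lemma rep_iso_sym (k : fieldType) (A : Type) (m n : nat)
    (rho : A -> 'M[k]_m) (sigma : A -> 'M[k]_n) : rep_iso rho sigma -> rep_iso sigma rho.
Proof.
move=> [P [Q [QP PQ PE]]]; exists Q, P; split=> // a.
by rewrite -[LHS]mulmx1 -PQ mulmxA -(mulmxA Q) -PE mulmxA QP mul1mx.
Qed.

(** * The isotropy and the noble point of the twisted structure *)

Section ShearIsotropy.
Variables (k : fieldType) (A : falgType k) (eps : {lrmorphism A -> k^o}) (H : hopf eps).
Variables (p : nat) (charp : p \in [pchar k]) (p_gt2 : (2 < p)%N) (X Y Z : A).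
Hypothesis heis : heis_triple p 1 X Y Z.
Hypothesis gen : left_generates X Y Z.
Hypothesis dimA : \dim {:A} = (p ^ 3)%N.
Hypotheses (primX : primitive_elt H X) (primY : primitive_elt H Y) (primZ : primitive_elt H Z).
Hypotheses (eX : eps X = 0) (eY : eps Y = 0) (eZ : eps Z = 0).
Hypothesis envelope : forall (B : algType k) (X' Y' Z' : B), heis_triple p 1 X' Y' Z' ->
  exists F : {lrmorphism A -> B}, [/\ F X = X', F Y = Y' & F Z = Z'].
Hypothesis uniq : forall (B : algType k) (F G : {lrmorphism A -> B}),
  F X = G X -> F Y = G Y -> F Z = G Z -> F =1 G.
Local Notation s := (socle p Y Z).

Let p_gt1 : (1 < p)%N. Proof. exact: ltnW. Qed.
Let p_gt0 : (0 < p)%N. Proof. exact: ltnW. Qed.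
Hypothesis Xp : X ^+ p = 0.
Local Notation Px := (point_of eps (base_point p_gt2 Xp)).

(** The quotient of A by [Y] and [Z]. It kills [s], so it does not distinguish [X] from [X + s], and
    the same map serves for both points. *)
Lemma theta_exists : exists theta : {lrmorphism A -> truncated k p},
  [/\ theta X = truncX k p, theta s = 0 & forall a, trunc_eps (theta a) = eps a].
Proof.
have T : heis_triple p 1 (truncX k p) 0 0.
  by split; rewrite ?mulr0 ?mul0r ?scaler0 ?addr0 //; split; rewrite ?truncXp // expr0n gtn_eqF.
have [F [FX FY FZ]] := envelope T; exists F; split=> //.
  rewrite /socle rmorphM rmorphXn /= FY expr0n.
  by rewrite (_ : (p.-1 == 0)%N = false) ?mul0r //; move: p_gt2; lia.
pose f a : k^o := trunc_eps (F a) - (eps a : k).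
have f_lin : linear f.
  by move=> c a b; rewrite /f linearP trunc_eps_lin linearP /= opprD addrACA -mulrBr.
pose f' := HB.pack_for {linear A -> k^o} f (GRing.isLinear.Build k A k^o *:%R f f_lin).
have fP a : (a \in lker (linfun f')) = (trunc_eps (F a) == (eps a : k)).
  by rewrite memv_ker lfunE /= subr_eq0.
move=> a; apply/eqP; rewrite -fP; apply: gen => [|w wW].
  by rewrite fP !rmorph1 trunc_eps1.
have st g : trunc_eps (F g) = 0 -> eps g = 0 -> g * w \in lker (linfun f').
  move=> Fg eg; rewrite fP !rmorphM /= trunc_epsM // Fg eg mul0r; apply/eqP.
  by rewrite (mul0r (eps w : k)).
have t0 : trunc_eps (0 : truncated k p) = 0 by rewrite /trunc_eps coef0.
by split; apply: st; rewrite ?FX ?FY ?FZ ?t0 ?trunc_epsX.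
Qed.

Lemma eps_socle : eps s = 0.
Proof.
rewrite /socle rmorphM rmorphXn /= eY expr0n (_ : (p.-1 == 0)%N = false) //.
  by rewrite [LHS](mul0r (_ : k)).
by move: p_gt2; lia.
Qed.

Lemma shear_aut_exists : exists phi : aug_aut eps,
  [/\ phi X = X + s, phi Y = Y, phi Z = Z & aut_inv phi X = X - s].
Proof.
have [F [FX FY FZ]] := envelope (shear_triple charp p_gt2 heis 1).
have [G [GX GY GZ]] := envelope (shear_triple charp p_gt2 heis (-1)).
rewrite scale1r in FX; rewrite scaleN1r in GX.
have Fs : F s = s by rewrite /socle rmorphM !rmorphXn /= FY FZ.
have Gs : G s = s by rewrite /socle rmorphM !rmorphXn /= GY GZ.
have FG : cancel F G.
  move=> a; have := @uniq A (G \o F) idfun; apply=> //=; rewrite ?FX ?FY ?FZ //.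
  by rewrite rmorphD /= GX Gs subrK.
have GF : cancel G F.
  move=> a; have := @uniq A (F \o G) idfun; apply=> //=; rewrite ?GX ?GY ?GZ //.
  by rewrite rmorphB /= FX Fs addrK.
have Fe a : eps (F a) = eps a.
  have := @uniq k^o (eps \o F) eps; apply=> //=; rewrite ?FY ?FZ //.
  by rewrite FX linearD /= eps_socle addr0.
by exists (AugAut FG GF Fe).
Qed.

Lemma base_point_closedX : closed_point eps Px.
Proof.
have [theta [tX _ te]] := theta_exists.
exact: (base_point_closed p_gt2 te Xp tX).
Qed.

Variable phi : aug_aut eps.
Hypotheses (pX : phi X = X + s) (pY : phi Y = Y) (pZ : phi Z = Z).

Lemma shear_tripleX : heis_triple p 1 (phi X) Y Z.
Proof. by have := shear_triple charp p_gt2 heis 1; rewrite scale1r -pX. Qed.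

Let tp : phi X ^+ p = 0. Proof. by case: shear_tripleX => _ _ _ []. Qed.

(** [theta] sends [phi X] to t as well, so its point is a homogeneous prime; by [shear_power] it
    contains the point of [X], which is closed. *)
Lemma shear_point : point_of eps (base_point p_gt2 tp) = Px.
Proof.
have [theta [tX ts te]] := theta_exists.
have tpX : theta (phi X) = truncX k p by rewrite pX rmorphD /= tX ts addr0.
have [homt _] := base_point_closed p_gt2 te tp tpX.
have [_ maxP] := base_point_closedX; apply: maxP => //.
have [e eE] := shear_power charp p_gt2 heis 1; rewrite scale1r -pX in eE.
have [co fr] := right_frame_exists p_gt0 p_gt1 heis gen dimA.
have uP : base_point p_gt2 tp (truncX k p) ^+ p.-1 = bc_in idfun e * bc_in idfun X.
  rewrite base_pointE powmapX //; last exact: bc_in_pth.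
  by rewrite -bc_inX eE bc_inM.
exact: (@point_inclusion k A eps p p_gt2 X Xp _ _ _ co fr k idfun (base_point p_gt2 tp) _ uP).
Qed.

Lemma shear_isotropy : isotropy phi Px.
Proof.
rewrite /isotropy aut_actE -[RHS]shear_point; congr point_of; apply/funext => r.
rewrite -[LHS]/(bc_aut phi (powmap (bc_in idfun X) r)).
rewrite -[RHS]/(powmap (bc_in idfun (phi X)) r) !powmapE // /bc_aut linear_sum; apply: eq_bigr => i _.
rewrite linearZ /= -!bc_inX bc_liftK ?rmorphXn // => c a b.
by rewrite linearP bc_in_linear.
Qed.

(** [phi X] is primitive for the twisted structure, so its powers span a Hopf subalgebra, and it
    defines the same point as [X]. *)
Lemma shear_noble : noble p (twisted_hopf H phi) Px.
Proof.
have pt : primitive_elt (twisted_hopf H phi) (phi X) by exact: twisted_primitive.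
have et : eps (phi X) = 0 by rewrite aut_eps.
have g : left_generates (phi X) Y Z.
  by have := @shear_generates k A p X Y Z 1 gen; rewrite scale1r -pX.
exists k, idfun, (base_point p_gt2 tp); split.
- have fl : flat (along (base_point p_gt2 tp)) by eapply flat_base_point; eassumption || exact: shear_tripleX.
  by eapply primitive_pi_point; eassumption.
- by rewrite shear_point.
exists (point_image p_gt2 tp); last exact: point_image_hopf.
by move=> b; exact: point_imageP.
Qed.

End ShearIsotropy.

Theorem proposition4p4p3
    (k : closedFieldType) (p : nat) (charp : p \in [pchar k]) (p_gt2 : (2 < p)%N)
    (* the Heisenberg Lie algebra *)
    (g : restricted_lie k p) (x y z : g) (xyz : basis_of fullv [:: x; y; z])
    (brxy : lbr x y = z) (brzx : lbr z x = 0) (brzy : lbr z y = 0)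
    (px : ppow x = 0) (py : ppow y = 0) (pz : ppow z = 0)
    (* A = u(g), with its augmentation and its primitively generated
       Hopf structure *)
    (A : falgType k) (inj : g -> A) (envA : is_envelope inj)
    (eps : {lrmorphism A -> k^o}) (eps_g : forall u, eps (inj u) = 0)
    (H0 : hopf eps)
    (prim : forall u, comult H0 (inj u) = tprod (inj u) 1 + tprod 1 (inj u)) :
  (exists t : g,
     [/\ has_order 1 t,
         exists phi : aug_aut eps,
           isotropy phi (nil_point inj eps 1 t) /\
           ~ rep_iso (tensor_rep (comult H0) (V1 inj eps t) (V1 inj eps t))
                     (tensor_rep (twist phi (comult H0))
                                 (V1 inj eps t) (V1 inj eps t))
       & pi_support p H0 (V1 inj eps t) = [set nil_point inj eps 1 t]%classic])
  /\ local_ring A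
  /\ ~ property_PA p H0.
Proof.
have T := inj_triple brxy brzx brzy px py pz envA.
have G := inj_generates charp p_gt2 xyz brxy brzx brzy px py pz envA.
have dimA := heis_dim charp p_gt2 xyz brxy brzx brzy px py pz envA.
have env := envelope_map charp p_gt2 xyz brxy brzx brzy px py pz envA.
have unq := envelope_unique xyz envA.
have eX := eps_g x; have eY := eps_g y; have eZ := eps_g z.
have primX : primitive_elt H0 (inj x) by exact: prim.
have primY : primitive_elt H0 (inj y) by exact: prim.
have primZ : primitive_elt H0 (inj z) by exact: prim.
have Xp : inj x ^+ p = 0 by case: T => _ _ _ [].
(* Holds by computation: both maps evaluate polynomials at [inj x], since order 1 means no
   restricted power is taken. *)
have PE : nil_point inj eps 1 x = point_of eps (base_point p_gt2 Xp) by [].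
have closedP : closed_point eps (point_of eps (base_point p_gt2 Xp)).
  by eapply base_point_closedX; eassumption.
have [phi [pX pY pZ psX]] : exists phi : aug_aut eps,
    [/\ phi (inj x) = inj x + socle p (inj y) (inj z), phi (inj y) = inj y,
        phi (inj z) = inj z & aut_inv phi (inj x) = inj x - socle p (inj y) (inj z)].
  by eapply shear_aut_exists; eassumption.
have supE : pi_support p H0 (V1 inj eps x) = [set nil_point inj eps 1 x]%classic.
  rewrite PE; apply/seteqP; split=> [P sP|_ ->].
    by eapply support_base_point; eassumption.
  by case: (closedP) => hp _; eapply base_point_support; eassumption.
have notiso : ~ rep_iso (tensor_rep (comult H0) (V1 inj eps x) (V1 inj eps x))
    (tensor_rep (twist phi (comult H0)) (V1 inj eps x) (V1 inj eps x)).
  have [q [ql qM qs qk]] := module_orbit eX.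
  by eapply twist_not_iso; eassumption.
have iso : isotropy phi (nil_point inj eps 1 x).
  by rewrite PE; eapply shear_isotropy; eassumption.
split; [|split].
- exists x; split=> //; last by exists phi.
  split=> //; split=> //; rewrite /nilset /=.
  move=> x0; have : x != 0 by apply: (free_not0 (basis_free xyz)); rewrite mem_head.
  by rewrite [x]x0 eqxx.
- apply: (nil_augmentation_local (eps := eps)).
  + by move=> c a b; rewrite linearP.
  + by move=> a b; rewrite rmorphM.
  + by rewrite rmorph1.
  move=> a ea; exists (4 * p)%N.
  by eapply augmentation_nilpotent; try eassumption; exact: ltnW (ltnW p_gt2).
(* The counterexample to Property PA is the twisted structure with [V] in both factors. *)
move=> PA; apply: notiso; apply: rep_iso_sym.
have sub : (pi_support p H0 (V1 inj eps x) `<=` [set nil_point inj eps 1 x])%classic.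
  by rewrite supE.
have cocomm : cocommutative (twisted_hopf H0 phi).
  by apply: twisted_cocommutative; exact: (primitive_cocommutative G).
have nob : noble p (twisted_hopf H0 phi) (nil_point inj eps 1 x).
  by rewrite PE; eapply shear_noble; eassumption.
exact: (PA (twisted_hopf H0 phi) cocomm (nil_point inj eps 1 x) closedP nob _ _ sub sub).
Qed.
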